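(* Let $\Psi$ be a function-free first-order sentence using at most two logical variables (an $\mathrm{FO}^2$ sentence) containing distinguished binary relation symbols $L$ and $S$. Then $\Psi \land \mathcal{L}(L) \land \mathcal{S}(S)$ is domain-liftable: for every pair of weighting functions $(w,\overline{w})$, $\mathrm{WFOMC}(\Psi \land \mathcal{L}(L) \land \mathcal{S}(S), n, w, \overline{w})$ can be computed in time polynomial in $n$.
   Context: All sentences are function-free first-order sentences interpreted over the finite domain $[n]=\{1,\dots,n\}$. A possible world interprets every relation of the sentence over the domain; a model is a possible world satisfying the sentence. A pair of weighting functions $(w,\overline{w})$ maps every relation symbol to a real number. The weight of a possible world $\omega$ is $\prod_{l} w(\mathrm{pred}(l))\cdot\prod_{l'}\overline{w}(\mathrm{pred}(l'))$, where $l$ ranges over the true ground atoms and $l'$ over the false ground atoms of $\omega$, and $\mathrm{pred}$ gives the relation symbol. $\mathrm{WFOMC}(\Phi,n,w,\overline{w})$ is the sum of the weights of all models of $\Phi$ over $[n]$. The linear order axiom $\mathcal{L}(L)$ requires that $L$ be interpreted as a linear order on the domain (reflexive, antisymmetric, transitive and total). The successor axiom $\mathcal{S}(S)$ requires that $S$ be interpreted as the successor relation of some linear order $\le'$ on the domain (which may differ from $L$), i.e. $S(x,y)$ holds iff $x <' y$ and there is no $z$ with $x <' z <' y$; equivalently, the directed graph of $S$ is a directed path through all domain elements. Domain-liftability concerns time complexity as a function of the domain size $n$ only, with the sentence and weighting functions fixed. *)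

(* Defs.v *)
(* MathComp world; [realType] is the type of real numbers of MathComp-Analysis. *)
From mathcomp Require Import all_boot all_order all_algebra.
From mathcomp Require Import boolp reals.

Set Implicit Arguments.
Unset Strict Implicit.
Unset Printing Implicit Defensive.

Import Order.TTheory GRing.Theory Num.Theory.

(** * Function-free first-order logic over a finite relational vocabulary *)

Section Logic.

Variables (sig : finType) (arity : sig -> nat).

(* Logical variables are named by natural numbers. *)
Inductive formula : Type :=
| FAtom (P : sig) (xs : (arity P).-tuple nat)
| FEq of nat & nat
| FNot of formula
| FAnd of formula & formula
| FOr of formula & formula
| FImp of formula & formula
| FForall of nat & formula
| FExists of nat & formula.

Fixpoint vars (f : formula) : seq nat :=
  match f with
  | FAtom _ xs => xs
  | FEq x y => [:: x; y]
  | FNot g => vars g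
  | FAnd g h | FOr g h | FImp g h => vars g ++ vars h
  | FForall x g | FExists x g => x :: vars g
  end.

Fixpoint free_vars (f : formula) : seq nat :=
  match f with
  | FAtom _ xs => xs
  | FEq x y => [:: x; y]
  | FNot g => free_vars g
  | FAnd g h | FOr g h | FImp g h => free_vars g ++ free_vars h
  | FForall x g | FExists x g => [seq y <- free_vars g | y != x]
  end.

Definition sentence (f : formula) : Prop := free_vars f = [::].

(* A variable may be quantified several times; only distinct names count. *)
Definition FO2 (f : formula) : Prop := size (undup (vars f)) <= 2.

(* The domain [n] = {1, ..., n} is represented by 'I_n. *)
Definition ground_atom (n : nat) : finType :=
  {P : sig & (arity P).-tuple 'I_n}.

(* A possible world is the set of its true ground atoms. *)
Definition world (n : nat) : finType := {set ground_atom n}.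

Definition holds n (om : world n) (P : sig) (ds : (arity P).-tuple 'I_n) : bool :=
  existT (fun Q : sig => (arity Q).-tuple 'I_n) P ds \in om.

Definition update n (e : nat -> 'I_n) (x : nat) (d : 'I_n) : nat -> 'I_n :=
  fun y => if y == x then d else e y.

Fixpoint eval n (om : world n) (e : nat -> 'I_n) (f : formula) : bool :=
  match f with
  | FAtom P xs => holds om (map_tuple e xs)
  | FEq x y => e x == e y
  | FNot g => ~~ eval om e g
  | FAnd g h => eval om e g && eval om e h
  | FOr g h => eval om e g || eval om e h
  | FImp g h => eval om e g ==> eval om e h
  | FForall x g => [forall d : 'I_n, eval om (update e x d) g]
  | FExists x g => [exists d : 'I_n, eval om (update e x d) g]
  end.

(* The truth value of a sentence does not depend on the assignment, so constant
   assignments suffice. Domains are nonempty: this is used for n > 0 only. *)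
Definition sat n (om : world n) (f : formula) : Prop :=
  forall d : 'I_n, eval om (fun=> d) f.

Definition binary n (om : world n) (P : sig) (arP : arity P = 2) : rel 'I_n :=
  fun x y => holds om (tcast (esym arP) [tuple x; y]).

Definition linear_order n (r : rel 'I_n) : Prop :=
  [/\ reflexive r, antisymmetric r, transitive r & total r].

Definition successor_of n (le s : rel 'I_n) : Prop :=
  let lt x y := le x y && (x != y) in
  forall x y, s x y <-> lt x y /\ ~ (exists z, lt x z /\ lt z y).

Definition linear_order_axiom n (om : world n) (L : sig) (arL : arity L = 2) : Prop :=
  linear_order (binary om arL).

Definition successor_axiom n (om : world n) (S : sig) (arS : arity S = 2) : Prop :=
  exists le : rel 'I_n, linear_order le /\ successor_of le (binary om arS).

(* A sentence with axioms that are not themselves first-order is given by its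
   class of models. *)
Definition model_class : Type := forall n, world n -> Prop.

Local Open Scope ring_scope.

Definition weight (F : comNzRingType) (w wbar : sig -> F) n (om : world n) : F :=
  (\prod_(a in om) w (tag a)) * (\prod_(a in ~: om) wbar (tag a)).

Definition WFOMC (F : comNzRingType) (Phi : model_class) (n : nat)
    (w wbar : sig -> F) : F :=
  \sum_(om : world n | `[< Phi n om >]) weight w wbar om.

End Logic.

(** * Random access machines over an ordered field

    The machine has index registers N[0], N[1], ... holding natural numbers and
    field registers X[0], X[1], ... holding elements of an ordered field F, both
    with indirect addressing. Index registers support only addition and truncated
    subtraction, so that they have O(t) bits after t instructions. The only field
    constants available to a program are 0 and 1: arbitrary real constants could
    encode infinitely many precomputed answers. *)

Inductive field_op := OpAdd | OpSub | OpMul | OpDiv.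

Inductive instr : Type :=
| NConst (i c : nat)                      (* N[i] := c           *)
| NAdd (i j k : nat)                      (* N[i] := N[j] + N[k] *)
| NSub (i j k : nat)                      (* N[i] := N[j] - N[k] *)
| NLoad (i j : nat)                       (* N[i] := N[N[j]]     *)
| NStore (i j : nat)                      (* N[N[i]] := N[j]     *)
| XConst (i : nat) (b : bool)             (* X[i] := b (0 or 1)  *)
| XOp (o : field_op) (i j k : nat)        (* X[i] := X[j] o X[k] *)
| XLoad (i j : nat)                       (* X[i] := X[N[j]]     *)
| XStore (i j : nat).                     (* X[N[i]] := X[j]     *)

Inductive test : Type :=
| NLe (i j : nat)                         (* N[i] <= N[j] *)
| XLe (i j : nat).                        (* X[i] <= X[j] *)

Inductive program : Type :=
| Skip
| Do of instr
| Seq of program & program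
| If of test & program & program
| While of test & program.

Section Machine.

Local Open Scope ring_scope.

(* [size x] is the cost of reading the field element x; it must be positive. *)
Variables (F : realFieldType) (size : F -> nat).

Record state : Type := State { regN : nat -> nat; regX : nat -> F }.

Definition set_reg (T : Type) (m : nat -> T) (i : nat) (v : T) : nat -> T :=
  fun j => if j == i then v else m j.

Definition setN (s : state) i v := State (set_reg (regN s) i v) (regX s).
Definition setX (s : state) i v := State (regN s) (set_reg (regX s) i v).

Definition field_op_fun (o : field_op) (x y : F) : F :=
  match o with
  | OpAdd => x + y
  | OpSub => x - y
  | OpMul => x * y
  | OpDiv => x / y
  end.

Definition step (a : instr) (s : state) : state :=
  match a with
  | NConst i c => setN s i c
  | NAdd i j k => setN s i (regN s j + regN s k)%N
  | NSub i j k => setN s i (regN s j - regN s k)%N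
  | NLoad i j => setN s i (regN s (regN s j))
  | NStore i j => setN s (regN s i) (regN s j)
  | XConst i b => setX s i b%:R
  | XOp o i j k => setX s i (field_op_fun o (regX s j) (regX s k))
  | XLoad i j => setX s i (regX s (regN s j))
  | XStore i j => setX s (regN s i) (regX s j)
  end.

Definition step_cost (a : instr) (s : state) : nat :=
  match a with
  | NConst _ _ | NAdd _ _ _ | NSub _ _ _ | NLoad _ _ | NStore _ _
  | XConst _ _ => 1
  | XOp _ _ j k => size (regX s j) + size (regX s k)
  | XLoad _ j => size (regX s (regN s j))
  | XStore _ j => size (regX s j)
  end.

Definition test_val (b : test) (s : state) : bool :=
  match b with
  | NLe i j => (regN s i <= regN s j)%N
  | XLe i j => regX s i <= regX s j
  end.

Definition test_cost (b : test) (s : state) : nat :=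
  match b with
  | NLe _ _ => 1
  | XLe i j => size (regX s i) + size (regX s j)
  end.

(* [exec p s t s']: started in s, p halts in s' after time t. *)
Inductive exec : program -> state -> nat -> state -> Prop :=
| exec_skip s : exec Skip s 1 s
| exec_do a s : exec (Do a) s (step_cost a s) (step a s)
| exec_seq p q s t s' t' s'' :
    exec p s t s' -> exec q s' t' s'' -> exec (Seq p q) s (t + t') s''
| exec_if b p q s t s' :
    exec (if test_val b s then p else q) s t s' ->
    exec (If b p q) s (test_cost b s + t) s'
| exec_while_stop b p s :
    ~~ test_val b s -> exec (While b p) s (test_cost b s) s
| exec_while_step b p s t s' t' s'' :
    test_val b s -> exec p s t s' -> exec (While b p) s' t' s'' ->
    exec (While b p) s (test_cost b s + t + t') s''.

Variable sig : finType.

(* N[0] = n, the first field registers hold the weights, the others are 0. *)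
Definition init (w wbar : sig -> F) (n : nat) : state :=
  State (fun i => if i is 0 then n else 0%N)
        (nth 0 ([seq w P | P <- enum sig] ++ [seq wbar P | P <- enum sig])).

(* The weights are fixed: the program and the polynomial may depend on them. The
   program receives n itself, so the bound is polynomial in n, not in log n. *)
Definition polytime_computable (w wbar : sig -> F) (f : nat -> F) : Prop :=
  exists (p : program) (c k : nat), forall n : nat, (0 < n)%N ->
    exists (t : nat) (s : state),
      [/\ exec p (init w wbar n) t s, (t <= c * n ^ k + c)%N & regX s 0 = f n].

End Machine.

Definition unit_size (F : realFieldType) (x : F) : nat := 1.

(* Number of binary digits of the numerator and of the denominator. *)
Definition bit_size (x : rat) : nat :=
  (trunc_log 2 `|numq x|).+1 + (trunc_log 2 `|denq x|).+1.

(* For real weights, arithmetic operations have unit cost (real RAM). Unit cost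
   alone would allow intermediate values with exponentially many digits; rational
   weights are therefore also required to be handled in polynomial time when
   operations are charged by the bit length of their operands. *)
Definition domain_liftable (R : realType) (sig : finType) (arity : sig -> nat)
    (Phi : model_class arity) : Prop :=
  (forall w wbar : sig -> R,
     polytime_computable (@unit_size R) w wbar (fun n => WFOMC Phi n w wbar)) /\
  (forall w wbar : sig -> rat,
     polytime_computable bit_size w wbar (fun n => WFOMC Phi n w wbar)).

(* Main.v *)
Require Import Defs.
From mathcomp Require Import all_boot all_order all_algebra.
From mathcomp Require Import fingroup perm.
From mathcomp Require Import boolp reals.
From mathcomp Require Import zify ring.

Set Implicit Arguments.
Unset Strict Implicit.
Unset Printing Implicit Defensive.

Import Order.TTheory GRing.Theory Num.Theory.

(* Relabelling makes [L] the standard order on {0, ..., n - 1}, at the price of a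
   factor n!, and [S] becomes the successor relation of a path, that is, of a
   permutation. Guess for every element the truth values of the quantified
   subformulas of [Psi]; Moebius inversion turns the conditions that the guesses be
   correct into products over pairs of elements. The sum over the possible worlds
   then factors, and the count is a sum over paths and labellings of the elements
   (by guesses and one-element substructures) of
     prod_x u(l x) * prod_(x < y) r(l x, l y, adjacency of x and y in the path).
   Paths are built by inserting the elements in the order [L]. An insertion separates
   two neighbours: only then is the weight of that pair known, and apart from it the
   weight of the insertion depends on the number of elements with each label alone.
   Hence the sum obeys a recurrence over counters, one for each label and one for
   each type of pair of neighbours, which dynamic programming evaluates with
   polynomially many additions and multiplications by constants. As a product of two
   computed values is never taken, all numbers have polynomially many bits. *)

(** * Loop programs and their compilation *)

(** An insertion can separate neighbours, but elements that are not neighbours never become so.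
    Hence the pairs of an inserted element with all earlier elements except its two neighbours get
    their final factor at once, and as it is above all of them in [L], these pairs are oriented
    alike. Only the pairs of current neighbours stay open; the gap counters remember their labels
    and orientation. Two kinds of atoms escape the pairwise description. Nullary atoms are recorded
    in every one-element substructure; a pair with different records contributes 0, and the first
    element of the path pays for their weight. Atoms with at least three distinct elements cannot be
    mentioned with two variables and give powers of [w P + wbar P]. The machine knows only the
    weights, 0 and 1, so the coefficients of the recurrence, which are integer polynomials in the
    weights, are computed by the program before [n] is read. For rational weights all values have a
    power of one common denominator as denominator, with an exponent linear in the number of
    steps. *)

Definition nreg : Type := (nat * nat)%type.

Definition upd (I : eqType) (T : Type) (m : I -> T) (i : I) (v : T) : I -> T :=
  fun j => if j == i then v else m j.

Section Loop.

Local Open Scope ring_scope.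

Variable F : realFieldType.

(* Multiplication is only by constants: the size of the values then grows
   linearly, not exponentially, in the number of steps. *)
Inductive loop : Type :=
| LNConst (r : nreg) (c : nat)
| LNAdd (r r1 r2 : nreg)
| LNSub (r r1 r2 : nreg)
| LXConst (i : nat) (b : bool)
| LXAdd (i j k : nat)
| LXMul (i j : nat) (x : F)
| LXLoad (i : nat) (r : nreg)
| LXStore (r : nreg) (i : nat)
| LSeq of loop & loop
| LRep (r : nreg) (p : loop).

(** Scalars are addressed statically and only the table [lT] is reached through an index, so that an
    indirect store cannot touch a scalar. *)
Record lstate : Type :=
  LState { lN : nreg -> nat; lX : nat -> F; lT : nat -> F }.

Definition setlN s r v := LState (upd (lN s) r v) (lX s) (lT s).
Definition setlX s i v := LState (lN s) (upd (lX s) i v) (lT s).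
Definition setlT s a v := LState (lN s) (lX s) (upd (lT s) a v).

Fixpoint sem (p : loop) (s : lstate) : lstate :=
  match p with
  | LNConst r c => setlN s r c
  | LNAdd r r1 r2 => setlN s r (lN s r1 + lN s r2)%N
  | LNSub r r1 r2 => setlN s r (lN s r1 - lN s r2)%N
  | LXConst i b => setlX s i b%:R
  | LXAdd i j k => setlX s i (lX s j + lX s k)
  | LXMul i j x => setlX s i (lX s j * x)
  | LXLoad i r => setlX s i (lT s (lN s r))
  | LXStore r i => setlT s (lN s r) (lX s i)
  | LSeq p q => sem q (sem p s)
  | LRep r p => iter (lN s r) (sem p) s
  end.

(** The count of a repetition is read once, on entry: every program halts and [steps] is total. The
    additional units pay for the counter of the compiled [While]. *)
Fixpoint steps (p : loop) (s : lstate) : nat :=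
  match p with
  | LSeq p q => (steps p s + steps q (sem p s))%N
  | LRep r p => (\sum_(i < lN s r) (steps p (iter i (sem p) s)).+1).+1
  | _ => 1%N
  end.

Fixpoint consts (p : loop) : seq F :=
  match p with
  | LXMul _ _ x => [:: x]
  | LSeq p q => consts p ++ consts q
  | LRep _ p => consts p
  | _ => [::]
  end.

Definition linit (n : nat) : lstate :=
  LState (upd (fun=> 0%N) (0, 0)%N n) (fun=> 0) (fun=> 0).

(** The subring generated by [W]. Without division, a common denominator of the weights controls the
    denominators of all constants. *)
Inductive generated (W : F -> Prop) : F -> Prop :=
| gen_in x : W x -> generated W x
| gen_bit (b : bool) : generated W b%:R
| gen_add x y : generated W x -> generated W y -> generated W (x + y)
| gen_sub x y : generated W x -> generated W y -> generated W (x - y)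
| gen_mul x y : generated W x -> generated W y -> generated W (x * y).

(** An abstract size measure that covers both cost models. A sum raises the common height of its
    operands by one and a product adds heights; multiplication by a fixed constant therefore raises
    the height by a fixed amount, and heights stay linear in the number of steps. *)
Record height_system (size : F -> nat) (W : F -> Prop) : Type := HeightSystem {
  height : nat -> F -> Prop;
  height_slope : nat;
  height_mono : forall m m' x, (m <= m')%N -> height m x -> height m' x;
  height_bit : forall b : bool, height 0 b%:R;
  height_add : forall m x y, height m x -> height m y -> height m.+1 (x + y);
  height_sub : forall m x y, height m x -> height m y -> height m.+1 (x - y);
  height_mul : forall m m' x y,
    height m x -> height m' y -> height (m + m') (x * y);
  height_size : forall m x, height m x -> (size x <= height_slope * m.+1)%N;
  height_W : forall x, W x -> height 1 x }.

(** ** Machine code *)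

Section Compile.

Local Open Scope nat_scope.

(* Constants are read from the registers [Q + i < M]; scalars and the table are
   interleaved from [M] on. *)
Variables (cs : seq F) (Q M : nat).

(** Index registers of the loop program are even from 2 on, which leaves [N[0] = n] alone; auxiliary
    ones are odd. [mH 0] holds the constant 1, [mH 1] and [mH 2] serve to compute addresses, and
    [mH (d + 3)] counts the rounds of a loop at nesting depth [d]. *)
Definition mN (r : nreg) : nat := (pickle r).*2.+2.
Definition mH (j : nat) : nat := j.*2.+1.
Definition mX (i : nat) : nat := M + i.*2.
Definition mT (a : nat) : nat := M + a.*2.+1.

Definition address (r : nreg) : program :=
  Seq (Do (NAdd (mH 1) (mN r) (mN r)))
  (Seq (Do (NConst (mH 2) M.+1)) (Do (NAdd (mH 1) (mH 1) (mH 2)))).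

Fixpoint compile (d : nat) (p : loop) : program :=
  match p with
  | LNConst r c => Do (NConst (mN r) c)
  | LNAdd r r1 r2 => Do (NAdd (mN r) (mN r1) (mN r2))
  | LNSub r r1 r2 => Do (NSub (mN r) (mN r1) (mN r2))
  | LXConst i b => Do (XConst (mX i) b)
  | LXAdd i j k => Do (XOp OpAdd (mX i) (mX j) (mX k))
  | LXMul i j x => Do (XOp OpMul (mX i) (mX j) (Q + index x cs))
  | LXLoad i r => Seq (address r) (Do (XLoad (mX i) (mH 1)))
  | LXStore r i => Seq (address r) (Do (XStore (mH 1) (mX i)))
  | LSeq p q => Seq (compile d p) (compile d q)
  | LRep r p =>
      Seq (Seq (Do (NConst (mH (d + 3)) 0))
               (Do (NAdd (mH (d + 3)) (mH (d + 3)) (mN r))))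
        (While (NLe (mH 0) (mH (d + 3)))
          (Seq (compile d.+1 p) (Do (NSub (mH (d + 3)) (mH (d + 3)) (mH 0)))))
  end.

Definition simulates (s : state F) (a : lstate) : Prop :=
  [/\ forall r, regN s (mN r) = lN a r,
      regN s (mH 0) = 1%N,
      forall i, regX s (mX i) = lX a i,
      forall i, regX s (mT i) = lT a i
    & forall x, x \in cs -> regX s (Q + index x cs) = x].

Lemma mN_inj r r' : (mN r == mN r') = (r == r').
Proof.
apply/eqP/eqP => [|-> //]; rewrite /mN => rr.
by apply: (pcan_inj pickleK); lia.
Qed.

Lemma mNH r j : (mN r == mH j) = false.
Proof. by apply/eqP; rewrite /mN /mH; lia. Qed.

Lemma mHN r j : (mH j == mN r) = false.
Proof. by rewrite eq_sym mNH. Qed.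

Lemma mH_inj i j : (mH i == mH j) = (i == j).
Proof. by apply/eqP/eqP => [|-> //]; rewrite /mH; lia. Qed.

Lemma mX_inj i j : (mX i == mX j) = (i == j).
Proof. by apply/eqP/eqP => [|-> //]; rewrite /mX; lia. Qed.

Lemma mT_inj i j : (mT i == mT j) = (i == j).
Proof. by apply/eqP/eqP => [|-> //]; rewrite /mT; lia. Qed.

Lemma mXT i j : (mX i == mT j) = false.
Proof. by apply/eqP; rewrite /mX /mT; lia. Qed.

Lemma mTX i j : (mT i == mX j) = false.
Proof. by rewrite eq_sym mXT. Qed.

Variables (size : F -> nat) (W : F -> Prop) (hs : height_system size W).
Variable grow : nat.
Hypothesis grow_gt0 : (0 < grow)%N.
Hypothesis cs_height : forall x, x \in cs -> height hs grow x.
Hypothesis QM : (Q + seq.size cs <= M)%N.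

Definition bounded h (s : state F) : Prop := forall r, height hs h (regX s r).

(** An arithmetic instruction reads two field elements of height at most [h]; the 6 is slack for
    address computations and loop bookkeeping. *)
Definition cost (h : nat) : nat := (2 * (height_slope hs * h.+1) + 6)%N.

Lemma cost_mono h h' : (h <= h')%N -> (cost h <= cost h')%N.
Proof. by move=> hh; rewrite /cost leq_add2r leq_mul2l leq_mul2l ltnS hh !orbT. Qed.

Lemma const_lt x : x \in cs -> Q + index x cs < M.
Proof. by rewrite -index_mem => ix; apply: leq_trans QM; rewrite ltn_add2l. Qed.

Lemma mCX i x : x \in cs -> (Q + index x cs == mX i) = false.
Proof. by move/const_lt=> ix; apply/eqP; rewrite /mX; lia. Qed.

Lemma mCT i x : x \in cs -> (Q + index x cs == mT i) = false.
Proof. by move/const_lt=> ix; apply/eqP; rewrite /mT; lia. Qed.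

Definition mE := (mN_inj, mNH, mHN, mH_inj, mX_inj, mT_inj, mXT, mTX).

(* Counters of the enclosing loops. *)
Definition same_counters d (s s' : state F) : Prop :=
  forall j, (j < d)%N -> regN s' (mH (j + 3)) = regN s (mH (j + 3)).

(** Each of the [n] steps raises heights by at most [grow] and is charged at the largest height
    reached at the end, so the time is at most quadratic in [n]. *)
Definition exec_ok (p : program) d (s : state F) a' h n : Prop :=
  exists t s', [/\ exec size p s t s', (t <= n * cost (h + grow * n))%N,
    simulates s' a', bounded (h + grow * n) s' & same_counters d s s'].

Lemma bounded_mono h h' s : (h <= h')%N -> bounded h s -> bounded h' s.
Proof. by move=> hh hb r; apply: height_mono (hb r). Qed.

Lemma bounded_set h h' s i v : (h <= h')%N ->
  bounded h s -> height hs h' v -> bounded h' (Defs.setX s i v).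
Proof.
move=> hh hb hv r; rewrite /= /set_reg; case: eqP => // _.
exact: height_mono (hb r).
Qed.

Lemma exec_address r s a : simulates s a ->
  exists s', [/\ exec size (address r) s (1 + (1 + 1)) s',
    simulates s' a, regX s' = regX s,
    regN s' (mH 1) = mT (lN a r)
    & forall j, (3 <= j)%N -> regN s' (mH j) = regN s (mH j)].
Proof.
case=> sN s1 sX sT sC.
eexists; split.
- by apply: exec_seq; [|apply: exec_seq]; apply: exec_do.
- split=> //=; first by move=> r'; rewrite /set_reg !mE.
- by [].
- by rewrite /= /set_reg /= !sN /mT; lia.
- by move=> j j3; rewrite /= /set_reg !mE; case: j j3 => [|[|[|]]].
Qed.

(** The height grows by one for a sum and by [grow] for a product, because the second factor is a
    constant from [cs]. Sequences and loops charge every part at the final height, by monotonicity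
    of [cost]. *)
Lemma compile_exec p : {subset consts p <= cs} -> forall d s a h,
  simulates s a -> bounded h s ->
  exec_ok (compile d p) d s (sem p a) h (steps p a).
Proof.
elim: p => [r c|r r1 r2|r r1 r2|i b|i j k|i j x|i r|r i|p IHp q IHq|r p IHp] /=
  csub d s a h sim bd.
- exists 1%N; eexists; split; [exact: exec_do | rewrite /cost; lia | | |].
  + case: sim => sN s1 sX sT sC; split=> //=.
    by move=> r'; rewrite /set_reg /upd mE; case: eqP.
  + by apply: bounded_mono bd; lia.
  + by move=> j jd /=; rewrite /set_reg mE.
- exists 1%N; eexists; split; [exact: exec_do | rewrite /cost; lia | | |].
  + case: sim => sN s1 sX sT sC; split=> //=.
    by move=> r'; rewrite /set_reg /upd mE !sN.
  + by apply: bounded_mono bd; lia.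
  + by move=> j jd /=; rewrite /set_reg mE.
- exists 1%N; eexists; split; [exact: exec_do | rewrite /cost; lia | | |].
  + case: sim => sN s1 sX sT sC; split=> //=.
    by move=> r'; rewrite /set_reg /upd mE !sN.
  + by apply: bounded_mono bd; lia.
  + by move=> j jd /=; rewrite /set_reg mE.
- exists 1%N; eexists; split; [exact: exec_do | rewrite /cost; lia | | |].
  + case: sim => sN s1 sX sT sC; split=> //=.
    * by move=> j; rewrite /set_reg /upd mE; case: eqP.
    * by move=> j; rewrite /set_reg mE.
    * by move=> x xcs; rewrite /set_reg mCX // sC.
  + apply: bounded_set (bd) _; first by lia.
    by apply: height_mono (height_bit hs b); lia.
  + by [].
- exists (step_cost size (XOp OpAdd (mX i) (mX j) (mX k)) s); eexists.
  split; [exact: exec_do | | | |].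
  + have hj := height_size (bd (mX j)); have hk := height_size (bd (mX k)).
    rewrite /= mul1n; apply: leq_trans (cost_mono (leq_addr _ _)).
    by rewrite /cost; lia.
  + case: sim => sN s1 sX sT sC; split=> //=.
    * by move=> l; rewrite /set_reg /upd mE !sX.
    * by move=> l; rewrite /set_reg mE.
    * by move=> x xcs; rewrite /set_reg mCX // sC.
  + apply: bounded_set (bd) _; first by lia.
    by apply: height_mono (height_add (bd _) (bd _)); lia.
  + by [].
- exists (step_cost size (XOp OpMul (mX i) (mX j) (Q + index x cs)) s).
  have xcs : x \in cs by apply: csub; rewrite inE.
  eexists; split; [exact: exec_do | | | |].
  + have hj := height_size (bd (mX j)).
    have hk := height_size (bd (Q + index x cs)%N).
    rewrite /= mul1n; apply: leq_trans (cost_mono (leq_addr _ _)).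
    by rewrite /cost; lia.
  + case: sim => sN s1 sX sT sC; split=> //=.
    * by move=> l; rewrite /set_reg /upd mE !sX sC.
    * by move=> l; rewrite /set_reg mE.
    * by move=> y ycs; rewrite /set_reg mCX // sC.
  + apply: bounded_set (bd) _; first by lia.
    rewrite muln1 /=; case: sim => sN s1 sX sT ->//.
    by apply: height_mul; [exact: bd | exact: cs_height].
  + by [].
- have [s1 [ex1 sim1 X1 N1 C1]] := exec_address r sim.
  exists (1 + (1 + 1) + step_cost size (XLoad (mX i) (mH 1)) s1)%N.
  eexists; split; [apply: exec_seq ex1 _; exact: exec_do | | | |].
  + have hj := height_size (bd (regN s1 (mH 1))).
    rewrite /= mul1n X1; apply: leq_trans (cost_mono (leq_addr _ _)).
    by rewrite /cost; lia.
  + case: sim1 => sN s11 sX sT sC; split=> //=.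
    * by move=> l; rewrite /set_reg /upd mE N1 sT; case: eqP.
    * by move=> l; rewrite /set_reg mE.
    * by move=> y ycs; rewrite /set_reg mCX // sC.
  + have bd1 : bounded h s1 by move=> l; rewrite X1; exact: bd.
    apply: bounded_set (bd1) _; first by lia.
    by apply: height_mono (bd1 _); lia.
  + by move=> j jd /=; rewrite C1 //; lia.
- have [s1 [ex1 sim1 X1 N1 C1]] := exec_address r sim.
  exists (1 + (1 + 1) + step_cost size (XStore (mH 1) (mX i)) s1)%N.
  eexists; split; [apply: exec_seq ex1 _; exact: exec_do | | | |].
  + have hj := height_size (bd (mX i)).
    rewrite /= mul1n X1; apply: leq_trans (cost_mono (leq_addr _ _)).
    by rewrite /cost; lia.
  + case: sim1 => sN s11 sX sT sC; split=> //=.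
    * by move=> l; rewrite /set_reg N1 mE.
    * by move=> l; rewrite /set_reg /upd N1 mE sX; case: eqP.
    * by move=> y ycs; rewrite /set_reg N1 mCT // sC.
  + have bd1 : bounded h s1 by move=> l; rewrite X1; exact: bd.
    apply: bounded_set (bd1) _; first by lia.
    by apply: height_mono (bd1 _); lia.
  + by move=> j jd /=; rewrite C1 //; lia.
- have csp : {subset consts p <= cs} by move=> x xp; apply: csub; rewrite mem_cat xp.
  have csq : {subset consts q <= cs}
    by move=> x xq; apply: csub; rewrite mem_cat xq orbT.
  have [t1 [s1 [ex1 le1 sim1 bd1 C1]]] := IHp csp d s a h sim bd.
  have [t2 [s2 [ex2 le2 sim2 bd2 C2]]] := IHq csq d s1 _ _ sim1 bd1.
  exists (t1 + t2)%N, s2; split=> //.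
  + exact: exec_seq ex1 ex2.
  + rewrite mulnDl; apply: leq_add.
      by apply: (leq_trans le1); rewrite leq_mul2l cost_mono ?orbT //; lia.
    by apply: (leq_trans le2); rewrite leq_mul2l cost_mono ?orbT //; lia.
  + by apply: bounded_mono bd2; lia.
  + by move=> j jd; rewrite C2 // C1.
- set ctr := mH (d + 3).
  (* The body is compiled at depth [d.+1], so [same_counters d.+1] protects the counter [ctr] of
     this loop from it. *)
  have loop k : forall s a h, simulates s a -> bounded h s -> regN s ctr = k ->
      exists t s', [/\ exec size (While (NLe (mH 0) ctr)
          (Seq (compile d.+1 p) (Do (NSub ctr ctr (mH 0))))) s t s',
        (t <= let n := \sum_(i < k) (steps p (iter i (sem p) a)).+1 in
           n * cost (h + grow * n) + 1)%N,
        simulates s' (iter k (sem p) a),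
        bounded (h + grow * \sum_(i < k) (steps p (iter i (sem p) a)).+1) s'
      & same_counters d s s'].
    elim: k => [|k IHk] {}s {}a {}h {}sim {}bd sk.
      exists 1%N, s; split=> //; last first.
      - by apply: bounded_mono bd; lia.
      - exact: leq_addl.
      - apply: (@exec_while_stop _ _ (NLe (mH 0) ctr)) => /=.
        by case: sim => _ -> *; rewrite sk.
    have [t1 [s1 [ex1 le1 sim1 bd1 C1]]] := IHp csub d.+1 s a h sim bd.
    pose s2 := step (NSub ctr ctr (mH 0)) s1.
    have sim2 : simulates s2 (sem p a).
      case: sim1 => sN s11 sX sT sC; split=> //=.
        by move=> r'; rewrite /set_reg mE.
      by rewrite /set_reg mE; case: eqP => //; lia.
    have s2k : regN s2 ctr = k.
      rewrite /= /set_reg eqxx C1 // sk.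
      by case: sim1 => _ -> *; rewrite subn1.
    have [t3 [s3 [ex3 le3 sim3 bd3 C3]]] := IHk s2 _ _ sim2 bd1 s2k.
    have E : (\sum_(i < k.+1) (steps p (iter i (sem p) a)).+1 = (steps p a).+1
        + \sum_(i < k) (steps p (iter i (sem p) (sem p a))).+1)%N.
      rewrite big_ord_recl /=; congr addn; apply: eq_bigr => i _.
      by rewrite -iterSr.
    exists (1 + (t1 + 1) + t3)%N, s3; split.
    + apply: (@exec_while_step _ _ (NLe (mH 0) ctr) _ _ _ _ _ _ _ _ ex3).
        by rewrite /=; case: sim => _ -> *; rewrite sk.
      by apply: exec_seq ex1 _; exact: exec_do.
    + rewrite E /=; move: le3; rewrite /=; set m := \sum_(i < k) _ => le3.
      set c := cost (h + grow * ((steps p a).+1 + m))%N.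
      have c2 : (2 <= c)%N by rewrite /c /cost; lia.
      have {}le1 : (t1 <= steps p a * c)%N.
        by apply: (leq_trans le1); rewrite leq_mul2l cost_mono ?orbT //; lia.
      have {}le3 : (t3 <= m * c + 1)%N.
        apply: (leq_trans le3); rewrite leq_add2r leq_mul2l cost_mono ?orbT //.
        lia.
      by rewrite mulnDl mulSn; move: c2 le1 le3; lia.
    + by rewrite iterSr.
    + rewrite E; apply: bounded_mono bd3; lia.
    + move=> j jd; rewrite C3 // /= /set_reg mE eqn_add2r (ltn_eqF jd) C1 //.
      by lia.
  pose s1 := step (NAdd ctr ctr (mN r)) (step (NConst ctr 0) s).
  have sim1 : simulates s1 a.
    case: sim => sN s11 sX sT sC; split=> //=.
      by move=> r'; rewrite /set_reg !mE.
    by rewrite /set_reg !mE; case: eqP => //; lia.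
  have s1k : regN s1 ctr = lN a r.
    by rewrite /= /set_reg eqxx mE /=; case: sim => ->.
  have bd1 : bounded h s1 by [].
  have [t3 [s3 [ex3 le3 sim3 bd3 C3]]] := loop _ s1 a h sim1 bd1 s1k.
  exists (1 + 1 + t3)%N, s3; split=> //.
  + apply: exec_seq ex3.
    by apply: exec_seq; exact: exec_do.
  + move: le3; rewrite /=; set m := \sum_(i < _) _ => le3.
    rewrite mulSn; set c := cost _.
    have c3 : (3 <= c)%N by rewrite /c /cost; lia.
    have {}le3 : (t3 <= m * c + 1)%N.
      apply: (leq_trans le3); rewrite leq_add2r leq_mul2l cost_mono ?orbT //.
      lia.
    have aux mc c' t : 3 <= c' -> t <= mc + 1 -> 1 + 1 + t <= c' + mc by lia.
    exact: aux.
  + by apply: bounded_mono bd3; rewrite leq_add2l leq_mul2l leqnSn orbT.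
  + by move=> j jd; rewrite C3 // /= /set_reg !mE eqn_add2r (ltn_eqF jd).
Qed.

End Compile.

End Loop.

(** * Polynomial bounds *)

Definition poly_bounded (f : nat -> nat) : Prop :=
  exists c k : nat, forall n, f n <= c * n.+1 ^ k.

Lemma poly_bounded_le f g :
  (forall n, f n <= g n) -> poly_bounded g -> poly_bounded f.
Proof. by move=> fg [c [k gb]]; exists c, k => n; apply: leq_trans (gb n). Qed.

Lemma poly_bounded_const c : poly_bounded (fun=> c).
Proof. by exists c, 0 => n; rewrite expn0 muln1. Qed.

Lemma poly_bounded_id : poly_bounded id.
Proof. by exists 1, 1 => n; rewrite expn1 mul1n. Qed.

Lemma poly_bounded_add f g :
  poly_bounded f -> poly_bounded g -> poly_bounded (fun n => f n + g n).
Proof.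
move=> [c [k fb]] [c' [k' gb]]; exists (c + c'), (k + k') => n.
rewrite mulnDl; apply: leq_add.
  by apply: leq_trans (fb n) _; rewrite leq_mul2l leq_pexp2l ?orbT ?leq_addr.
by apply: leq_trans (gb n) _; rewrite leq_mul2l leq_pexp2l ?orbT ?leq_addl.
Qed.

Lemma poly_bounded_succ f : poly_bounded f -> poly_bounded (fun n => (f n).+1).
Proof.
move=> fb; apply: poly_bounded_le (poly_bounded_add fb (poly_bounded_const 1)).
by move=> n; rewrite addn1.
Qed.

Lemma poly_bounded_mul f g :
  poly_bounded f -> poly_bounded g -> poly_bounded (fun n => f n * g n).
Proof.
move=> [c [k fb]] [c' [k' gb]]; exists (c * c'), (k + k') => n.
by rewrite expnD mulnACA leq_mul.
Qed.

Lemma poly_bounded_exp f k :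
  poly_bounded f -> poly_bounded (fun n => f n ^ k).
Proof.
move=> fb; elim: k => [|k IHk].
  by apply: poly_bounded_le (poly_bounded_const 1) => n; rewrite expn0.
by apply: poly_bounded_le (poly_bounded_mul fb IHk) => n; rewrite expnS.
Qed.

Lemma poly_bounded_sum (I : Type) (r : seq I) (f : I -> nat -> nat) :
  (forall i, poly_bounded (f i)) -> poly_bounded (fun n => \sum_(i <- r) f i n).
Proof.
move=> fb; elim: r => [|i r IHr].
  by apply: poly_bounded_le (poly_bounded_const 0) => n; rewrite big_nil.
apply: (@poly_bounded_le _ (fun n => f i n + \sum_(j <- r) f j n)).
  by move=> n; rewrite big_cons.
exact: poly_bounded_add.
Qed.

(** Powers of [n.+1] are positive and monotone in the exponent, which makes the closure lemmas
    uniform; for positive [n], [n.+1 <= 2 * n] brings back powers of [n]. *)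
Lemma poly_bounded_shape f : poly_bounded f ->
  exists c k : nat, forall n, 0 < n -> f n <= c * n ^ k + c.
Proof.
move=> [c [k fb]]; exists (c * 2 ^ k), k => n n_gt0.
apply: leq_trans (fb n) (leq_trans _ (leq_addr _ _)).
rewrite -mulnA -expnMn leq_mul2l; apply/orP; right.
by case: k {fb} => // k; rewrite leq_exp2r //; lia.
Qed.

(** * Computing the constants of a program from the weights *)

Section CompileCorrect.

Variables (F : realFieldType) (size : F -> nat) (W : F -> Prop).
Variable hs : height_system size W.

(** Finite support matters because the scalars and the table of the loop program must start at 0 in
    the registers beyond it. *)
Definition tame (X : nat -> F) : Prop :=
  (exists h, forall r, height hs h (X r)) /\
  (exists M, forall r, M <= r -> X r = 0%R).

Lemma tame_set X i v : tame X -> (exists h, height hs h v) -> tame (set_reg X i v).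
Proof.
move=> [[h Xh] [M XM]] [h' vh]; split.
  exists (maxn h h') => r; rewrite /set_reg; case: eqP => _.
    by apply: height_mono vh; exact: leq_maxr.
  by apply: height_mono (Xh r); exact: leq_maxl.
exists (maxn M i.+1) => r; rewrite geq_max /set_reg => /andP[Mr ir].
by rewrite gtn_eqF // XM.
Qed.

(** The code works for every [N] and leaves it unchanged, so its result and its time [t] do not
    depend on the size of the domain. *)
Definition straight p X t X' : Prop :=
  forall N, exec size p (State N X) t (State N X').

Lemma straight_seq p q X t X' t' X'' :
  straight p X t X' -> straight q X' t' X'' ->
  straight (Seq p q) X (t + t') X''.
Proof. by move=> ex ex' N; exact: exec_seq (ex N) (ex' N). Qed.

Lemma straight_op o i j k X : straight (Do (XOp o i j k)) X
  (size (X j) + size (X k)) (set_reg X i (field_op_fun o (X j) (X k))).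
Proof. by move=> N; exact: (exec_do _ (XOp o i j k) (State N X)). Qed.

Lemma straight_const i b X :
  straight (Do (XConst i b)) X 1 (set_reg X i b%:R%R).
Proof. by move=> N; exact: (exec_do _ (XConst i b) (State N X)). Qed.

Variable K : nat.

Definition available (X : nat -> F) : Prop :=
  forall x, W x -> exists2 r, r < K & X r = x.

Lemma available_agree X X' d : K <= d -> (forall r, r < d -> X' r = X r) ->
  available X -> available X'.
Proof.
move=> Kd XX av x /av[r rK <-]; exists r => //; apply: XX.
exact: leq_trans rK Kd.
Qed.

Lemma generated_height x : generated W x -> exists h, height hs h x.
Proof.
elim=> {x} [x Wx|b|x y _ [h hx] _ [h' hy]|x y _ [h hx] _ [h' hy]
           |x y _ [h hx] _ [h' hy]].
- by exists 1; exact: height_W.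
- by exists 0; exact: height_bit.
- exists (h + h').+1; apply: height_add.
    by apply: height_mono hx; rewrite leq_addr.
  by apply: height_mono hy; rewrite leq_addl.
- exists (h + h').+1; apply: height_sub.
    by apply: height_mono hx; rewrite leq_addr.
  by apply: height_mono hy; rewrite leq_addl.
- by exists (h + h'); exact: height_mul.
Qed.

(** Stack discipline: code writes at [d] and above only. The left operand in [d] survives the
    evaluation of the right one in [d.+1], and the weights, stored below [K <= d], are never
    lost. *)
Definition produces x d X : Prop := exists p t X',
  [/\ straight p X t X', X' d = x, forall r, r < d -> X' r = X r & tame X'].

Lemma produces_op o x y d X : tame X -> available X -> K <= d ->
  (exists h, height hs h (field_op_fun o x y)) ->
  (forall d' X', K <= d' -> tame X' -> available X' -> produces x d' X') ->
  (forall d' X', K <= d' -> tame X' -> available X' -> produces y d' X') ->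
  produces (field_op_fun o x y) d X.
Proof.
move=> tX avX Kd hv px py.
have [p [t [X1 [ex1 X1d X1r tX1]]]] := px d X Kd tX avX.
have Kd1 : K <= d.+1 by exact: leqW.
have [q [t' [X2 [ex2 X2d X2r tX2]]]] :=
  py d.+1 X1 Kd1 tX1 (available_agree Kd X1r avX).
exists (Seq p (Seq q (Do (XOp o d d d.+1)))); do 2 eexists; split.
- apply: straight_seq ex1 (straight_seq ex2 (straight_op _ _ _ _ _)).
- by rewrite /= /set_reg eqxx X2d X2r // X1d.
- by move=> r rd; rewrite /= /set_reg ltn_eqF // X2r ?X1r // ltnW.
- by apply: tame_set; rewrite //= X2d X2r // X1d.
Qed.

Lemma generated_produced x : generated W x -> forall d X,
  K <= d -> tame X -> available X -> produces x d X.
Proof.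
move=> gx; have hx := generated_height gx.
elim: gx hx => {x} [x Wx|b|x y gx IHx gy IHy|x y gx IHx gy IHy|x y gx IHx gy IHy]
  hx d X Kd tX avX.
- have [r rK Xr] := avX x Wx.
  (* A copy is made as [0 + x], which leaves the index registers alone. *)
  exists (Seq (Do (XConst d false)) (Do (XOp OpAdd d d r))); do 2 eexists; split.
  + exact: straight_seq (straight_const _ _ _) (straight_op _ _ _ _ _).
  + by rewrite /= /set_reg eqxx ltn_eqF ?add0r //; exact: leq_trans rK Kd.
  + by move=> r' r'd; rewrite /= /set_reg ltn_eqF.
  + apply: tame_set.
      by apply: tame_set => //; exists 0; exact: (height_bit _ false).
    rewrite /= /set_reg eqxx ltn_eqF ?add0r ?Xr //; exact: leq_trans rK Kd.
- exists (Do (XConst d b)); do 2 eexists; split.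
  + exact: straight_const.
  + by rewrite /= /set_reg eqxx.
  + by move=> r' r'd; rewrite /= /set_reg ltn_eqF.
  + by apply: tame_set.
- apply: (@produces_op OpAdd) => // d' X' *.
    by apply: IHx => //; exact: generated_height.
  by apply: IHy => //; exact: generated_height.
- apply: (@produces_op OpSub) => // d' X' *.
    by apply: IHx => //; exact: generated_height.
  by apply: IHy => //; exact: generated_height.
- apply: (@produces_op OpMul) => // d' X' *.
    by apply: IHx => //; exact: generated_height.
  by apply: IHy => //; exact: generated_height.
Qed.

Lemma generated_list (cs : seq F) : (forall x, x \in cs -> generated W x) ->
  forall d X, K <= d -> tame X -> available X ->
  exists p t X', [/\ straight p X t X',
    forall i, i < seq.size cs -> X' (d + i) = nth 0%R cs i,
    forall r, r < d -> X' r = X r & tame X'].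
Proof.
elim: cs => [|x cs IHcs] gcs d X Kd tX avX.
  by exists Skip, 1, X; split=> // N; exact: exec_skip.
have gx : generated W x by apply: gcs; rewrite mem_head.
have [p [t [X1 [ex1 X1d X1r tX1]]]] := generated_produced gx Kd tX avX.
have gcs' y : y \in cs -> generated W y by move=> yc; apply: gcs; rewrite inE yc orbT.
have Kd1 : K <= d.+1 by exact: leqW.
have [q [t' [X2 [ex2 X2d X2r tX2]]]] :=
  IHcs gcs' d.+1 X1 Kd1 tX1 (available_agree Kd X1r avX).
exists (Seq p q), (t + t'), X2; split=> //.
- exact: straight_seq ex1 ex2.
- case=> [_|i]; first by rewrite addn0 X2r.
  by rewrite /= ltnS addnS -addSn; exact: X2d.
- by move=> r rd; rewrite X2r ?X1r // ltnW.
Qed.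

End CompileCorrect.

Section CompileTheorem.

Variables (F : realFieldType) (size : F -> nat) (sig : finType).
Variables (w wbar : sig -> F).

Definition weights : F -> Prop := fun x => exists P, x = w P \/ x = wbar P.

Variable hs : height_system size weights.

(** Straight-line code computes the constants in a time [t0] that does not depend on [n]; then the
    compiled loop program runs, and its scalar 0 is copied to the output register. *)
Lemma compile_correct (p : loop F) :
  (forall x, x \in consts p -> generated weights x) ->
  poly_bounded (fun n => steps p (linit F n)) ->
  polytime_computable size w wbar (fun n => lX (sem p (linit F n)) 0).
Proof.
move=> gen_p poly_p.
pose X0 := nth 0%R ([seq w P | P <- enum sig] ++ [seq wbar P | P <- enum sig]).
pose K := #|sig| + #|sig|.
have X0w P : exists2 r, r < K & X0 r = w P.
  exists (enum_rank P); first by rewrite ltn_addr // ltn_ord.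
  rewrite /X0 nth_cat size_map -?enumT -cardT ltn_ord (nth_map P) -?cardT ?ltn_ord //.
  by rewrite nth_enum_rank.
have X0wbar P : exists2 r, r < K & X0 r = wbar P.
  exists (#|sig| + enum_rank P); first by rewrite ltn_add2l ltn_ord.
  rewrite /X0 nth_cat size_map -?enumT -cardT ltnNge leq_addr /= addKn.
  by rewrite (nth_map P) -?cardT ?ltn_ord // nth_enum_rank.
have av0 : available weights K X0 by move=> _ [P [->|->]].
have ht0 r : height hs 1 (X0 r).
  have [rK|Kr] := ltnP r K; last first.
    rewrite /X0 nth_default; last by rewrite size_cat !size_map -!enumT -!cardT.
    by apply: height_mono (height_bit hs false).
  apply: height_W; rewrite /X0 nth_cat size_map -?enumT -cardT.
  case: ltnP => r1.
    pose i := Ordinal r1; exists (enum_val i); left.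
    by rewrite (nth_map (enum_val i)) -?cardT // -(enum_val_nth _ i).
  have r2 : r - #|sig| < #|sig| by rewrite /K in rK; lia.
  pose i := Ordinal r2; exists (enum_val i); right.
  by rewrite (nth_map (enum_val i)) -?cardT // -(enum_val_nth _ i).
have tX0 : tame hs X0.
  split; first by exists 1.
  by exists K => r Kr; rewrite /X0 nth_default // size_cat !size_map -!enumT -!cardT.
have [pre [t0 [X1 [ex1 X1c _ [[h X1h] [M0 X1M]]]]]] :=
  generated_list gen_p (leqnn K) tX0 av0.
set cs := consts p in gen_p X1c.
(* [M] lies above the constants and above the last nonzero field register; the successor also keeps
   [mX M 0] apart from the output register 0. *)
pose M := (M0 + (K + seq.size cs)).+1.
(* Register [mH 1] still holds 0, so the addition copies [n] from [N[0]]. *)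
pose prologue := Seq (Do (NConst (mH 0) 1)) (Do (NAdd (mN (0, 0)) 0 (mH 1))).
pose epilogue := Seq (Do (XConst 0 false)) (Do (XOp OpAdd 0 0 (mX M 0))).
have csh x : x \in cs -> height hs h.+1 x.
  move=> xc; rewrite -(nth_index 0%R xc) -X1c ?index_mem //.
  by apply: height_mono (X1h _).
have QM : K + seq.size cs <= M by rewrite /M; lia.
pose bnd n := let m := steps p (linit F n) in
  t0 + (2 + (m * cost hs (h + h.+1 * m) + (cost hs (h + h.+1 * m)))).
have bnd_poly : poly_bounded bnd.
  by do ![apply: poly_bounded_add | apply: poly_bounded_mul
      | exact: poly_bounded_const | exact: poly_p | apply: poly_bounded_succ].
have [c [k bnd_ck]] := poly_bounded_shape bnd_poly.
exists (Seq pre (Seq prologue (Seq (compile cs K M 0 p) epilogue))), c, k => n n_gt0.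
set s1 := State (regN (init w wbar n)) X1.
have {}ex1 : exec size pre (init w wbar n) t0 s1 by exact: ex1.
pose s2 := step (NAdd (mN (0, 0)) 0 (mH 1)) (step (NConst (mH 0) 1) s1).
have sim2 : simulates cs K M s2 (linit F n).
  split=> /=.
  - by move=> r; rewrite /set_reg /upd mN_inj mNH /= addn0.
  - by [].
  - by move=> i; rewrite X1M // /mX /M; lia.
  - by move=> i; rewrite X1M // /mT /M; lia.
  - by move=> x xc; rewrite X1c ?index_mem ?nth_index.
have bd2 : bounded hs h s2 by [].
have [t3 [s3 [ex3 le3 sim3 bd3 _]]] :=
  compile_exec (ltn0Sn h) csh QM (fun x xc => xc) 0 sim2 bd2.
exists (t0 + (1 + 1 + (t3 + (1 + step_cost size (XOp OpAdd 0 0 (mX M 0))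
  (step (XConst 0 false) s3))))); eexists; split.
- apply: exec_seq ex1 (exec_seq _ (exec_seq ex3 _)).
    by apply: exec_seq; exact: exec_do.
  by apply: exec_seq; exact: exec_do.
- apply: leq_trans (bnd_ck n n_gt0); rewrite /bnd leq_add2l.
  set m := steps p (linit F n); apply: leq_add => //; apply: leq_add => //.
  have h1 := height_size (height_bit hs false).
  have h2 := height_size (bd3 (mX M 0)).
  have : (size 0%R <= height_slope hs * (h + h.+1 * m).+1)%N.
    by apply: leq_trans h1 _; rewrite leq_mul2l ltnS leq0n orbT.
  rewrite -/m /cost; case: (sim3) => _ _ sX _ _.
  rewrite /= /set_reg eqxx; have -> : (mX M 0 == 0) = false by rewrite /mX /M.
  have aux x y z : x <= z -> y <= z -> 1 + (x + y) <= 2 * z + 6 by lia.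
  by move=> h3; apply: aux.
- case: sim3 => _ _ sX _ _; rewrite /= /set_reg eqxx.
  have -> : (mX M 0 == 0) = false by rewrite /mX /M.
  by rewrite sX add0r.
Qed.

End CompileTheorem.

(** * Heights for unit cost and for bit length *)

Lemma unit_height_system (F : realFieldType) (W : F -> Prop) :
  height_system (@unit_size F) W.
Proof. by exists (fun _ _ => True) 1 => // m x _; rewrite mul1n. Qed.

Lemma leq_expl m n e : m <= n -> m ^ e <= n ^ e.
Proof. by move=> mn; case: e => // e; rewrite leq_exp2r. Qed.

Section RatHeight.

Local Open Scope ring_scope.

Variables (D e : nat).
Hypotheses (D_gt0 : (0 < D)%N) (DE : (2 * D <= 2 ^ e)%N).

(** [D] is a common denominator of the weights, and fractions over [D ^ m] are not reduced. By
    [2 * D <= 2 ^ e], one unit of height pays for both effects of a sum on the numerator: the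
    doubling and the factor [D] that raises the denominator to the next power. *)
Definition rat_height (m : nat) (x : rat) : Prop :=
  exists2 z : int, x * (D ^ m)%:R = z%:~R & (`|z| <= 2 ^ (e * m))%N.

Lemma D_le_pow m : (D ^ m <= 2 ^ (e * m))%N.
Proof. by rewrite expnM leq_expl //; apply: leq_trans DE; exact: leq_pmull. Qed.

Lemma rat_height_mono m m' x : (m <= m')%N -> rat_height m x -> rat_height m' x.
Proof.
move=> mm [z xz zb]; exists (z * (D ^ (m' - m))%:Z).
  by rewrite -[in LHS](subnKC mm) expnD natrM mulrA xz intrM.
rewrite abszM absz_nat -[in leqRHS](subnKC mm) mulnDr expnD leq_mul //.
exact: D_le_pow.
Qed.

Lemma rat_height_bit (b : bool) : rat_height 0 b%:R.
Proof. by exists b%:Z; rewrite ?mulr1 // muln0 absz_nat; case: b. Qed.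

Lemma rat_height_opp m x : rat_height m x -> rat_height m (- x).
Proof.
by move=> [z xz zb]; exists (- z); rewrite ?abszN // mulNr xz rmorphN.
Qed.

Lemma rat_height_add m x y :
  rat_height m x -> rat_height m y -> rat_height m.+1 (x + y).
Proof.
move=> [z xz zb] [t yt tb]; exists ((z + t) * D%:Z).
  by rewrite expnS mulnC natrM mulrA mulrDl xz yt intrM rmorphD.
rewrite abszM absz_nat mulnS expnD.
have zt : (absz (z + t)%R <= 2 ^ (e * m) * 2)%N by lia.
apply: (@leq_trans (2 ^ (e * m) * (2 * D))%N).
  by rewrite mulnA leq_mul2r zt orbT.
by rewrite mulnC leq_mul2r DE orbT.
Qed.

Lemma rat_height_mul m m' x y :
  rat_height m x -> rat_height m' y -> rat_height (m + m') (x * y).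
Proof.
move=> [z xz zb] [t yt tb]; exists (z * t).
  by rewrite expnD natrM mulrACA xz yt intrM.
by rewrite abszM mulnDr expnD leq_mul.
Qed.

(** The fraction over [D ^ m] is the reduced one with numerator and denominator multiplied by some
    [s], so its bounds pass to [numq x] and [denq x]. *)
Lemma rat_height_size m x : rat_height m x ->
  (bit_size x <= (2 * e + 2) * m.+1)%N.
Proof.
move=> [z xz zb].
have Dm0 : (D ^ m)%:Z != 0 by rewrite eqz_nat expn_eq0 negb_and -lt0n D_gt0.
have Dm0' : (D ^ m)%:R != 0 :> rat by rewrite (intr_eq0 _ (D ^ m)%:Z).
have xE : fracq (z, (D ^ m)%:Z) = x.
  by rewrite fracqE /= -xz -[(D ^ m)%:Z%:~R]/((D ^ m)%:R) mulfK.
have [s zE DE'] : exists2 s, z = s * numq x & (D ^ m)%:Z = s * denq x.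
  have := @valq_frac (z, (D ^ m)%:Z) Dm0; rewrite xE => -[zE DE'].
  by eexists; eassumption.
have s_gt0 : (0 < `|s|)%N.
  by rewrite absz_gt0; apply: contraNneq Dm0 => s0; rewrite DE' s0 mul0r.
have nb : (`|numq x| <= 2 ^ (e * m))%N.
  by apply: leq_trans zb; rewrite zE abszM leq_pmull.
have db : (`|denq x| <= 2 ^ (e * m))%N.
  apply: leq_trans (D_le_pow m); rewrite -[(D ^ m)%N]absz_nat DE' abszM.
  exact: leq_pmull.
have := leq_trunc_log 2 nb; have := leq_trunc_log 2 db.
by rewrite trunc_expnK // /bit_size; lia.
Qed.

Lemma rat_height_system (W : rat -> Prop) :
  (forall x, W x -> rat_height 1 x) -> height_system bit_size W.
Proof.
move=> HW; exists rat_height (2 * e + 2)%N => //.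
- exact: rat_height_mono.
- exact: rat_height_bit.
- exact: rat_height_add.
- by move=> m x y hx hy; apply: rat_height_add => //; exact: rat_height_opp.
- exact: rat_height_mul.
- exact: rat_height_size.
Qed.

End RatHeight.

Lemma finite_rat_height (I : finType) (x : I -> rat) :
  exists D e, [/\ 0 < D, 2 * D <= 2 ^ e & forall i, rat_height D e 1 (x i)].
Proof.
pose D := \prod_i `|denq (x i)|; pose z i := (x i * D%:R)%R.
have D_gt0 : 0 < D by apply: prodn_gt0 => i; rewrite absz_gt0 denq_eq0.
have zP i : exists t : int, z i = t%:~R%R.
  rewrite /z /D (bigD1 i) //=; set m := \prod_(j | _) _.
  exists (numq (x i) * m%:Z)%R.
  rewrite natrM mulrA intrM numqE; congr (_ * _ * _)%R.
  by rewrite -[RHS]/(_%:~R)%R -absz_denq.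
(* A crude exponent: both bounds are below [b], and [b < 2 ^ b]. *)
pose b := 2 * D + \sum_i `|numq (z i)|.
exists D, b; split=> //.
  by apply: leq_trans (ltnW (ltn_expl b _)) => //; exact: leq_addr.
move=> i; have [t zt] := zP i; exists t; first by rewrite expn1.
rewrite muln1; apply: leq_trans (ltnW (ltn_expl b _)) => //.
by rewrite /b (bigD1 i) //= zt numq_int; lia.
Qed.

Lemma bit_height_system (sig : finType) (w wbar : sig -> rat) :
  exists hs : height_system bit_size (weights w wbar), True.
Proof.
pose x (i : sig + sig) := match i with inl P => w P | inr P => wbar P end.
have [D [e [D_gt0 De xb]]] := finite_rat_height x.
have h y : weights w wbar y -> rat_height D e 1 y.
  by move=> [P [->|->]]; [exact: xb (inl P) | exact: xb (inr P)].
by exists (rat_height_system D_gt0 De h).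
Qed.

(** * Dynamic programming over counters *)

Section Recurrence.

Local Open Scope ring_scope.

Variable F : realFieldType.

(* A move consumes one unit of the counter [mgap], adds one unit to each
   counter of [minc], and is weighted by [mcoef], by the value of [mgap] and by
   a factor [x ^ (e j - d)] for each entry [(j, d, x)] of [mpow]. *)
Definition move : Type := (F * nat * seq (nat * nat * F) * seq nat)%type.

Definition mcoef (m : move) : F := m.1.1.1.
Definition mgap (m : move) : nat := m.1.1.2.
Definition mpow (m : move) : seq (nat * nat * F) := m.1.2.
Definition minc (m : move) : seq nat := m.2.

Definition moved (m : move) (e : nat -> nat) : nat -> nat :=
  fun j => (e j - (j == mgap m) + count_mem j (minc m))%N.

(** A move out of an empty counter has weight 0 because of [*+ e (mgap m)]; the truncated
    subtraction in [moved] thus matters only where it is a genuine one. *)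
Definition move_weight (m : move) (e : nat -> nat) : F :=
  (mcoef m * \prod_(q <- mpow m) q.2 ^+ (e q.1.1 - q.1.2)) *+ e (mgap m).

Fixpoint value (moves : seq move) (fin : seq (nat * F)) (k : nat)
    (e : nat -> nat) : F :=
  match k with
  | 0 => \prod_(q <- fin) q.2 ^+ e q.1
  | k'.+1 => \sum_(m <- moves) move_weight m e * value moves fin k' (moved m e)
  end.

End Recurrence.

Section LoopPrograms.

Local Open Scope nat_scope.

Variable F : realFieldType.

Lemma upd_upd (I : eqType) (T : Type) (m : I -> T) i v v' :
  upd (upd m i v) i v' = upd m i v'.
Proof. by apply: funext => j; rewrite /upd; case: eqP. Qed.

Lemma upd_id (I : eqType) (T : Type) (m : I -> T) i : upd m i (m i) = m.
Proof. by apply: funext => j; rewrite /upd; case: eqP => [->|]. Qed.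

Lemma sem_rep_addN (r a b : nreg) (s : lstate F) : a != b ->
  sem (LRep r (LNAdd F a a b)) s = setlN s a (lN s a + lN s r * lN s b).
Proof.
move=> ab /=; elim: (lN s r) => [|k IHk].
  by rewrite /= mul0n addn0 /setlN upd_id; case: s.
rewrite iterS IHk /= /setlN /= upd_upd /upd eqxx eq_sym (negPf ab).
by rewrite mulSnr addnA.
Qed.

Lemma sem_rep_mulX (r : nreg) i x (s : lstate F) :
  sem (LRep r (LXMul i i x)) s = setlX s i (lX s i * x ^+ lN s r)%R.
Proof.
rewrite /=; elim: (lN s r) => [|k IHk].
  by rewrite /= expr0 mulr1 /setlX upd_id; case: s.
by rewrite iterS IHk /= /setlX /= upd_upd /upd eqxx exprSr mulrA.
Qed.

Lemma sem_rep_addX (r : nreg) i j (s : lstate F) : i != j ->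
  sem (LRep r (LXAdd F i i j)) s = setlX s i (lX s i + lX s j *+ lN s r)%R.
Proof.
move=> ij; rewrite /=; elim: (lN s r) => [|k IHk].
  by rewrite /= mulr0n addr0 /setlX upd_id; case: s.
rewrite iterS IHk /= /setlX /= upd_upd /upd eqxx eq_sym (negPf ij).
by rewrite mulrSr addrA.
Qed.

Lemma steps_rep_const (r : nreg) (p : loop F) c s :
  (forall s', steps p s' = c) -> steps (LRep r p) s = (lN s r * c.+1).+1.
Proof.
by move=> pc /=; under eq_bigr => i _ do rewrite pc; rewrite sum_nat_const card_ord.
Qed.

Lemma steps_rep_le (r : nreg) (p : loop F) c s :
  (forall i, i < lN s r -> steps p (iter i (sem p) s) <= c) ->
  steps (LRep r p) s <= (lN s r * c.+1).+1.
Proof.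
move=> pc; rewrite /= ltnS -[X in X * _](card_ord (lN s r)) -sum_nat_const.
by apply: leq_sum => i _; rewrite ltnS pc.
Qed.

(** A multiplication by 1 plays the role of a skip instruction; 1 is among the generated
    constants. *)
Definition lskip : loop F := LXMul 0 0 1%R.

Lemma sem_lskip s : sem lskip s = s.
Proof. by rewrite /= mulr1 /setlX upd_id; case: s. Qed.

Definition lseq (ps : seq (loop F)) : loop F := foldr (@LSeq F) lskip ps.

Lemma sem_cons (p : loop F) ps s :
  sem (lseq (p :: ps)) s = sem (lseq ps) (sem p s).
Proof. by []. Qed.

Lemma steps_cons (p : loop F) ps s :
  steps (lseq (p :: ps)) s = steps p s + steps (lseq ps) (sem p s).
Proof. by []. Qed.

Lemma sem_seq (p q : loop F) s : sem (LSeq p q) s = sem q (sem p s).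
Proof. by []. Qed.

Lemma steps_seq (p q : loop F) s :
  steps (LSeq p q) s = steps p s + steps q (sem p s).
Proof. by []. Qed.

End LoopPrograms.

Arguments LNConst {F}.
Arguments LNAdd {F}.
Arguments LNSub {F}.
Arguments LXConst {F}.
Arguments LXAdd {F}.
Arguments LXLoad {F}.
Arguments LXStore {F}.
Arguments lskip {F}.

(** * Filling the table of the recurrence *)

Section Evaluation.

Local Open Scope nat_scope.

Variables (F : realFieldType) (K c : nat) (moves : seq (move F)).
Variables (fin : seq (nat * F)) (start : nat -> nat).

(** [RB] holds the base of the positional code of the counters and [Rs j] its [j]-th power; [Ra] is
    the address of the current entry, [Rb] that of an entry on which it depends, [Rt] an exponent,
    and [Re j] a counter. *)
Definition Rn : nreg := (0, 0).
Definition R1 : nreg := (1, 0).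
Definition RB : nreg := (2, 0).
Definition Ra : nreg := (3, 0).
Definition Rt : nreg := (4, 0).
Definition Rb : nreg := (5, 0).
Definition Re (j : nat) : nreg := (6, j).
Definition Rs (j : nat) : nreg := (7, j).

(* [Ra] := address of the table entry for the counters [Re 0], ..., [Re K.-1]
   and the number [Re K] of remaining moves. *)
Definition load_address : loop F :=
  LSeq (LNConst Ra 0)
    (lseq [seq LRep (Re j) (LNAdd Ra Ra (Rs j)) | j <- iota 0 K.+1]).

Definition load_power (q : nat * nat * F) : loop F :=
  LSeq (LNConst Rt q.1.2)
  (LSeq (LNSub Rt (Re q.1.1) Rt) (LRep Rt (LXMul 2 2 q.2))).

(** The code is additive in the counters, so the entry reached by the move is found by subtracting
    and adding powers of the base. If the counter [mgap m] is 0, this address is meaningless, but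
    the value read from it is then added zero times. *)
Definition add_move (m : move F) : loop F :=
  LSeq (LNSub Rb Ra (Rs K))
  (LSeq (LNSub Rb Rb (Rs (mgap m)))
  (LSeq (lseq [seq LNAdd Rb Rb (Rs i) | i <- minc m])
  (LSeq (LXLoad 2 Rb)
  (LSeq (LXMul 2 2 (mcoef m))
  (LSeq (lseq [seq load_power q | q <- mpow m])
  (LSeq (LXConst 3 false)
  (LSeq (LRep (Re (mgap m)) (LXAdd 3 3 2)) (LXAdd 1 1 3)))))))).

Definition fill_step : loop F :=
  LSeq load_address
  (LSeq (LXConst 1 false) (LSeq (lseq [seq add_move m | m <- moves]) (LXStore Ra 1))).

Definition fill_last : loop F :=
  LSeq load_address
  (LSeq (LXConst 1 true)
  (LSeq (lseq [seq LRep (Re q.1) (LXMul 1 1 q.2) | q <- fin]) (LXStore Ra 1))).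

Fixpoint for_all (j : nat) (p : loop F) : loop F :=
  match j with
  | 0 => p
  | i.+1 => LSeq (LNConst (Re i) 0)
      (LRep RB (LSeq (for_all i p) (LNAdd (Re i) (Re i) R1)))
  end.

Definition setup : loop F :=
  LSeq (LNConst R1 1)
  (LSeq (LNConst RB 2)
  (LSeq (lseq (nseq c (LNAdd RB RB Rn)))
  (LSeq (LNConst (Rs 0) 1)
    (lseq [seq LSeq (LNConst (Rs j.+1) 0)
                 (LRep RB (LNAdd (Rs j.+1) (Rs j.+1) (Rs j))) | j <- iota 0 K])))).

(** Entries depend on entries with one remaining move less, so the table is filled plane by plane
    for growing [Re K]. The loop ends with [Re K] equal to [n.+1], hence the subtraction. *)
Definition evaluate : loop F :=
  LSeq setup
  (LSeq (LNConst (Re K) 0)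
  (LSeq (for_all K fill_last)
  (LSeq (LNConst (Re K) 1)
  (LSeq (LRep Rn (LSeq (for_all K fill_step) (LNAdd (Re K) (Re K) R1)))
  (LSeq (LNSub (Re K) (Re K) R1)
  (LSeq (lseq [seq LNConst (Re j) (start j) | j <- iota 0 K])
  (LSeq load_address (LXLoad 0 Ra)))))))).

Lemma load_addressE s : sem load_address s =
  setlN s Ra (\sum_(j < K.+1) lN s (Re j) * lN s (Rs j)).
Proof.
rewrite -(big_mkord xpredT (fun j => lN s (Re j) * lN s (Rs j))) /load_address.
rewrite /index_iota subn0.
have H js v : sem (lseq [seq LRep (Re j) (LNAdd Ra Ra (Rs j)) | j <- js])
    (setlN s Ra v) = setlN s Ra (v + \sum_(j <- js) lN s (Re j) * lN s (Rs j)).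
  elim: js v => [|j js IHjs] v; first by rewrite sem_lskip big_nil addn0.
  rewrite big_cons addnA -IHjs [lseq _]/=.
  have -> p q (t : lstate F) : sem (LSeq p q) t = sem q (sem p t) by [].
  by rewrite sem_rep_addN // /setlN /= upd_upd /upd.
exact: (H (iota 0 K.+1) 0).
Qed.

Lemma load_powerE q s : sem (load_power q) s =
  let k := lN s (Re q.1.1) - q.1.2 in
  setlX (setlN s Rt k) 2 (lX s 2 * q.2 ^+ k)%R.
Proof.
have -> : sem (load_power q) s = sem (LRep Rt (LXMul 2 2 q.2))
  (setlN (setlN s Rt q.1.2) Rt (lN s (Re q.1.1) - q.1.2)) by [].
by rewrite sem_rep_mulX /setlN /= upd_upd.
Qed.

Definition scratch_free (s s' : lstate F) : Prop :=
  (forall r, r \notin [:: Rb; Rt] -> lN s' r = lN s r) /\ lT s' = lT s.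

Lemma scratch_free_trans s s' s'' :
  scratch_free s s' -> scratch_free s' s'' -> scratch_free s s''.
Proof. by move=> [N1 T1] [N2 T2]; split=> [r rn|]; rewrite ?N2 ?N1 ?T2. Qed.

Lemma load_powers_spec b qs s : (forall j, lN s (Re j) <= b) ->
  let p := lseq [seq load_power q | q <- qs] in let s' := sem p s in
  [/\ scratch_free s s', lX s' 1 = lX s 1,
    lX s' 2 = (lX s 2 * \prod_(q <- qs) q.2 ^+ (lN s (Re q.1.1) - q.1.2))%R
  & steps p s <= seq.size qs * (2 * b + 3) + 1].
Proof.
elim: qs s => [|q qs IHqs] s sb p s'.
  by rewrite /s' big_nil sem_lskip mulr1; split=> //; split.
rewrite /s' {s'} /p {p} map_cons sem_cons steps_cons; set s1 := sem (load_power q) s.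
have s1E := load_powerE q s; rewrite -/s1 /= in s1E.
have sf1 : scratch_free s s1.
  split=> [r rn|]; rewrite s1E //= /upd; case: eqP rn => // ->.
  by rewrite !inE eqxx orbT.
have N1 j : lN s1 (Re j) = lN s (Re j) by case: sf1 => ->.
have [] := IHqs s1; first by move=> j; rewrite N1.
move=> sf2 X1 X2 st; split.
- exact: scratch_free_trans sf1 sf2.
- by rewrite X1 s1E.
- rewrite X2 big_cons {1}s1E /= /upd eqxx mulrA; congr (_ * _)%R.
  by apply: eq_bigr => q' _; rewrite N1.
- rewrite [seq.size _]/= mulSn -addnA; apply: leq_add st.
  rewrite !steps_seq (@steps_rep_const _ _ _ 1) //.
  by have := sb q.1.1; rewrite /= /upd /=; lia.
Qed.

Lemma add_indicesE js (s : lstate F) :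
  sem (lseq [seq LNAdd Rb Rb (Rs i) | i <- js]) s =
  setlN s Rb (lN s Rb + \sum_(i <- js) lN s (Rs i)).
Proof.
elim: js s => [|j js IHjs] s.
  by rewrite big_nil sem_lskip addn0 /setlN upd_id; case: s.
by rewrite map_cons sem_cons IHjs big_cons /setlN /= upd_upd /upd eqxx addnA.
Qed.

Lemma steps_add_indices js (s : lstate F) :
  steps (lseq [seq LNAdd Rb Rb (Rs i) | i <- js]) s = seq.size js + 1.
Proof. by elim: js s => // j js IHjs s; rewrite map_cons steps_cons IHjs. Qed.

Definition move_steps b (m : move F) : nat :=
  seq.size (minc m) + seq.size (mpow m) * (2 * b + 3) + 2 * b + 9.

Definition move_term (s : lstate F) (m : move F) : F :=
  ((lT s (lN s Ra - lN s (Rs K) - lN s (Rs (mgap m))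
          + \sum_(i <- minc m) lN s (Rs i)) * mcoef m
   * \prod_(q <- mpow m) q.2 ^+ (lN s (Re q.1.1) - q.1.2))
   *+ lN s (Re (mgap m)))%R.

Lemma add_move_spec b m s : (forall j, lN s (Re j) <= b) ->
  let s' := sem (add_move m) s in
  [/\ scratch_free s s', lX s' 1 = (lX s 1 + move_term s m)%R
  & steps (add_move m) s <= move_steps b m].
Proof.
move=> sb s'; rewrite /s' {s'} /add_move !sem_seq !steps_seq.
set s1 := sem (LNSub Rb Ra (Rs K)) s.
set s2 := sem (LNSub Rb Rb _) s1.
rewrite (add_indicesE (minc m) s2) steps_add_indices.
set s3 := setlN s2 _ _.
set s4 := sem (LXLoad 2 Rb) s3.
set s5 := sem (LXMul _ _ _) s4.
have N5 r : r \notin [:: Rb; Rt] -> lN s5 r = lN s r.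
  by rewrite !inE negb_or => /andP[/negPf rb /negPf rt]; rewrite /= /upd !rb.
have N5e j : lN s5 (Re j) = lN s (Re j) by rewrite N5.
have sf5 : scratch_free s s5 by split.
have := @load_powers_spec b (mpow m) s5.
case; first by move=> j; rewrite N5e.
set s6 := sem (lseq _) s5 => sf6 X61 X62 st6.
set s7 := sem (LXConst 3 false) s6.
have sf7 := scratch_free_trans sf5 sf6.
have N7e j : lN s7 (Re j) = lN s (Re j) by case: sf7 => ->.
rewrite sem_rep_addX // (@steps_rep_const _ _ _ 1) // N7e; split.
- by case: sf7.
- rewrite /= /upd /= X61 X62 add0r /move_term /= /upd /=.
  congr (_ + _)%R; congr (_ * _ *+ _)%R.
- rewrite /move_steps; have := sb (mgap m); move: st6.
  by rewrite [steps (LNSub _ _ _) _]/= [steps (LNSub _ _ _) _]/=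
     [steps (LXLoad _ _) _]/= [steps (LXMul _ _ _) _]/=
     [steps (LXConst _ _) _]/= [steps (LXAdd _ _ _) _]/=; lia.
Qed.

Lemma add_moves_spec b ms s : (forall j, lN s (Re j) <= b) ->
  let p := lseq [seq add_move m | m <- ms] in let s' := sem p s in
  [/\ scratch_free s s', lX s' 1 = (lX s 1 + \sum_(m <- ms) move_term s m)%R
  & steps p s <= \sum_(m <- ms) move_steps b m + 1].
Proof.
elim: ms s => [|m ms IHms] s sb p s'.
  by rewrite /s' !big_nil sem_lskip addr0; split=> //; split.
rewrite /s' {s'} /p {p} map_cons sem_cons steps_cons.
have [] := add_move_spec m sb; set s1 := sem _ s => sf1 X1 st1.
have N1 r : r \notin [:: Rb; Rt] -> lN s1 r = lN s r by case: sf1 => + _; apply.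
have [] := IHms s1; first by move=> j; rewrite N1.
move=> sf2 X2 st2; split.
- exact: scratch_free_trans sf1 sf2.
- rewrite X2 X1 big_cons addrA; congr (_ + _)%R; apply: eq_bigr => m' _.
  rewrite /move_term; case: sf1 => _ ->; rewrite !N1 //; congr (_ * _ * _ *+ _)%R.
    by congr (lT s _); congr addn; apply: eq_bigr => i _; rewrite N1.
  by apply: eq_bigr => i _; rewrite N1.
- by rewrite big_cons -addnA; apply: leq_add st2.
Qed.

Definition well_indexed : Prop :=
  (forall m, m \in moves -> [/\ mgap m < K, forall q, q \in mpow m -> q.1.1 < K,
     forall i, i \in minc m -> i < K & seq.size (minc m) <= c]) /\
  (forall q, q \in fin -> q.1 < K).

Hypothesis wi : well_indexed.

Notation value := (value moves fin).

Lemma value_ext k e e' : (forall j, j < K -> e j = e' j) -> value k e = value k e'.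
Proof.
elim: k e e' => [|k IHk] e e' ee' /=.
  by rewrite big_seq [RHS]big_seq; apply: eq_bigr => q /wi.2 qK; rewrite ee'.
rewrite big_seq [RHS]big_seq; apply: eq_bigr => m mm.
have [gK pK _ _] := wi.1 m mm.
congr (_ * _)%R; last by apply: IHk => j jK; rewrite /moved ee'.
rewrite /move_weight ee' //; congr (_ * _ *+ _)%R.
by rewrite big_seq [RHS]big_seq; apply: eq_bigr => q /pK qK; rewrite ee'.
Qed.

Definition code (B : nat) (e : nat -> nat) : nat := \sum_(j < K.+1) e j * B ^ j.

(** Reduction modulo [B] yields the lowest digit and division the others; the last quotient is the
    digit at [K], which may exceed [B]. *)
Lemma code_inj B e e' : (forall j, j < K -> e j < B) ->
  (forall j, j < K -> e' j < B) -> code B e = code B e' ->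
  forall j, j <= K -> e j = e' j.
Proof.
rewrite /code; elim: K e e' => [|k IHk] e e' eB e'B.
  by rewrite !big_ord1 !muln1 => ee' j; rewrite leqn0 => /eqP->.
have B0 : 0 < B by apply: leq_ltn_trans (eB 0 _).
rewrite big_ord_recl [RHS]big_ord_recl /= !muln1.
have E (f : nat -> nat) : \sum_(i < k.+1) f (bump 0 i) * B ^ bump 0 i =
    (\sum_(i < k.+1) f i.+1 * B ^ i) * B.
  by rewrite big_distrl; apply: eq_bigr => i _; rewrite /= expnSr mulnA.
rewrite !E => ee'.
have e0 : e 0 = e' 0.
  have := congr1 (modn^~ B) ee'; rewrite ![_ 0 + _]addnC !modnMDl.
  by rewrite !modn_small ?eB ?e'B.
have es : forall j, j <= k -> e j.+1 = e' j.+1.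
  apply: (IHk (e \o succn) (e' \o succn)) => [j jk|j jk|] /=.
  - exact: eB.
  - exact: e'B.
  - by move: ee'; rewrite e0 => /addnI/eqP; rewrite eqn_pmul2r // => /eqP.
by case.
Qed.

(** Counters start with at most 1 and gain at most [c] in each of [n] moves, so they stay at most
    [c * n + 1]. *)
Definition base (n : nat) : nat := c * n + 2.

Definition env (n : nat) (e : nat -> nat) (s : lstate F) : Prop :=
  [/\ lN s Rn = n, lN s R1 = 1, lN s RB = base n,
    forall j, j <= K -> lN s (Rs j) = base n ^ j & forall j, lN s (Re j) = e j].

(* With [e K] moves remaining, counters larger than this are never reached. *)
Definition valid (n : nat) (e : nat -> nat) : Prop :=
  e K <= n /\ forall j, j < K -> e j <= c * (n - e K) + 1.

Definition filled n (s : lstate F) (e : nat -> nat) : Prop :=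
  lT s (code (base n) e) = value (e K) e.

Definition filled_below n k (s : lstate F) : Prop :=
  forall e, valid n e -> e K < k -> filled n s e.

Lemma valid_base n e j : valid n e -> j < K -> e j < base n.
Proof.
move=> [eK ej] jK; apply: leq_ltn_trans (ej j jK) _.
rewrite /base addn2 addn1 !ltnS leq_mul2l; lia.
Qed.

(** The two positivity conditions make the truncated subtractions genuine: the digits at [K] and at
    [mgap m] can each give up one unit. *)
Lemma code_next n e m : m \in moves -> 0 < e K -> 0 < e (mgap m) ->
  code (base n) e - base n ^ K - base n ^ (mgap m)
    + \sum_(i <- minc m) base n ^ i
  = code (base n) (upd (moved m e) K (e K).-1).
Proof.
move=> mm eK eg; set B := base n; have [gK _ iK _] := wi.1 m mm.
have sumi : \sum_(i <- minc m) B ^ i = \sum_(j < K) count_mem (j : nat) (minc m) * B ^ j.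
  elim: (minc m) iK => [|i js IHjs] iK.
    by rewrite big_nil big1.
  rewrite big_cons IHjs; last by move=> j ji; apply: iK; rewrite inE ji orbT.
  have iK' : i < K by apply: iK; rewrite mem_head.
  under [RHS]eq_bigr => j _ do rewrite /= mulnDl.
  rewrite big_split /=; congr addn.
  rewrite (bigD1 (Ordinal iK')) //= eqxx mul1n big1 ?addn0 // => j.
  by rewrite -val_eqE /= eq_sym => /negPf->.
have sume : \sum_(j < K) e j * B ^ j =
    \sum_(j < K) (e j - (j == mgap m :> nat)) * B ^ j + B ^ mgap m.
  rewrite (bigD1 (Ordinal gK)) //= [X in _ = X + _](bigD1 (Ordinal gK)) //= eqxx.
  rewrite addnAC -mulSnr -subSn // subn1 /=; congr addn.
  by apply: eq_bigr => j; rewrite -val_eqE /= => /negPf->; rewrite subn0.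
rewrite /code !big_ord_recr /= {2}/upd eqxx sume sumi.
rewrite [X in _ = X + _](eq_bigr (fun j : 'I_K =>
  (e j - (j == mgap m :> nat)) * B ^ j + count_mem (j : nat) (minc m) * B ^ j));
  last by move=> j _; rewrite /upd ltn_eqF // /moved mulnDl.
rewrite big_split /=; case: (e K) eK => // k _.
by rewrite mulSn; lia.
Qed.

(** The loops visit all digit vectors below the base, also invalid ones, for which the value stored
    may be wrong. Therefore the specification says separately that lower planes stay correct, that
    correct valid entries of the same plane stay correct, and that the current entry becomes correct
    if it is valid. *)
Definition step_ok (n t : nat) (p : loop F) (k : nat) : Prop :=
  forall s e, env n e s -> e K = k -> (forall j, e j <= base n) ->
    (forall j, j < K -> e j < base n) -> filled_below n k s ->
  let s' := sem p s in
  [/\ env n e s', filled_below n k s',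
    forall e', valid n e' -> e' K = k -> filled n s e' -> filled n s' e',
    valid n e -> filled n s' e & steps p s <= t].

Lemma load_address_env n e s : env n e s ->
  sem load_address s = setlN s Ra (code (base n) e).
Proof.
move=> [_ _ _ sS sE]; rewrite load_addressE; congr setlN.
by apply: eq_bigr => j _; rewrite sE sS // -ltnS ltn_ord.
Qed.

Lemma steps_load_address n e s : env n e s -> (forall j, e j <= base n) ->
  steps load_address s <= K.+1 * (2 * base n + 1) + 2.
Proof.
move=> [_ _ _ _ sE] eb; rewrite /load_address steps_seq.
have H js v : steps (lseq [seq LRep (Re j) (LNAdd Ra Ra (Rs j)) | j <- js])
    (setlN s Ra v) <= seq.size js * (2 * base n + 1) + 1.
  elim: js v => [|j js IHjs] v //.
  rewrite map_cons steps_cons (@steps_rep_const _ _ _ 1) // sem_rep_addN //.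
  rewrite [seq.size _]/= mulSn -addnA; apply: leq_add.
    have -> : lN (setlN s Ra v) (Re j) = e j by exact: sE.
    by have := eb j; lia.
  by rewrite /setlN /= upd_upd; exact: IHjs.
have := H (iota 0 K.+1) 0; rewrite size_iota => Hs.
by rewrite addn2 -[X in _ <= X.+1]addn1 ltnS; exact: leq_trans Hs _.
Qed.

(** A store hits the entry of a valid [e'] only if the codes coincide; then [e] and [e'] have the
    same digits, so [e] is valid too and the stored value is right. *)
Lemma store_ok n s s' e v k : e K = k -> (forall j, j < K -> e j < base n) ->
  filled_below n k s -> lT s' = upd (lT s) (code (base n) e) v ->
  (valid n e -> v = value k e) ->
  [/\ filled_below n k s',
    forall e', valid n e' -> e' K = k -> filled n s e' -> filled n s' e'
  & valid n e -> filled n s' e].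
Proof.
move=> ek eB fb T' vE; split.
- move=> e' ve' e'k; rewrite /filled T' /upd; case: eqP => [cc|_].
    have := code_inj (fun j jK => valid_base ve' jK) eB cc (leqnn K).
    by move=> kk; rewrite kk ek ltnn in e'k.
  exact: fb.
- move=> e' ve' e'k; rewrite /filled T' /upd; case: eqP => // cc _.
  have ee' := code_inj (fun j jK => valid_base ve' jK) eB cc.
  rewrite e'k vE; first by apply: value_ext => j /ltnW jK; rewrite ee'.
  case: ve' => e'n e'c; split; first by rewrite ek -e'k.
  by move=> j jK; rewrite -ee' ?(ltnW jK) // ek -e'k; exact: e'c.
- by move=> ve; rewrite /filled T' /upd eqxx ek vE.
Qed.

Lemma valid_next n e m : valid n e -> m \in moves -> 0 < e K ->
  valid n (upd (moved m e) K (e K).-1).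
Proof.
move=> [en ec] mm eK; have [gK _ iK sc] := wi.1 m mm.
rewrite /valid (_ : upd _ _ _ K = (e K).-1); last by rewrite /upd eqxx.
split=> [|j jK]; first lia.
rewrite /upd ltn_eqF // /moved.
have : count_mem j (minc m) <= c by apply: leq_trans (count_size _ _) sc.
have := ec j jK; have -> : n - (e K).-1 = (n - e K).+1 by lia.
by rewrite mulnS; lia.
Qed.

Definition fill_step_bound n : nat :=
  K.+1 * (2 * base n + 1) + 5 + \sum_(m <- moves) move_steps (base n) m.

Lemma env_scratch_free n e s s' : env n e s ->
  (forall r, r \notin [:: Ra; Rb; Rt] -> lN s' r = lN s r) -> env n e s'.
Proof.
move=> [sn s1 sB sS sE] N'; by split=> [|||j jK|j]; rewrite N' //; exact: sS.
Qed.

Lemma fill_step_ok n k : 0 < k -> step_ok n (fill_step_bound n) fill_step k.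
Proof.
move=> k0 s e es ek eb eB fb; rewrite /fill_step 3!sem_seq 3!steps_seq.
rewrite (load_address_env es).
set s1 := setlN s Ra _; set s2 := sem (LXConst 1 false) s1.
have N2 j : lN s2 (Re j) = e j by case: es => _ _ _ _ sE; exact: sE.
have [] := @add_moves_spec (base n) moves s2; first by move=> j; rewrite N2.
set s3 := sem (lseq _) s2 => sf X st.
have es3 : env n e s3.
  apply: env_scratch_free es _ => r; rewrite !inE !negb_or => /and3P[ra rb rt].
  rewrite sf.1; last by rewrite !inE negb_or rb rt.
  by rewrite /= /upd (negPf ra).
have A3 : lN s3 Ra = code (base n) e by rewrite sf.1 //= /upd eqxx.
have T' : lT (sem (LXStore Ra 1) s3) = upd (lT s) (code (base n) e) (lX s3 1).
  by rewrite /= A3 sf.2.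
have vE : valid n e -> lX s3 1 = value k e.
  move=> ve; rewrite X /= /upd eqxx add0r -ek.
  have eK : 0 < e K by rewrite ek.
  case E : (e K) eK => [//|k'] _ /=.
  rewrite big_seq [RHS]big_seq; apply: eq_bigr => m mm.
  rewrite /move_term N2 /move_weight.
  (* With no gap of this type the address may be wrong, but both sides are 0. *)
  have [->|g0] := posnP (e (mgap m)); first by rewrite !mulr0n mul0r.
  have [gK pK iK _] := wi.1 m mm.
  have -> : lN s2 Ra = code (base n) e by rewrite /= /upd eqxx.
  have sS j : j <= K -> lN s2 (Rs j) = base n ^ j by case: es => _ _ _ + _; apply.
  rewrite !sS ?(ltnW gK) //.
  rewrite (_ : \sum_(i <- minc m) _ = \sum_(i <- minc m) base n ^ i); last first.
    by rewrite big_seq [RHS]big_seq; apply: eq_bigr => i /iK iK'; rewrite sS ?(ltnW iK').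
  rewrite code_next // ?E //.
  have eK : 0 < e K by rewrite E.
  have updK : upd (moved m e) K (e K).-1 K = k' by rewrite /upd eqxx E.
  have := fb _ (valid_next ve mm eK); rewrite /filled updK -ek E => /(_ (leqnn _)).
  rewrite -E [lT s2]/= => ->.
  rewrite (@value_ext _ _ (moved m e)); last by move=> j jK; rewrite /upd ltn_eqF.
  rewrite mulrnAl; congr (_ *+ _)%R; rewrite -mulrA mulrC; congr (_ * _ * _)%R.
  by apply: eq_bigr => q _; rewrite N2.
have [fb' keep' new'] := store_ok ek eB fb T' vE.
split=> //.
have := steps_load_address es eb; move: st; rewrite /fill_step_bound.
by rewrite [steps (LXConst _ _) _]/= [steps (LXStore _ _) _]/=; lia.
Qed.

Definition fill_last_bound n : nat :=
  K.+1 * (2 * base n + 1) + 5 + seq.size fin * (2 * base n + 1).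

Lemma fill_last_ok n : step_ok n (fill_last_bound n) fill_last 0.
Proof.
move=> s e es ek eb eB fb; rewrite /fill_last 3!sem_seq 3!steps_seq.
rewrite (load_address_env es).
set s1 := setlN s Ra _; set s2 := sem (LXConst 1 true) s1.
have N2 j : lN s2 (Re j) = e j by case: es => _ _ _ _ sE; exact: sE.
have H qs x : let p := lseq [seq LRep (Re q.1) (LXMul 1 1 q.2) | q <- qs] in
    sem p (setlX s2 1 x) =
      setlX s2 1 (x * \prod_(q <- qs) q.2 ^+ e q.1)%R /\
    steps p (setlX s2 1 x) <= seq.size qs * (2 * base n + 1) + 1.
  elim: qs x => [|q qs IHqs] x p; first by rewrite sem_lskip big_nil mulr1.
  rewrite /p {p} map_cons sem_cons steps_cons sem_rep_mulX.
  rewrite (@steps_rep_const _ _ _ 1) //.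
  have -> : lN (setlX s2 1 x) (Re q.1) = e q.1 by exact: N2.
  have -> : setlX (setlX s2 1 x) 1 (lX (setlX s2 1 x) 1 * q.2 ^+ e q.1)%R =
      setlX s2 1 (x * q.2 ^+ e q.1)%R by rewrite /setlX /= upd_upd [upd _ 1 x 1]/upd eqxx.
  have [-> st] := IHqs (x * q.2 ^+ e q.1)%R.
  rewrite big_cons mulrA; split=> //.
  rewrite [seq.size _]/= mulSn -addnA; apply: leq_add st.
  by have := eb q.1; lia.
have s2E : s2 = setlX s2 1 1%R by rewrite /setlX /= upd_upd.
have [] := H fin 1%R; rewrite -s2E mul1r.
set s3 := sem (lseq _) s2 => s3E st.
have es3 : env n e s3.
  apply: env_scratch_free es _ => r; rewrite !inE !negb_or => /and3P[ra rb rt].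
  by rewrite s3E /= /upd (negPf ra).
have A3 : lN s3 Ra = code (base n) e by rewrite s3E.
have T' : lT (sem (LXStore Ra 1) s3) = upd (lT s) (code (base n) e) (lX s3 1).
  by rewrite /= A3 s3E.
have vE : valid n e -> lX s3 1 = value 0 e by rewrite s3E.
have [fb' keep' new'] := store_ok ek eB fb T' vE.
split=> //.
have := steps_load_address es eb; move: st; rewrite /fill_last_bound.
by rewrite [steps (LXConst _ _) _]/= [steps (LXStore _ _) _]/=; lia.
Qed.

Lemma env_set n e s j v : env n e s -> env n (upd e j v) (setlN s (Re j) v).
Proof.
move=> [sn s1 sB sS sE]; split=> //= i.
by rewrite /upd xpair_eqE eqxx /=; case: eqP.
Qed.

Fixpoint for_bound n t j : nat :=
  if j is i.+1 then (base n * (for_bound n t i + 2).+1).+2 else t.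

(** By induction on the number of nested loops. The invariant [good m] of the outermost one says
    that, after [m] rounds, the valid entries with digit below [m] at its position and with the
    higher digits of [e] are filled. Inner loops leave their counters at arbitrary values, whence
    the existential [e1]. *)
Lemma for_all_ok n t p k : step_ok n t p k -> k <= n -> forall j, j <= K ->
  forall s e, env n e s -> e K = k -> (forall i, e i <= base n) ->
    (forall i, j <= i < K -> e i < base n) -> filled_below n k s ->
  let s' := sem (for_all j p) s in
  [/\ exists e1, [/\ env n e1 s', forall i, e1 i <= base n
                   & forall i, j <= i -> e1 i = e i],
    filled_below n k s',
    forall e', valid n e' -> e' K = k -> filled n s e' -> filled n s' e',
    forall e', valid n e' -> (forall i, j <= i <= K -> e' i = e i) ->
      filled n s' e'
  & steps (for_all j p) s <= for_bound n t j].
Proof.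
move=> okp kn; elim=> [|j IHj] jK s e es ek eb eB fb s'.
  have [es' fb' keep new st] := okp s e es ek eb (fun i iK => eB i iK) fb.
  split=> //; first by exists e.
  move=> e' [e'n e'c] ee'; have E : code (base n) e' = code (base n) e.
    by apply: eq_bigr => i _; rewrite ee' //=; case: i => i /=; rewrite ltnS.
  have ve : valid n e.
    split; first by rewrite -ee' ?leqnn.
    by move=> i iK; rewrite -(ee' i) ?(ltnW iK) // -(ee' K) ?leqnn //; exact: e'c.
  have := new ve; rewrite /filled E => ->; rewrite ek.
  have -> : e' K = k by rewrite ee' ?leqnn.
  by apply: value_ext => i iK; rewrite ee' //=; exact: ltnW.
rewrite {}/s' [for_all _ _]/= sem_seq steps_seq.
set s0 := sem (LNConst _ _) s.
set body := LSeq (for_all j p) _.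
have base0 : 0 < base n by rewrite /base addn2.
pose good m s2 := [/\ exists e1, [/\ env n e1 s2, forall i, e1 i <= base n, e1 j = m
                   & forall i, j < i -> e1 i = e i],
    filled_below n k s2,
    forall e', valid n e' -> e' K = k -> filled n s e' -> filled n s2 e'
  & forall e', valid n e' -> (forall i, j < i <= K -> e' i = e i) -> e' j < m ->
      filled n s2 e'].
have good_body m s2 : m < base n -> good m s2 -> good m.+1 (sem body s2) /\
    steps body s2 <= (for_bound n t j + 2).
  move=> mB [[e1 [es1 eb1 e1m e1e]] fb2 keep2 new2].
  have e1K : e1 K = k by rewrite e1e.
  have e1B i : j <= i < K -> e1 i < base n.
    move=> /andP[]; rewrite leq_eqVlt => /orP[/eqP <-|ji iK]; first by rewrite e1m.
    by rewrite e1e //; apply: eB; rewrite ji.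
  have [[e3 [es3 eb3 e3e]] fb3 keep3 new3 st3] := IHj (ltnW jK) s2 e1 es1 e1K eb1 e1B fb2.
  split; last by rewrite steps_seq leq_add.
  rewrite sem_seq; set s3 := sem (for_all j p) s2 in es3 fb3 keep3 new3 *.
  have e3m : e3 j = m by rewrite e3e // e1m.
  have s4E : sem (LNAdd (Re j) (Re j) R1) s3 = setlN s3 (Re j) m.+1.
    by case: es3 => _ /= -> _ _ ->; rewrite e3m addn1.
  rewrite s4E; split=> //.
  - exists (upd e3 j m.+1); split.
    + exact: env_set es3.
    + by move=> i; rewrite /upd; case: eqP.
    + by rewrite /upd eqxx.
    + by move=> i ji; rewrite /upd gtn_eqF // e3e ?(ltnW ji) // e1e.
  - by move=> e' ve' e'k f; apply: keep3 => //; exact: keep2.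
  - move=> e' ve' e'e; rewrite ltnS leq_eqVlt => /orP[/eqP e'm|e'm].
      apply: new3 => // i /andP[]; rewrite leq_eqVlt => /orP[/eqP <- _|ji iK].
        by rewrite e'm e1m.
      by rewrite e'e ?ji // e1e.
    have e'k : e' K = k by rewrite e'e ?jK ?leqnn.
    by apply: keep3 => //; exact: new2.
have good0 : good 0 s0.
  split=> //; exists (upd e j 0); split.
  - exact: env_set es.
  - by move=> i; rewrite /upd; case: eqP.
  - by rewrite /upd eqxx.
  - by move=> i ji; rewrite /upd gtn_eqF.
have good_iter m : m <= base n -> good m (iter m (sem body) s0).
  elim: m => [//|m IHm] mB; rewrite iterS.
  by case: (good_body m (iter m (sem body) s0) mB (IHm (ltnW mB))).
have s0B : lN s0 RB = base n by case: es.
have semE : sem (LRep RB body) s0 = iter (base n) (sem body) s0 by rewrite -s0B.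
have [[e1 [es1 eb1 _ e1e]] fb1 keep1 new1] := good_iter _ (leqnn _).
rewrite semE; split=> //.
- by exists e1.
- move=> e' ve' e'e; apply: new1 => //; exact: valid_base.
- have st : steps (LRep RB body) s0 <= (lN s0 RB * (for_bound n t j + 2).+1).+1.
    apply: steps_rep_le => i; rewrite s0B => iB.
    by case: (good_body i (iter i (sem body) s0) iB (good_iter i (ltnW iB))).
  by rewrite s0B in st; rewrite [steps (LNConst _ _) _]/= add1n ltnS.
Qed.

Definition fill_bound (n : nat) : nat :=
  for_bound n (fill_step_bound n + fill_last_bound n) K.

Lemma step_ok_le n t t' p k : t <= t' -> step_ok n t p k -> step_ok n t' p k.
Proof.
move=> tt ok s e es ek eb eB fb.
by have [es' fb' keep new st] := ok s e es ek eb eB fb; split=> //; apply: leq_trans tt.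
Qed.

Lemma fill_plane n k s e p : k <= n ->
  step_ok n (fill_step_bound n + fill_last_bound n) p k ->
  env n e s -> e K = k -> (forall i, e i <= base n) -> filled_below n k s ->
  let s' := sem (for_all K p) s in
  [/\ exists e1, [/\ env n e1 s', forall i, e1 i <= base n & e1 K = k],
    filled_below n k.+1 s' & steps (for_all K p) s <= fill_bound n].
Proof.
move=> kn okp es ek eb fb s'.
have eB i : K <= i < K -> e i < base n by move=> /andP[Ki /(leq_ltn_trans Ki)]; rewrite ltnn.
have [[e1 [es1 eb1 e1e]] fb1 _ new st] := for_all_ok okp kn (leqnn K) es ek eb eB fb.
split=> //; first by exists e1; split=> //; rewrite e1e.
move=> e' ve'; rewrite ltnS leq_eqVlt => /orP[/eqP e'k|e'k]; last exact: fb1.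
apply: new => // i; rewrite -eqn_leq => /eqP <-; by rewrite e'k.
Qed.

Definition setup_bound n := 6 + c + K * (2 * base n + 2).

Lemma setup_ok n s : lN s Rn = n -> (forall j, lN s (Re j) = 0) ->
  let s' := sem setup s in env n (fun=> 0) s' /\ steps setup s <= setup_bound n.
Proof.
move=> sn sE; rewrite /setup 4!sem_seq 4!steps_seq.
set s1 := sem (LNConst RB 2) _.
have H k (t : lstate F) : lN t Rn = n -> let p := lseq (nseq k (LNAdd RB RB Rn)) in
    sem p t = setlN t RB (lN t RB + k * n) /\ steps p t = k + 1.
  elim: k t => [|k IHk] t tn p.
    by rewrite /p sem_lskip mul0n addn0 /setlN upd_id; case: t {tn}.
  rewrite /p sem_cons steps_cons; have [-> ->] := IHk (sem (LNAdd RB RB Rn) t) tn.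
  by rewrite /setlN /= upd_upd /upd eqxx tn mulSn addnA.
have [] := H c s1 sn => -> ->; rewrite [lN s1 RB]/=.
set s2 := sem (LNConst (Rs 0) 1) _.
have B2 : lN s2 RB = base n by rewrite /= /upd /= addnC.
have H2 m k (t : lstate F) : m + k = K -> lN t RB = base n ->
    (forall j, j <= m -> lN t (Rs j) = base n ^ j) ->
    let p := lseq [seq LSeq (LNConst (Rs j.+1) 0)
      (LRep RB (LNAdd (Rs j.+1) (Rs j.+1) (Rs j))) | j <- iota m k] in
    [/\ forall r, r.1 != 7 -> lN (sem p t) r = lN t r,
      forall j, j <= K -> lN (sem p t) (Rs j) = base n ^ j
    & steps p t <= k * (2 * base n + 2) + 1].
  elim: k m t => [|k IHk] m t mk tB tS p.
    by rewrite /p sem_lskip; split=> // j; rewrite -mk addn0; exact: tS.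
  rewrite /p map_cons sem_cons steps_cons sem_seq steps_seq.
  have mm : Rs m.+1 != Rs m by rewrite xpair_eqE eqxx /=; lia.
  rewrite sem_rep_addN // (@steps_rep_const _ _ _ 1) //.
  set t0 := sem (LNConst (Rs m.+1) 0) t; set t1 := setlN t0 _ _.
  have t0m : lN t0 (Rs m.+1) = 0 by rewrite /= /upd eqxx.
  have t0S : lN t0 (Rs m) = base n ^ m by rewrite /= /upd eq_sym (negPf mm) tS.
  have t1B : lN t1 RB = base n by [].
  have t1S j : j <= m.+1 -> lN t1 (Rs j) = base n ^ j.
    rewrite leq_eqVlt => /orP[/eqP->|jm].
      have -> : lN t1 (Rs m.+1) = lN t0 (Rs m.+1) + lN t0 RB * lN t0 (Rs m).
        by rewrite /t1 [LHS]/= {1}/upd eqxx.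
      by rewrite t0m t0S expnS -tB.
    by rewrite /= /upd !xpair_eqE !eqxx /= ltn_eqF ?tS.
  have [N1 S1 st] := IHk m.+1 t1 (etrans (addSnnS m k) mk) t1B t1S.
  split=> //.
    by move=> r r7; rewrite N1 //= /upd; case: eqP => // rE; rewrite rE in r7.
  rewrite mulSn -[leqRHS]addnA; apply: leq_add st.
  have -> : lN t0 RB = base n by exact: tB.
  by rewrite /=; lia.
have [] := H2 0 K s2 erefl B2; first by move=> j; rewrite leqn0 => /eqP ->.
move=> N3 S3 st3; split.
  split=> //; rewrite ?N3 //.
  by move=> j; rewrite N3 //; exact: sE.
move: st3; rewrite /setup_bound [steps (LNConst _ _) _]/=
  [steps (LNConst _ _) _]/= [steps (LNConst _ _) _]/=; lia.
Qed.

Definition evaluate_bound n : nat :=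
  setup_bound n + fill_bound n * n.+1 + 2 * n + 2 * K + K.+1 * (2 * base n + 1) + 10.

Hypothesis c_gt0 : 0 < c.
Hypothesis start_le1 : forall j, j < K -> start j <= 1.

Lemma evaluate_ok n s : lN s Rn = n -> (forall j, lN s (Re j) = 0) ->
  [/\ lX (sem evaluate s) 0 = value n start, lN (sem evaluate s) Rn = n
  & steps evaluate s <= evaluate_bound n].
Proof.
move=> sn sE; rewrite /evaluate 8!sem_seq 8!steps_seq.
have [es1 st1] := setup_ok sn sE; set s1 := sem setup s in es1 st1 *.
(* The register [Re K] reaches [n.+1], and the time bounds assume every counter to be at most the
   base. *)
have n_base : n.+1 <= base n by rewrite /base; nia.
set s2 := sem (LNConst (Re K) 0) s1.
have es2 : env n (upd (fun=> 0) K 0) s2 by exact: env_set.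
have [] := @fill_plane n 0 s2 (upd (fun=> 0) K 0) fill_last (leq0n n).
- by apply: step_ok_le (@fill_last_ok n); rewrite leq_addl.
- exact: es2.
- by rewrite /upd eqxx.
- by move=> i; rewrite /upd; case: eqP.
- by [].
set s3 := sem (for_all K fill_last) s2 => -[e3 [es3 eb3 e3K]] fb3 st3.
set s4 := sem (LNConst (Re K) 1) s3.
set body := LSeq (for_all K fill_step) _.
pose good m t := (exists e1, [/\ env n e1 t, forall i, e1 i <= base n & e1 K = m.+1])
  /\ filled_below n m.+1 t.
have good_body m t : m < n -> good m t ->
    good m.+1 (sem body t) /\ steps body t <= fill_bound n + 1.
  move=> mn [[e1 [es eb eK]] fb].
  have okp : step_ok n (fill_step_bound n + fill_last_bound n) fill_step m.+1.
    by apply: step_ok_le (@fill_step_ok n _ (ltn0Sn m)); rewrite leq_addr.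
  have [[e2 [es' eb' e2K]] fb' st'] := fill_plane mn okp es eK eb fb.
  split; last by rewrite steps_seq leq_add.
  rewrite sem_seq; set t1 := sem (for_all K fill_step) t in es' fb' *.
  have -> : sem (LNAdd (Re K) (Re K) R1) t1 = setlN t1 (Re K) m.+2.
    by case: es' => _ /= -> _ _ ->; rewrite e2K addn1.
  split=> //; exists (upd e2 K m.+2); split; first exact: env_set.
    move=> i; rewrite /upd; case: eqP => // _; lia.
  by rewrite /upd eqxx.
have good4 : good 0 s4.
  split=> //; exists (upd e3 K 1); split; first exact: env_set.
    by move=> i; rewrite /upd; case: eqP => // _; lia.
  by rewrite /upd eqxx.
have good_iter m : m <= n -> good m (iter m (sem body) s4).
  elim: m => [//|m IHm] mn; rewrite iterS.
  by case: (good_body m (iter m (sem body) s4) mn (IHm (ltnW mn))).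
have s4n : lN s4 Rn = n by case: es3.
have -> : sem (LRep Rn body) s4 = iter n (sem body) s4 by rewrite -s4n.
have st5 : steps (LRep Rn body) s4 <= (lN s4 Rn * (fill_bound n + 1).+1).+1.
  apply: steps_rep_le => i; rewrite s4n => iB.
  by case: (good_body i (iter i (sem body) s4) iB (good_iter i (ltnW iB))).
rewrite s4n -addnS in st5.
have [[e5 [es5 eb5 e5K]] fb5] := good_iter n (leqnn n).
set s5 := iter n (sem body) s4 in es5 fb5 *.
set s6 := sem (LNSub (Re K) (Re K) R1) s5.
have s6E : s6 = setlN s5 (Re K) n.
  by rewrite /s6; case: es5 => _ /= -> _ _ ->; rewrite e5K subn1.
have es6 : env n (upd e5 K n) s6 by rewrite s6E; exact: env_set.
have H js e t : env n e t -> let p := lseq [seq LNConst (Re j) (start j) | j <- js] in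
    [/\ env n (fun j => if j \in js then start j else e j) (sem p t),
      lT (sem p t) = lT t & steps p t = seq.size js + 1].
  elim: js e t => [|j js IHjs] e t et p; first by rewrite /p sem_lskip.
  rewrite /p map_cons sem_cons steps_cons.
  have [et' -> ->] := IHjs _ _ (env_set j (start j) et); split=> //.
  rewrite (_ : (fun _ => _) = fun i => if i \in js then start i else upd e j (start j) i) //.
  apply: funext => i; rewrite inE /upd; case: (i \in js); rewrite ?orbT ?orbF //.
  by case: eqP => [->|].
have [] := H (iota 0 K) _ _ es6.
set s7 := sem _ s6; set e7 := fun j => _ => es7 T7 st7.
have e7K : e7 K = n by rewrite /e7 mem_iota ltnn /upd eqxx.
have e7s j : j < K -> e7 j = start j by rewrite /e7 mem_iota => ->.
rewrite (load_address_env es7).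
(* With all [n] moves remaining, validity bounds the counters by 1, which is the assumption on
   [start]. *)
have ve7 : valid n e7.
  split; first by rewrite e7K.
  by move=> j jK; rewrite e7s // e7K subnn muln0 start_le1.
have := fb5 _ ve7; rewrite e7K => /(_ (leqnn _)); rewrite /filled e7K => f7.
have b7 j : e7 j <= base n.
  rewrite /e7; case: ifP => jK.
    by rewrite mem_iota in jK; have := start_le1 jK; lia.
  by rewrite /upd; case: eqP => // _; lia.
have st8 := steps_load_address es7 b7.
split.
- rewrite (_ : lX _ 0 = lT s7 (code (base n) e7)) // T7 s6E f7.
  by apply: value_ext => j jK; rewrite e7s.
- by case: es7.
- rewrite st7 size_iota /evaluate_bound.
  rewrite [steps (LNConst _ _) _]/= [steps (LNConst _ _) _]/=
    [steps (LNSub _ _ _) _]/= [steps (LXLoad _ _) _]/=.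
  have : steps (for_all K fill_last) s2 + (n * (fill_bound n + 2)).+1 <=
      fill_bound n * n.+1 + 2 * n + 1.
    by move: st3; nia.
  lia.
Qed.

End Evaluation.

(** * Constants and running time of the table program *)

Section Constants.

Local Open Scope nat_scope.

Variables (F : realFieldType) (K c : nat) (moves : seq (move F)).
Variables (fin : seq (nat * F)) (start : nat -> nat) (W : F -> Prop).

Lemma generated_one : generated W 1%R.
Proof. exact: (gen_bit _ true). Qed.

Definition generated_consts (p : loop F) : Prop :=
  forall x, x \in consts p -> generated W x.

Lemma generated_consts_seq p q :
  generated_consts p -> generated_consts q -> generated_consts (LSeq p q).
Proof. by move=> gp gq x; rewrite [consts _]/= mem_cat => /orP[/gp|/gq]. Qed.

Lemma generated_consts_rep r p :
  generated_consts p -> generated_consts (LRep r p).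
Proof. by []. Qed.

Lemma generated_consts_mul i j x :
  generated W x -> generated_consts (LXMul i j x).
Proof. by move=> gx y; rewrite inE => /eqP ->. Qed.

Lemma generated_consts_map (T : eqType) (f : T -> loop F) (ts : seq T) :
  (forall t, t \in ts -> generated_consts (f t)) ->
  generated_consts (lseq [seq f t | t <- ts]).
Proof.
elim: ts => [|t ts IHts] gp; first exact/generated_consts_mul/generated_one.
apply: generated_consts_seq; first by apply: gp; rewrite mem_head.
by apply: IHts => u uts; apply: gp; rewrite inE uts orbT.
Qed.

Lemma generated_consts_nseq p k :
  generated_consts p -> generated_consts (lseq (nseq k p)).
Proof.
move=> gp; elim: k => [|k IHk]; first exact/generated_consts_mul/generated_one.
exact: generated_consts_seq.
Qed.

Lemma generated_consts_for_all j p :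
  generated_consts p -> generated_consts (for_all j p).
Proof.
move=> gp; elim: j => // j gj; apply: generated_consts_seq => //.
by apply/generated_consts_rep/generated_consts_seq.
Qed.

Lemma generated_consts_evaluate :
  (forall m, m \in moves -> generated W (mcoef m) /\
     forall q, q \in mpow m -> generated W q.2) ->
  (forall q, q \in fin -> generated W q.2) ->
  generated_consts (evaluate K c moves fin start).
Proof.
move=> gm gf.
have address : generated_consts (load_address F K).
  by apply: generated_consts_seq => //; exact: generated_consts_map.
repeat apply: generated_consts_seq => //.
- exact: generated_consts_nseq.
- by apply: generated_consts_map => j _; exact: generated_consts_seq.
- apply: generated_consts_for_all; repeat apply: generated_consts_seq => //.
  by apply: generated_consts_map => q qf; exact/generated_consts_mul/gf.
- apply: generated_consts_rep; apply: generated_consts_seq => //.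
  apply: generated_consts_for_all; repeat apply: generated_consts_seq => //.
  apply: generated_consts_map => m mm; have [gc gp] := gm m mm.
  repeat apply: generated_consts_seq => //.
  + exact: generated_consts_map.
  + exact: generated_consts_mul.
  + apply: generated_consts_map => q qm; repeat apply: generated_consts_seq => //.
    exact/generated_consts_mul/gp.
- exact: generated_consts_map.
Qed.

(** The nesting depth [K] does not depend on [n], so the nested bound [for_bound] is a polynomial
    whose degree depends on [K]. *)
Lemma poly_evaluate_bound : poly_bounded (evaluate_bound K c moves fin).
Proof.
have pb : poly_bounded (base c).
  by do ![exact: poly_bounded_const | exact: poly_bounded_id | apply: poly_bounded_add | apply: poly_bounded_mul].
have pm : poly_bounded (fun n => \sum_(m <- moves) move_steps (base c n) m).
  apply: poly_bounded_sum => m; rewrite /move_steps.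
  by do ![exact: poly_bounded_const | exact: pb | apply: poly_bounded_add
         | apply: poly_bounded_mul].
have pf : poly_bounded (fill_bound K c moves fin).
  rewrite /fill_bound.
  have pt : poly_bounded (fun n => fill_step_bound K c moves n + fill_last_bound K c fin n).
    rewrite /fill_step_bound /fill_last_bound.
    by do ![exact: pm | exact: poly_bounded_const | exact: pb | apply: poly_bounded_add | apply: poly_bounded_mul].
  have pfor t k : poly_bounded t -> poly_bounded (fun n => for_bound c n (t n) k).
    move=> pt'; elim: k => [|k IHk] //=.
    by do ![exact: IHk | exact: poly_bounded_const | exact: pb
           | apply: poly_bounded_succ | apply: poly_bounded_add
           | apply: poly_bounded_mul].
  exact: pfor pt.
rewrite /evaluate_bound /setup_bound.
by do ![exact: pf | exact: poly_bounded_const | exact: pb | exact: poly_bounded_id | apply: poly_bounded_succ | apply: poly_bounded_add | apply: poly_bounded_mul].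
Qed.

End Constants.

(** * Multiplication by factorials and by powers *)

Section Multipliers.

Local Open Scope nat_scope.

Variable F : realFieldType.

Definition Ro : nreg := (9, 0).
Definition Ri : nreg := (10, 0).
Definition Rc : nreg := (11, 0).
Definition Rd : nreg := (12, 0).

Definition multiplies (p : loop F) (g : nat -> F) (t : nat -> nat) : Prop :=
  forall n s, lN s Rn = n -> [/\ lX (sem p s) 0 = (lX s 0 * g n)%R,
    lN (sem p s) Rn = n & steps p s <= t n].

(** The factor of a round changes with the round and is not a constant of the program, so the
    product is formed by repeated addition. *)
Definition multiply_fact : loop F :=
  LSeq (LNConst Ro 1) (LSeq (LNConst Ri 0)
  (LRep Rn (LSeq (LNAdd Ri Ri Ro)
    (LSeq (LXConst 1 false) (LSeq (LRep Ri (LXAdd 1 1 0))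
    (LSeq (LXConst 0 false) (LXAdd 0 0 1))))))).

Lemma multiply_factP : multiplies multiply_fact (fun n => n`!%:R%R)
  (fun n => n * (2 * n + 8) + 3).
Proof.
move=> n s sn; rewrite /multiply_fact 2!sem_seq 2!steps_seq.
set s0 := sem (LNConst Ri 0) _; set body := LSeq (LNAdd _ _ _) _.
have H k : [/\ lN (iter k (sem body) s0) Rn = n, lN (iter k (sem body) s0) Ro = 1,
    lN (iter k (sem body) s0) Ri = k
    & lX (iter k (sem body) s0) 0 = (lX s 0 * k`!%:R)%R].
  elim: k => [|k [IHn IHo IHi IHx]]; first by split=> //; rewrite mulr1.
  rewrite iterS; set t := iter k _ _ in IHn IHo IHi IHx *.
  rewrite /body 4!sem_seq sem_rep_addX //=.
  split=> //; first by rewrite /upd /= IHo IHi addn1.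
  by rewrite /upd /= !add0r IHo IHi addn1 IHx factS natrM mulrCA mulr_natl.
have s0n : lN s0 Rn = n by [].
have [Hn _ _ Hx] := H n.
have -> : sem (LRep Rn body) s0 = iter n (sem body) s0 by rewrite -s0n.
split=> //.
have st : steps (LRep Rn body) s0 <= (lN s0 Rn * (2 * n + 7).+1).+1.
  apply: steps_rep_le => i; rewrite s0n => iN; have [_ Ho Hi _] := H i.
  rewrite /body 4!steps_seq (@steps_rep_const _ _ _ 1) //= /upd /= Ho Hi; lia.
by move: st; rewrite s0n [steps (LNConst _ _) _]/= [steps (LNConst _ _) _]/=; lia.
Qed.

Definition count_tuples (a k b b' : nat) : loop F :=
  LSeq (LNConst Ro 1) (LSeq (LNConst Rc 1)
  (LSeq (lseq (nseq a (LSeq (LNConst Rd 0) (LSeq (LRep Rn (LNAdd Rd Rd Rc))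
          (LSeq (LNConst Rc 0) (LNAdd Rc Rc Rd))))))
  (LSeq (LNConst Ri 0) (LSeq (LNConst Rd 0)
  (LSeq (LRep Rn (LSeq (LNAdd Rd Rd Ri) (LNAdd Ri Ri Ro)))
  (LSeq (lseq (nseq k (LNSub Rc Rc Rd)))
  (LSeq (lseq (nseq b (LNSub Rc Rc Rn))) (lseq (nseq b' (LNSub Rc Rc Ro)))))))))).

(** For suitable coefficients this is the number of [a]-tuples with at least three distinct
    components: from all tuples, [k] are removed for each pair of elements, [b] for each element and
    [b'] for the empty set. *)
Definition tuple_count a k b b' n := n ^ a - k * 'C(n, 2) - b * n - b'.

Lemma count_tuplesP a k b b' n s : lN s Rn = n ->
  let p := count_tuples a k b b' in
  [/\ lX (sem p s) = lX s, lN (sem p s) Rn = n,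
      lN (sem p s) Rc = tuple_count a k b b' n
    & steps p s <= a * (2 * n + 4) + 3 * n + k + b + b' + 9].
Proof.
move=> sn; rewrite /count_tuples 8!sem_seq 8!steps_seq.
set s1 := sem (LNConst Rc 1) _.
pose same (t t' : lstate F) := [/\ lX t' = lX t, lN t' Rn = lN t Rn & lN t' Ro = lN t Ro].
have same_trans t t' t'' : same t t' -> same t' t'' -> same t t''.
  by move=> [X1 n1 o1] [X2 n2 o2]; split; rewrite ?X2 ?n2 ?o2.
have Ha j (t : lstate F) : lN t Rn = n ->
   let p := lseq (nseq j (LSeq (LNConst Rd 0) (LSeq (LRep Rn (LNAdd Rd Rd Rc))
          (LSeq (LNConst Rc 0) (LNAdd Rc Rc Rd))))) in
   [/\ same t (sem p t), lN (sem p t) Rc = lN t Rc * n ^ j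
     & steps p t = j * (2 * n + 4) + 1].
  elim: j t => [|j IHj] t tn p.
    by rewrite /p sem_lskip muln1; split.
  rewrite /p sem_cons steps_cons; set q := LSeq (LNConst Rd 0) _.
  have qE : sem q t = setlN (setlN t Rd (lN t Rc * n)) Rc (lN t Rc * n).
    rewrite /q 3!sem_seq sem_rep_addN //; set t0 := sem (LNConst Rd 0) t.
    have -> : lN t0 Rd + lN t0 Rn * lN t0 Rc = lN t Rc * n by rewrite mulnC -tn.
    by rewrite /t0 /= /setlN /= !upd_upd.
  have qn : lN (sem q t) Rn = n by rewrite qE.
  have [st Rct ->] := IHj _ qn; split.
  - by apply: same_trans st; rewrite qE; split.
  - by rewrite Rct qE [lN _ Rc]/= {1}/upd eqxx expnS mulnA.
  - rewrite /q 3!steps_seq (@steps_rep_const _ _ _ 1) //.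
    have -> : lN (sem (LNConst Rd 0) t) Rn = n by [].
    rewrite [steps (LNConst _ _) _]/= [steps (LNConst _ _) _]/=
      [steps (LNAdd _ _ _) _]/=; lia.
have s1n : lN s1 Rn = n by [].
have [] := Ha a s1 s1n; set s2 := sem (lseq _) s1 => sm2 c2 ->.
set s4 := sem (LNConst Rd 0) _.
have [X2 n2 o2] := sm2.
have Hb j : [/\ same s4 (iter j (sem (LSeq (LNAdd Rd Rd Ri) (LNAdd Ri Ri Ro))) s4),
    lN (iter j (sem (LSeq (LNAdd Rd Rd Ri) (LNAdd Ri Ri Ro))) s4) Ri = j,
    lN (iter j (sem (LSeq (LNAdd Rd Rd Ri) (LNAdd Ri Ri Ro))) s4) Rd = 'C(j, 2)
  & lN (iter j (sem (LSeq (LNAdd Rd Rd Ri) (LNAdd Ri Ri Ro))) s4) Rc = lN s4 Rc].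
  elim: j => [|j [sj ij dj cj]]; first by split.
  rewrite iterS; set t := iter j _ _ in sj ij dj cj *.
  split.
  - by apply: same_trans sj _; split.
  - rewrite /= /upd /= ij; case: sj => _ _ ->.
    by rewrite /= /upd /= o2 addn1.
  - by rewrite /= /upd /= ij dj binS bin1.
  - exact: cj.
have s4n : lN s4 Rn = n by rewrite -s1n -n2.
have -> : sem (LRep Rn (LSeq (LNAdd Rd Rd Ri) (LNAdd Ri Ri Ro))) s4 =
  iter n (sem (LSeq (LNAdd Rd Rd Ri) (LNAdd Ri Ri Ro))) s4 by rewrite -[in RHS]s4n.
have [] := Hb n; set s5 := iter n _ s4 => sm5 i5 d5 c5.
rewrite (@steps_rep_const _ _ _ 2) // s4n.
have Hc j r (t : lstate F) : r != Rc -> let p := lseq (nseq j (LNSub Rc Rc r)) in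
   sem p t = setlN t Rc (lN t Rc - j * lN t r) /\ steps p t = j + 1.
  move=> rc; elim: j t => [|j IHj] t p.
    by rewrite /p sem_lskip subn0 /setlN upd_id; case: t.
  rewrite /p sem_cons steps_cons; have [-> ->] := IHj (sem (LNSub Rc Rc r) t).
  rewrite /setlN /= upd_upd {2 3}/upd eqxx (negPf rc); split=> //.
  by rewrite -subnDA mulSn.
have [] := Hc k Rd s5 isT => -> ->; set s6 := setlN s5 _ _.
have [] := Hc b Rn s6 isT => -> ->; set s7 := setlN s6 _ _.
have [] := Hc b' Ro s7 isT => -> ->.
have [X5 n5 o5] := sm5.
split=> //.
- by rewrite /= X5 /= X2.
- by rewrite /= /upd /= n5 s4n.
- rewrite /= /upd /= d5 n5 o5 c5 s4n /= /upd /= o2 c2 /=.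
  by rewrite /upd /= mul1n muln1.
- rewrite [steps (LNConst _ _) _]/= [steps (LNConst _ _) _]/=
   [steps (LNConst _ _) _]/= [steps (LNConst _ _) _]/=; lia.
Qed.

Definition multiply_power (a k b b' : nat) (x : F) : loop F :=
  LSeq (count_tuples a k b b') (LRep Rc (LXMul 0 0 x)).

Lemma multiply_powerP a k b b' x :
  multiplies (multiply_power a k b b' x) (fun n => x ^+ tuple_count a k b b' n)%R
    (fun n => a * (2 * n + 4) + 3 * n + k + b + b' + 9 + 2 * n ^ a + 1).
Proof.
move=> n s sn; have [X1 n1 c1 st] := @count_tuplesP a k b b' n s sn.
rewrite /multiply_power sem_seq steps_seq sem_rep_mulX (@steps_rep_const _ _ _ 1) //.
rewrite c1 X1; split=> //.
have : tuple_count a k b b' n <= n ^ a by rewrite /tuple_count; lia.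
by lia.
Qed.

Lemma multiplies_seq p q g h t t' : multiplies p g t -> multiplies q h t' ->
  multiplies (LSeq p q) (fun n => g n * h n)%R (fun n => t n + t' n).
Proof.
move=> mp mq n s sn; have [X1 n1 st1] := mp n s sn.
have [X2 n2 st2] := mq n (sem p s) n1.
by rewrite sem_seq steps_seq X2 X1 mulrA; split=> //; exact: leq_add.
Qed.

Lemma multiplies_lseq (I : Type) (r : seq I) (p : I -> loop F) g t :
  (forall i, multiplies (p i) (g i) (t i)) ->
  multiplies (lseq [seq p i | i <- r]) (fun n => \prod_(i <- r) g i n)%R
    (fun n => \sum_(i <- r) t i n + 1).
Proof.
move=> mp; elim: r => [|i r IHr] n s sn.
  by rewrite sem_lskip !big_nil mulr1; split.
have [X1 n1 st1] := mp i n s sn.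
have [X2 n2 st2] := IHr n (sem (p i) s) n1.
rewrite map_cons sem_cons steps_cons X2 X1 !big_cons mulrA; split=> //.
by rewrite -addnA leq_add.
Qed.

End Multipliers.

Lemma polytime_computable_eq (F : realFieldType) (size : F -> nat) (sig : finType)
    (w wbar : sig -> F) (f g : nat -> F) : (forall n, 0 < n -> f n = g n) ->
  polytime_computable size w wbar f -> polytime_computable size w wbar g.
Proof.
move=> fg [p [c [k H]]]; exists p, c, k => n n_gt0; have [t [s [ex tb st]]] := H n n_gt0.
by exists t, s; split=> //; rewrite st fg.
Qed.

(** The interface between machine and combinatorics: it remains to bring the count into this form,
    with coefficients in the ring generated by the weights. *)
Lemma recurrence_polytime (F : realFieldType) (size : F -> nat) (sig : finType)
    (w wbar : sig -> F) (hs : height_system size (weights w wbar))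
    (K c : nat) (moves : seq (move F)) (fin : seq (nat * F)) (start : nat -> nat)
    (pw : seq (nat * nat * nat * nat * F)) :
  well_indexed K c moves fin -> 0 < c -> (forall j, j < K -> start j <= 1) ->
  (forall m, m \in moves -> generated (weights w wbar) (mcoef m) /\
     forall q, q \in mpow m -> generated (weights w wbar) q.2) ->
  (forall q, q \in fin -> generated (weights w wbar) q.2) ->
  (forall q, q \in pw -> generated (weights w wbar) q.2) ->
  polytime_computable size w wbar (fun n => value moves fin n start *
    (n`!%:R * \prod_(q <- pw)
       q.2 ^+ tuple_count q.1.1.1.1 q.1.1.1.2 q.1.1.2 q.1.2 n))%R.
Proof.
move=> wi c0 s1 gm gf gp.
pose q0 (q : nat * nat * nat * nat * F) :=
  multiply_power q.1.1.1.1 q.1.1.1.2 q.1.1.2 q.1.2 q.2.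
pose p1 := evaluate K c moves fin start.
pose p2 := LSeq (multiply_fact F) (lseq [seq q0 q | q <- pw]).
have mp2 := multiplies_seq (@multiply_factP F) (multiplies_lseq pw (fun q =>
  @multiply_powerP F q.1.1.1.1 q.1.1.1.2 q.1.1.2 q.1.2 q.2)).
have ev n : [/\ lX (sem p1 (linit F n)) 0 = value moves fin n start,
    lN (sem p1 (linit F n)) Rn = n
  & steps p1 (linit F n) <= evaluate_bound K c moves fin n].
  exact: (evaluate_ok wi c0 s1).
apply: (@polytime_computable_eq _ _ _ _ _ (fun n => lX (sem (LSeq p1 p2) (linit F n)) 0)).
  move=> n _; have [X1 n1 _] := ev n.
  by have [X2 _ _] := mp2 n _ n1; rewrite sem_seq X2 X1.
apply: (compile_correct hs).
  apply: generated_consts_seq; first exact: generated_consts_evaluate.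
  apply: generated_consts_seq => //.
  apply: generated_consts_map => q qp.
  repeat apply: generated_consts_seq => //; try exact: generated_consts_nseq.
  exact/generated_consts_mul/gp.
apply: (@poly_bounded_le _ (fun n => evaluate_bound K c moves fin n +
    (n * (2 * n + 8) + 3 + (\sum_(q <- pw) (q.1.1.1.1 * (2 * n + 4) + 3 * n +
      q.1.1.1.2 + q.1.1.2 + q.1.2 + 9 + 2 * n ^ q.1.1.1.1 + 1) + 1)))).
  move=> n; have [X1 n1 st1] := ev n; have [_ _ st2] := mp2 n _ n1.
  by rewrite steps_seq leq_add.
apply: poly_bounded_add; first exact: poly_evaluate_bound.
apply: poly_bounded_add.
  by do ![exact: poly_bounded_const | exact: poly_bounded_id
         | apply: poly_bounded_add | apply: poly_bounded_mul].
apply: poly_bounded_add (poly_bounded_const 1).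
apply: poly_bounded_sum => q.
by do ![exact: poly_bounded_const | exact: poly_bounded_id
       | apply: poly_bounded_add | apply: poly_bounded_mul | apply: poly_bounded_exp].
Qed.

(** * Counting labelled paths by insertion *)

Section ConsecutivePairs.

Variable T : eqType.

Fixpoint cpair (x : T) (s : seq T) (z : T) : seq (T * T) :=
  if s is y :: s' then (x, y) :: cpair y s' z else [:: (x, z)].

Definition insert (p : nat) (t : T) (s : seq T) : seq T :=
  take p s ++ t :: drop p s.

Lemma size_cpair x s z : size (cpair x s z) = (size s).+1.
Proof. by elim: s x => //= y s IHs x; rewrite IHs. Qed.

Lemma perm_insert p t s : perm_eq (insert p t s) (t :: s).
Proof. by rewrite perm_catC /= perm_cons perm_catC cat_take_drop. Qed.

Lemma cpair_insert x s z p : p <= size s -> exists X Y q,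
  [/\ cpair x s z = X ++ q :: Y, size X = p &
      forall t, cpair x (insert p t s) z = X ++ (q.1, t) :: (t, q.2) :: Y].
Proof.
elim: s x p => [|y s IHs] x [|p] //= ps.
- by exists [::], [::], (x, z).
- by exists [::], (cpair y s z), (x, y); split=> // t; rewrite /insert take0 drop0.
- have [X [Y [q [E sX H]]]] := IHs y p ps.
  exists ((x, y) :: X), Y, q; split=> [||t] /=; rewrite ?E ?sX //.
  by rewrite -H.
Qed.

Lemma cpair_fst x s z : [seq q.1 | q <- cpair x s z] = x :: s.
Proof. by elim: s x => //= y s IHs x; rewrite IHs. Qed.

Lemma cpair_snd x s z : [seq q.2 | q <- cpair x s z] = rcons s z.
Proof. by elim: s x => //= y s IHs x; rewrite IHs. Qed.

Lemma cpair_mem x s z q : q \in cpair x s z ->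
  (q.1 \in x :: s) && (q.2 \in rcons s z).
Proof.
move=> qs; have := map_f fst qs; have := map_f snd qs.
by rewrite cpair_fst cpair_snd => -> ->.
Qed.

Lemma cpair_zip x s z : cpair x s z = zip (x :: s) (rcons s z).
Proof. by elim: s x => //= y s IHs x; rewrite IHs. Qed.

Lemma uniq_cpair x s z : uniq (x :: s) -> uniq (cpair x s z).
Proof. by rewrite -(cpair_fst x s z) => /map_uniq. Qed.

End ConsecutivePairs.

(** * Weights of labelled paths under insertion *)

Section Paths.

Local Open Scope ring_scope.

Variables (F : realFieldType) (C : finType) (c0 : C).
Variables (u b : C -> F) (r : C -> C -> bool -> bool -> F).

Definition r0 (c d : C) : F := r c d false false.

Definition label (l : seq C) (o : option nat) : option C := omap (nth c0 l) o.

Definition gap : Type := (option C * option C * bool)%type.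

(* The flag tells whether the second element was inserted later. *)
Definition gap_type (l : seq C) (q : option nat * option nat) : gap :=
  (label l q.1, label l q.2,
   if q.2 is Some y then if q.1 is Some x then (x < y)%N else true else false).

(** [None] marks both ends, so that a path with [m] elements has [m.+1] gaps and insertion at an end
    is no special case. *)
Definition gaps (s : seq nat) : seq (option nat * option nat) :=
  cpair None [seq Some x | x <- s] None.

Definition adjacent (s : seq nat) (x y : nat) : bool :=
  (Some x, Some y) \in gaps s.

(* The factor of a pair of neighbours once another element separates them. *)
Definition broken (g : gap) : F :=
  match g with
  | (Some c, Some d, true) => r0 c d
  | (Some c, Some d, false) => r0 d c
  | _ => 1
  end.

(* The factor of a pair of elements that remain neighbours. *)
Definition kept (g : gap) : F :=
  match g with
  | (Some c, Some d, true) => r c d true false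
  | (Some c, Some d, false) => r d c false true
  | (None, Some d, _) => b d
  | _ => 1
  end.

Definition path_weight (s : seq nat) (l : seq C) : F :=
  \prod_(y < size s) (u (nth c0 l y) *
    \prod_(x < y) r (nth c0 l x) (nth c0 l y) (adjacent s x y) (adjacent s y x))
  * \prod_(x < size s | (None, Some (x : nat)) \in gaps s) b (nth c0 l x).

(** The part of the weight that no later insertion can change: pairs of current neighbours count 1
    until they are separated. *)
Definition apart_weight (s : seq nat) (l : seq C) : F :=
  \prod_(y < size s) (u (nth c0 l y) *
    \prod_(x < y) if adjacent s x y || adjacent s y x then 1
                  else r0 (nth c0 l x) (nth c0 l y)).

Definition icell (c : C) : nat := enum_rank c.
Definition igap (g : gap) : nat := (#|C| + enum_rank g)%N.
Definition ncounters : nat := (#|C| + #|{: gap}|)%N.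

Definition counters (s : seq nat) (l : seq C) : nat -> nat :=
  fun j => count_mem j ([seq icell c | c <- l] ++
                        [seq igap (gap_type l q) | q <- gaps s]).

(** The insertion settles the pair that it separates ([broken g]) and the pairs of the new element
    with all but its two neighbours, which the exponents leave out. The new element is the later one
    in both new gaps, whence the flags; those that [gap_type] gives at the ends of the path follow
    the same rule. *)
Definition insertion (g : gap) (t : C) : move F :=
  (u t * broken g, igap g,
   [seq (icell c, (g.1.1 == Some c) + (g.1.2 == Some c), r0 c t)%N | c <- enum C],
   [:: icell t; igap (g.1.1, Some t, true); igap (Some t, g.1.2, false)]).

Definition insertions : seq (move F) :=
  [seq insertion g t | g <- enum {: gap}, t <- enum C].

Definition keeping : seq (nat * F) := [seq (igap g, kept g) | g <- enum {: gap}].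

Definition initial (j : nat) : nat := j == igap (None, None, false).

(** The next element is always [size s]: elements arrive in increasing order, that is, in the order
    [L]. *)
Fixpoint total (k : nat) (s : seq nat) (l : seq C) : F :=
  if k is k'.+1 then
    \sum_(p < (size s).+1) \sum_t total k' (insert p (size s) s) (rcons l t)
  else path_weight s l.

Lemma igap_inj : injective igap.
Proof. by move=> g g' /addnI/ord_inj gg'; exact: enum_rank_inj. Qed.

Lemma icell_inj : injective icell.
Proof. by move=> g g' /ord_inj gg'; exact: enum_rank_inj. Qed.

Lemma icell_neq_igap c g : (icell c == igap g) = false.
Proof. by apply: ltn_eqF; rewrite ltn_addr // ltn_ord. Qed.

Lemma counters_igap s l g :
  counters s l (igap g) = count_mem g [seq gap_type l q | q <- gaps s].
Proof.
rewrite /counters count_cat !count_map (@eq_count _ _ pred0); last first.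
  by move=> c; rewrite /= icell_neq_igap.
rewrite count_pred0 add0n; apply: eq_count => q /=.
by rewrite (inj_eq igap_inj).
Qed.

Lemma counters_icell s l c : counters s l (icell c) = count_mem c l.
Proof.
rewrite /counters count_cat !count_map [X in (_ + X)%N](@eq_count _ _ pred0); last first.
  by move=> q; rewrite /= eq_sym icell_neq_igap.
rewrite count_pred0 addn0; apply: eq_count => d /=.
by rewrite (inj_eq icell_inj).
Qed.

Lemma sum_gaps (M : nmodType) (gs : seq gap) (f : gap -> M) :
  \sum_(g <- gs) f g = \sum_(g <- enum {: gap}) f g *+ count_mem g gs.
Proof.
elim: gs => [|g gs IHgs].
  by rewrite big_nil big1 // => g _; rewrite mulr0n.
rewrite big_cons IHgs; under [RHS]eq_bigr do rewrite /= mulrnDr.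
rewrite big_split /=; congr (_ + _).
rewrite big_enum (bigD1 g) //= eqxx mulr1n big1 ?addr0 // => g' /negPf.
by rewrite eq_sym => ->; rewrite mulr0n.
Qed.

Lemma value_keeping s l : value insertions keeping 0 (counters s l) =
  \prod_(q <- gaps s) kept (gap_type l q).
Proof.
rewrite /= big_map -(big_map (gap_type l) xpredT kept).
set gs := map _ _; under eq_bigr do rewrite /= counters_igap -/gs.
elim: gs => [|g gs IHgs].
  by rewrite big_nil big1 // => g _; rewrite expr0.
rewrite big_cons -IHgs; under eq_bigr do rewrite /= exprD.
rewrite big_split /=; congr (_ * _).
rewrite big_enum (bigD1 g) //= eqxx expr1 big1 ?mulr1 // => g' /negPf.
by rewrite eq_sym => ->; rewrite expr0.
Qed.

Definition path_of (m : nat) (s : seq nat) : Prop := perm_eq s (iota 0 m).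

Lemma path_of_size m s : path_of m s -> size s = m.
Proof. by move/perm_size; rewrite size_iota. Qed.

Lemma path_of_uniq m s : path_of m s -> uniq s.
Proof. by move/perm_uniq ->; exact: iota_uniq. Qed.

Lemma path_of_mem m s x : path_of m s -> (x \in s) = (x < m)%N.
Proof. by move/perm_mem ->; rewrite mem_iota. Qed.

Lemma path_of_insert m p s : path_of m s -> path_of m.+1 (insert p m s).
Proof.
move=> ps; rewrite /path_of (perm_trans (perm_insert p m s)) //.
by rewrite -addn1 iotaD add0n perm_sym perm_catC perm_cons perm_sym.
Qed.

Lemma gaps_uniq m s : path_of m s -> uniq (gaps s).
Proof.
move/path_of_uniq => us; apply: uniq_cpair => /=.
rewrite map_inj_uniq ?us ?andbT; first by apply/mapP => -[].
by move=> x y [].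
Qed.

Lemma adjacentE m s x y : path_of m s ->
  adjacent s x y = [&& (x < m)%N, (y < m)%N & index y s == (index x s).+1].
Proof.
move=> ps; have us := path_of_uniq ps; rewrite -!(path_of_mem _ ps).
pose A := None :: [seq Some x | x <- s]; pose B := rcons [seq Some x | x <- s] None.
have sA : size A = (size s).+1 by rewrite /= size_map.
have sB : size B = (size s).+1 by rewrite size_rcons size_map.
have nA i : (i < size s)%N -> nth None A i.+1 = Some (nth 0%N s i).
  by move=> si; rewrite /= (nth_map 0%N).
have nB i : (i < size s)%N -> nth None B i = Some (nth 0%N s i).
  by move=> si; rewrite nth_rcons size_map si (nth_map 0%N).
rewrite /adjacent /gaps cpair_zip -/A -/B; apply/idP/and3P.
  move/(nthP (None, None)) => [i]; rewrite size_zip sA sB minnn => si.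
  rewrite nth_zip ?sA ?sB // => -[].
  case: i si => [//|i]; rewrite ltnS => si; rewrite nA // => -[<-].
  have [si'|] := ltnP i.+1 (size s).
    rewrite nB // => -[<-]; rewrite !mem_nth //; split=> //.
    by rewrite !index_uniq.
  by move=> si'; rewrite nth_rcons size_map ltnNge si' /= if_same.
move=> [xs ys /eqP ixy]; apply/(nthP (None, None)); exists (index y s).
  by rewrite size_zip sA sB minnn ltnS ltnW // index_mem.
rewrite nth_zip ?sA ?sB // nB ?index_mem // nth_index //.
by rewrite ixy nA ?index_mem // nth_index.
Qed.

Lemma adjacent_asym m s x y : path_of m s -> adjacent s x y -> ~~ adjacent s y x.
Proof.
move=> ps; rewrite !(adjacentE _ _ ps) => /and3P[_ _ /eqP xy]; apply/and3P => -[_ _].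
by rewrite xy => /eqP; lia.
Qed.

Lemma gaps_insert m s p : path_of m s -> (p <= m)%N -> exists X Y q,
  [/\ gaps s = X ++ q :: Y, size X = p &
      gaps (insert p m s) = X ++ (q.1, Some m) :: (Some m, q.2) :: Y].
Proof.
move=> ps pm; have sm := path_of_size ps.
have ps' : (p <= size [seq Some x | x <- s])%N by rewrite size_map sm.
have [X [Y [q [E sX H]]]] := cpair_insert None None ps'.
exists X, Y, q; split=> //.
by rewrite /gaps /insert map_cat map_cons map_take map_drop -H.
Qed.

Lemma gaps_lt m s q x : path_of m s -> q \in gaps s ->
  (q.1 = Some x \/ q.2 = Some x) -> (x < m)%N.
Proof.
move=> ps /cpair_mem /andP[q1 q2] qx; rewrite -(path_of_mem _ ps).
case: qx => E; rewrite E in q1 q2.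
  by move: q1; rewrite inE /= mem_map // => ? ? [].
by move: q2; rewrite mem_rcons inE /= mem_map // => ? ? [].
Qed.

Lemma label_rcons m l t o : size l = m -> (forall x, o = Some x -> x < m)%N ->
  label (rcons l t) o = label l o.
Proof.
by move=> sl; case: o => //= x /(_ x erefl) xm; rewrite nth_rcons sl xm.
Qed.

Lemma gap_type_rcons m s l t q : path_of m s -> size l = m -> q \in gaps s ->
  gap_type (rcons l t) q = gap_type l q.
Proof.
move=> ps sl qs; rewrite /gap_type.
by rewrite !(label_rcons _ sl) // => x E; apply: (gaps_lt ps qs); [right|left].
Qed.

(** The gap [q] gives way to two gaps at [m]. The others involve only elements below [m], so the
    appended label does not change their types. *)
Lemma counters_insert m s l t p X Y q : path_of m s -> size l = m ->
  gaps s = X ++ q :: Y ->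
  gaps (insert p m s) = X ++ (q.1, Some m) :: (Some m, q.2) :: Y ->
  counters (insert p m s) (rcons l t) =
  moved (insertion (gap_type l q) t) (counters s l).
Proof.
move=> ps sl E E'; apply: funext => j.
have qs : q \in gaps s by rewrite E mem_cat mem_head orbT.
have lm : label (rcons l t) (Some m) = Some t by rewrite /= nth_rcons sl ltnn eqxx.
have g1 : gap_type (rcons l t) (q.1, Some m) = (label l q.1, Some t, true).
  rewrite /gap_type lm /= (label_rcons _ sl) => [|x Ex].
    by congr (_, _, _); case Ex : q.1 => [x|//]; apply: (gaps_lt ps qs); left.
  by apply: (gaps_lt ps qs); left.
have g2 : gap_type (rcons l t) (Some m, q.2) = (Some t, label l q.2, false).
  rewrite /gap_type lm /= (label_rcons _ sl) => [|x Ex].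
    congr (_, _, _); case Ex : q.2 => [x|//]; apply/negbTE; rewrite -leqNgt ltnW //.
    by apply: (gaps_lt ps qs); right.
  by apply: (gaps_lt ps qs); right.
rewrite /counters /moved /= E E' !map_cat !map_cons !count_cat g1 g2.
have H Z : {subset Z <= gaps s} ->
    [seq igap (gap_type (rcons l t) q0) | q0 <- Z] =
    [seq igap (gap_type l q0) | q0 <- Z].
  move=> Zs; apply/eq_in_map => z zZ; congr igap.
  exact: gap_type_rcons ps sl (Zs z zZ).
rewrite !H; last 2 first.
- by move=> z zY; rewrite E mem_cat inE zY !orbT.
- by move=> z zX; rewrite E mem_cat zX.
rewrite /mgap /minc /= map_rcons -cats1 count_cat /= [j == _]eq_sym; lia.
Qed.

Lemma prod_single m a b' (v : nat -> nat -> F) : (a < b')%N -> (b' < m)%N ->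
  \prod_(y < m) \prod_(x < y) (if (x == a :> nat) && (y == b' :> nat) then v x y else 1)
  = v a b'.
Proof.
move=> ab bm; rewrite (bigD1 (Ordinal bm)) //= [X in _ * X]big1 ?mulr1; last first.
  move=> y; rewrite -val_eqE /= => /negPf yb; rewrite big1 // => x _.
  by rewrite yb andbF.
rewrite (bigD1 (Ordinal ab)) //= !eqxx [X in _ * X]big1 ?mulr1 // => x.
by rewrite -val_eqE /= => /negPf ->.
Qed.

(** The factor of one separated pair is spread over all pairs [x < y], so that it can be merged with
    [apart_weight] factor by factor. *)
Lemma prod_broken m s l q : path_of m s -> q \in gaps s ->
  \prod_(y < m) \prod_(x < y)
    (if (q == (Some (x : nat), Some (y : nat))) || (q == (Some (y : nat), Some (x : nat)))
     then r0 (nth c0 l x) (nth c0 l y) else 1) = broken (gap_type l q).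
Proof.
move=> ps; case: q => [[a|] [b'|]] qs; last 3 first.
- by rewrite big1 // => y _; rewrite big1 // => x _; rewrite !xpair_eqE !andbF.
- by rewrite big1 // => y _; rewrite big1.
- by rewrite big1 // => y _; rewrite big1.
have : adjacent s a b' by [].
rewrite (adjacentE _ _ ps) => /and3P[am bm /eqP ixab]; rewrite /gap_type /=.
have [ab|ba|ab] := ltngtP a b'; last by move: ixab; rewrite ab; lia.
- rewrite -(@prod_single m a b' (fun x y => r0 (nth c0 l x) (nth c0 l y))) //.
  apply: eq_bigr => y _; apply: eq_bigr => x _.
  rewrite !xpair_eqE !(inj_eq (@Some_inj _)); have := ltn_ord x.
  by do ![case: eqP] => //=; lia.
- rewrite -(@prod_single m b' a (fun x y => r0 (nth c0 l x) (nth c0 l y))) //.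
  apply: eq_bigr => y _; apply: eq_bigr => x _.
  rewrite !xpair_eqE !(inj_eq (@Some_inj _)); have := ltn_ord x.
  by do ![case: eqP] => //=; lia.
Qed.

(** The elements are grouped by label. Subtracting both indicators is right because the two
    neighbours are distinct elements ([q12]), even if their labels coincide. *)
Lemma prod_not_neighbours m s l q t : path_of m s -> size l = m -> q \in gaps s ->
  \prod_(x < m) (if (q.1 == Some (x : nat)) || (q.2 == Some (x : nat)) then 1
                 else r0 (nth c0 l x) t) =
  \prod_c r0 c t ^+ (count_mem c l - ((label l q.1 == Some c) + (label l q.2 == Some c))).
Proof.
move=> ps sl qs.
have lt1 x : q.1 = Some x -> (x < m)%N by move=> E; apply: (gaps_lt ps qs); left.
have lt2 x : q.2 = Some x -> (x < m)%N by move=> E; apply: (gaps_lt ps qs); right.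
have q12 x : q.1 = Some x -> q.2 = Some x -> False.
  case: q qs {lt1 lt2} => a b' /= qs E1 E2; rewrite E1 E2 in qs.
  have : adjacent s x x by [].
  by rewrite (adjacentE _ _ ps) => /and3P[_ _ /eqP]; lia.
pose near (x : 'I_m) := (q.1 == Some (x : nat)) || (q.2 == Some (x : nat)).
transitivity (\prod_(x < m | ~~ near x) r0 (nth c0 l x) t).
  by rewrite [RHS]big_mkcond; apply: eq_bigr => x _; rewrite if_neg.
rewrite (partition_big (fun x : 'I_m => nth c0 l x) xpredT) //=.
apply: eq_bigr => c _.
rewrite (eq_bigr (fun=> r0 c t)); last by move=> x /andP[_ /eqP ->].
rewrite prodr_const; congr (_ ^+ _).
have cl : count_mem c l = #|[pred x : 'I_m | nth c0 l x == c]|.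
  rewrite -sum1_card -sum1_count (big_nth c0) big_mkord sl.
  by apply: eq_bigl => x; rewrite inE.
have near_card (o : option nat) : (forall x, o = Some x -> x < m)%N ->
    #|[pred x : 'I_m | (o == Some (x : nat)) && (nth c0 l x == c)]| = (label l o == Some c).
  case: o => [x /(_ x erefl) xm|_] /=; last by apply: eq_card0 => x; rewrite !inE.
  have [E|E] := eqVneq (nth c0 l x) c.
    rewrite /= E eqxx (@eq_card1 _ (Ordinal xm)) // => y.
    rewrite !inE -[Some x == _]/(x == y) -val_eqE /= eq_sym.
    by case: eqP => //= ->; rewrite E eqxx.
  rewrite (_ : (Some _ == _) = false); last by apply/negbTE; apply: contraNneq E => -[->].
  apply: eq_card0 => y; rewrite !inE -[Some x == _]/(x == y).
  by case: eqP => //= <-; apply/negbTE.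
rewrite -(near_card _ lt1) -(near_card _ lt2) cl.
apply/eqP; rewrite -[_ == _](eqn_add2r (#|[pred x : 'I_m | (q.1 == Some (x : nat))
    && (nth c0 l x == c)]| + #|[pred x : 'I_m | (q.2 == Some (x : nat)) && (nth c0 l x == c)]|)%N).
have cardS (A : pred 'I_m) : #|A| = (\sum_(x < m) A x)%N.
  by rewrite -sum1_card big_mkcond; apply: eq_bigr => x _; rewrite unfold_in; case: (A x).
rewrite subnK !cardS -!big_split /=.
  apply/eqP/eq_bigr => x _; rewrite /near.
  case: (q.1 =P _) => [q1|_]; case: (q.2 =P _) => [q2|_]; case: (_ == c) => //.
  by case: (q12 _ q1 q2).
apply: leq_sum => x _ /=; case: (q.1 =P _) => [q1|_]; case: (q.2 =P _) => [q2|_];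
  case: (_ == c) => //.
by case: (q12 _ q1 q2).
Qed.

(** Among the old pairs, the insertion changes only the status of [q], which ceases to be a pair of
    neighbours and is paid by [broken]. Among the pairs with [m], those with the components of [q]
    become open and all others are paid at once. *)
Lemma apart_insert m s l t p X Y q : path_of m s -> size l = m ->
  gaps s = X ++ q :: Y ->
  gaps (insert p m s) = X ++ (q.1, Some m) :: (Some m, q.2) :: Y ->
  apart_weight (insert p m s) (rcons l t) =
  apart_weight s l * (u t * broken (gap_type l q) *
    \prod_c r0 c t ^+ (count_mem c l - ((label l q.1 == Some c) + (label l q.2 == Some c)))).
Proof.
move=> ps sl E E'; have sm := path_of_size ps.
have qs : q \in gaps s by rewrite E mem_cat mem_head orbT.
have out x y : (Some x, Some y) \in X ++ Y -> (x < m)%N && (y < m)%N.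
  move=> xy; have xys : (Some x, Some y) \in gaps s.
    by rewrite E mem_cat inE orbCA -mem_cat xy orbT.
  by rewrite (gaps_lt ps xys (or_introl erefl)) (gaps_lt ps xys (or_intror erefl)).
have adjE x y : adjacent (insert p m s) x y =
    [|| (Some x, Some y) \in X ++ Y, (q.1 == Some x) && (y == m)
      | (x == m) && (q.2 == Some y)].
  rewrite /adjacent E' !mem_cat !inE !xpair_eqE.
  rewrite [Some x == q.1]eq_sym [Some y == q.2]eq_sym.
  rewrite -![Some _ == Some m]/(_ == m).
  by case: (_ \in X); case: (_ \in Y); rewrite ?orbT ?orbF.
have uq : q \notin X ++ Y.
  have := gaps_uniq ps; rewrite E -cat1s uniq_catCA cat1s /=.
  by case/andP.
have adj x y : (x < m)%N -> (y < m)%N ->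
    adjacent s x y = adjacent (insert p m s) x y || (q == (Some x, Some y)).
  move=> xm ym; rewrite adjE [y == m]ltn_eqF // [x == m]ltn_eqF // andbF /= orbF.
  by rewrite /adjacent E !mem_cat inE eq_sym orbCA orbC.
have nadj x y : (x < m)%N -> (y < m)%N -> q == (Some x, Some y) ->
    adjacent (insert p m s) x y = false.
  move=> xm ym /eqP qE; rewrite adjE [y == m]ltn_eqF // [x == m]ltn_eqF // andbF /= orbF.
  by apply/negbTE; rewrite -qE.
have pi := path_of_insert p ps.
rewrite -(prod_broken l ps qs) /apart_weight (path_of_size pi) sm big_ord_recr /=.
rewrite nth_rcons sl ltnn eqxx.
have -> : \prod_(x < m) (if adjacent (insert p m s) x m || adjacent (insert p m s) m x
      then 1 else r0 (nth c0 (rcons l t) x) t) =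
    \prod_(x < m) (if (q.1 == Some (x : nat)) || (q.2 == Some (x : nat)) then 1
                 else r0 (nth c0 l x) t).
  apply: eq_bigr => x _; rewrite !adjE nth_rcons sl ltn_ord !eqxx [(x : nat) == m]ltn_eqF //=.
  rewrite !andbF !andbT !orbF /=.
  have -> : ((Some (x : nat), Some m) \in X ++ Y) = false.
    by apply/negP => /out; rewrite ltnn andbF.
  have -> : ((Some m, Some (x : nat)) \in X ++ Y) = false.
    by apply/negP => /out; rewrite ltnn.
  by [].
rewrite (prod_not_neighbours t ps sl qs) [LHS]mulrA [RHS]mulrA; congr (_ * _).
rewrite [LHS]mulrC [RHS]mulrCA; congr (_ * _).
rewrite -big_split /=; apply: eq_bigr => y _.
rewrite -mulrA -big_split /= nth_rcons sl ltn_ord; congr (_ * _).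
apply: eq_bigr => x _; rewrite nth_rcons sl; have xm := ltn_trans (ltn_ord x) (ltn_ord y).
rewrite xm !adj //.
have [q1|q1] := boolP (q == (Some (x : nat), Some (y : nat))).
  have /negbTE na : ~~ adjacent s y x.
    by apply: (adjacent_asym ps); rewrite adj // q1 orbT.
  have := na; rewrite adj // => /norP[/negPf na' _].
  by rewrite (nadj _ _ xm (ltn_ord y) q1) na' /= mul1r.
have [q2|q2] := boolP (q == (Some (y : nat), Some (x : nat))).
  have /negbTE na : ~~ adjacent s x y.
    by apply: (adjacent_asym ps); rewrite adj // q2 orbT.
  have := na; rewrite adj // => /norP[/negPf na' _].
  by rewrite (nadj _ _ (ltn_ord y) xm q2) na' /= mul1r.
by rewrite !orbF mulr1.
Qed.

Lemma prod_square m (f : nat -> nat -> F) :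
  \prod_(x < m) \prod_(y < m) f x y =
  \prod_(y < m) (f y y * \prod_(x < y) (f x y * f y x)).
Proof.
elim: m => [|m IHm]; first by rewrite !big_ord0.
rewrite [RHS]big_ord_recr -IHm big_ord_recr /=.
under eq_bigr do rewrite big_ord_recr.
rewrite big_split [X in _ * X]big_ord_recr /= [in RHS]big_split /=.
by ring.
Qed.

Lemma prod_gaps m s (f : option nat * option nat -> F) : path_of m s ->
  \prod_(q <- gaps s) f q =
  (if (None, None) \in gaps s then f (None, None) else 1) *
  \prod_(y < m) (if (None, Some (y : nat)) \in gaps s then f (None, Some (y : nat)) else 1) *
  \prod_(x < m) (if (Some (x : nat), None) \in gaps s then f (Some (x : nat), None) else 1) *
  \prod_(x < m) \prod_(y < m)
    (if adjacent s x y then f (Some (x : nat), Some (y : nat)) else 1).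
Proof.
move=> ps; pose O := None :: [seq Some x | x <- iota 0 m].
have O_uniq : uniq O.
  rewrite /= map_inj_uniq ?iota_uniq ?andbT; last by move=> x y [].
  by apply/mapP => -[].
have O_mem o : (forall x, o = Some x -> x < m)%N -> o \in O.
  case: o => [x /(_ x erefl) xm|_]; last exact: mem_head.
  by rewrite inE /= mem_map ?mem_iota //; move=> ? ? [].
have -> : \prod_(q <- gaps s) f q =
    \prod_(q <- [seq (o, o') | o <- O, o' <- O]) (if q \in gaps s then f q else 1).
  rewrite -big_mkcond -[RHS]big_filter; apply: perm_big; apply: uniq_perm.
  - exact: gaps_uniq ps.
  - by apply/filter_uniq/allpairs_uniq => // -[? ?] [? ?].
  - move=> q; rewrite mem_filter; case qs: (q \in gaps s); rewrite ?andTb ?andFb //.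
    have [q1 q2] : q.1 \in O /\ q.2 \in O.
      by split; apply: O_mem => x E; apply: (gaps_lt ps qs); [left|right].
    by case: q {qs} q1 q2 => o o' q1 q2; rewrite allpairs_f.
rewrite big_allpairs_dep /O big_cons /= big_cons big_map.
have iotaE (g : nat -> F) : \prod_(x <- iota 0 m) g x = \prod_(x < m) g x.
  by rewrite -[iota 0 m]/(iota 0 m) -{1}[m]subn0 -/(index_iota 0 m) big_mkord.
rewrite (iotaE (fun y => if (None, Some y) \in gaps s then f (None, Some y) else 1)).
rewrite big_map; under eq_bigr => x _ do
  rewrite big_cons big_map (iotaE (fun y =>
    if (Some x, Some y) \in gaps s then f (Some x, Some y) else 1)).
rewrite (iotaE (fun x => (if (Some x, None) \in gaps s then f (Some x, None) else 1) *
  \prod_(y < m) (if (Some x, Some (y : nat)) \in gaps s then f (Some x, Some (y : nat)) else 1))).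
by rewrite big_split /= mulrA.
Qed.

(** After the last insertion the open pairs are the neighbours on the final path, and [kept] settles
    them; the gap at the left end carries the factor [b] of the first element. *)
Lemma path_weight_apart m s l : path_of m s -> size l = m ->
  path_weight s l = apart_weight s l * \prod_(q <- gaps s) kept (gap_type l q).
Proof.
move=> ps sl; have sm := path_of_size ps.
rewrite (prod_gaps _ ps) [kept (gap_type l (None, None))]/= if_same mul1r.
rewrite [\prod_(x < m) (if (_, None) \in _ then _ else _)]big1; last first.
  by move=> x _; rewrite /= if_same.
rewrite mulr1 mulrCA [RHS]mulrC /path_weight sm -big_mkcond /=; congr (_ * _).
rewrite (@prod_square m (fun x y =>
  if adjacent s x y then kept (gap_type l (Some x, Some y)) else 1)).
rewrite /apart_weight sm -big_split /=; apply: eq_bigr => y _.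
have -> : adjacent s y y = false.
  by rewrite (adjacentE _ _ ps); apply/negP => /and3P[_ _ /eqP]; lia.
rewrite mul1r -mulrA -big_split /=; congr (_ * _); apply: eq_bigr => x _.
rewrite /gap_type /= ltn_ord ltnNge (ltnW (ltn_ord x)) /=.
have [xy|xy] := boolP (adjacent s x y).
  by rewrite (negPf (adjacent_asym ps xy)) mul1r mulr1.
by case: (adjacent s y x); rewrite /= ?mul1r ?mulr1.
Qed.

(** Positions of insertion are gaps, and the weight of an insertion as well as the next counters
    depend on the position through the type of its gap only. Grouping the positions by type gives
    each type its counter as multiplicity. *)
Lemma total_value k m s l : path_of m s -> size l = m ->
  total k s l = apart_weight s l * value insertions keeping k (counters s l).
Proof.
elim: k m s l => [|k IHk] m s l ps sl.
  by rewrite value_keeping; exact: path_weight_apart ps sl.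
move: sl (ps); rewrite -(path_of_size ps) => sl {}ps; rewrite [LHS]/= [value _ _ _ _]/= /insertions.
rewrite big_allpairs_dep big_distrr [RHS]/=.
pose f g := apart_weight s l * \sum_(t <- enum C)
  (u t * broken g * \prod_c r0 c t ^+ (count_mem c l - ((g.1.1 == Some c) + (g.1.2 == Some c))))
  * value insertions keeping k (moved (insertion g t) (counters s l)).
transitivity (\sum_(q <- gaps s) f (gap_type l q)).
  rewrite (big_nth (None, None)) big_mkord size_cpair size_map.
  apply: eq_bigr => p _; have pm : (p <= size s)%N by rewrite -ltnS.
  have [X [Y [q [E sX E']]]] := gaps_insert ps pm.
  have -> : nth (None, None) (gaps s) p = q by rewrite E nth_cat sX ltnn subnn.
  rewrite /f big_distrr [RHS]big_enum [RHS]/=; apply: eq_bigr => t _.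
  have sl' : size (rcons l t) = (size s).+1 by rewrite size_rcons sl.
  rewrite (IHk _ _ _ (path_of_insert p ps) sl').
  by rewrite (apart_insert t ps sl E E') (counters_insert t ps sl E E') !mulrA.
transitivity (\sum_(g <- [seq gap_type l q | q <- gaps s]) f g).
  by rewrite big_map.
rewrite sum_gaps.
apply: eq_bigr => g _; rewrite -counters_igap /f -mulrnAr; congr (_ * _).
rewrite -sumrMnl; apply: eq_bigr => t _; rewrite -mulrnAl; congr (_ * _).
rewrite /move_weight /insertion /mcoef /mpow /mgap /=; congr (_ * _ *+ _).
rewrite big_map big_enum /=; apply: eq_bigr => c _.
by rewrite counters_icell.
Qed.

Fixpoint perms (m : nat) : seq (seq nat) :=
  if m is m'.+1 then [seq insert p m' s | s <- perms m', p <- iota 0 m'.+1]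
  else [:: [::]].

Fixpoint labels (m : nat) : seq (seq C) :=
  if m is m'.+1 then [seq rcons l t | l <- labels m', t <- enum C] else [:: [::]].

Lemma permsS m :
  perms m.+1 = [seq insert p m s | s <- perms m, p <- iota 0 m.+1].
Proof. by []. Qed.

Lemma labelsS m : labels m.+1 = [seq rcons l t | l <- labels m, t <- enum C].
Proof. by []. Qed.

Lemma perms_path m s : s \in perms m -> path_of m s.
Proof.
elim: m s => [|m IHm] s; first by rewrite inE => /eqP ->.
by move=> /allpairsPdep[s' [p [/IHm ps' _ ->]]]; exact: path_of_insert.
Qed.

Lemma labels_size m l : l \in labels m -> size l = m.
Proof.
elim: m l => [|m IHm] l; first by rewrite inE => /eqP ->.
by move=> /allpairsPdep[l' [t [/IHm sl' _ ->]]]; rewrite size_rcons sl'.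
Qed.

Lemma total_sum n : total n [::] [::] =
  \sum_(s <- perms n) \sum_(l <- labels n) path_weight s l.
Proof.
suff H m k : \sum_(s <- perms m) \sum_(l <- labels m) total k s l =
    \sum_(s <- perms (m + k)) \sum_(l <- labels (m + k)) path_weight s l.
  by have := H 0%N n; rewrite /= !big_seq1.
elim: k m => [|k IHk] m; first by rewrite addn0.
rewrite addnS -addSn -IHk permsS labelsS big_allpairs_dep big_seq [RHS]big_seq.
apply: eq_bigr => s /perms_path/path_of_size sm.
under [RHS]eq_bigr do rewrite big_allpairs_dep.
rewrite [RHS]exchange_big; apply: eq_bigr => l _.
rewrite -[in RHS](subn0 m.+1) -/(index_iota 0 m.+1) big_mkord [LHS]/= sm.
by apply: eq_bigr => p _; rewrite big_enum.
Qed.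

(** The position can be read off as the index of [m] in the result, since [m] is new. *)
Lemma insert_inj m : {in [pred x : seq nat * nat | (m \notin x.1) && (x.2 <= size x.1)%N] &,
  injective (fun x => insert x.2 m x.1)}.
Proof.
move=> [s p] [s' p'] /andP[/= ms ps] /andP[/= ms' ps'] E.
have idx (z : seq nat) k : m \notin z -> (k <= size z)%N -> index m (insert k m z) = k.
  move=> mz kz; rewrite index_cat /= eqxx addn0 size_take.
  rewrite ifN; last by apply: contra mz; exact: mem_take.
  by move: kz; rewrite leq_eqVlt => /orP[/eqP ->|->]; rewrite ?ltnn.
have pp : p = p' by rewrite -(idx s p) // E idx.
move: E; rewrite -pp /insert => /eqP; rewrite eqseq_cat; last first.
  by rewrite !size_takel // pp.
by rewrite eqseq_cons eqxx /= => /andP[/eqP t1 /eqP t2];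
  rewrite -(cat_take_drop p s) t1 t2 cat_take_drop.
Qed.

Lemma uniq_perms m : uniq (perms m).
Proof.
elim: m => [//|m IHm]; rewrite permsS; apply: allpairs_uniq => //.
  exact: iota_uniq.
move=> [s p] [s' p'] /allpairsPdep[a [b' [ap bp [-> ->]]]]
  /allpairsPdep[a' [b'' [ap' bp' [-> ->]]]] E.
have cond z k : z \in perms m -> k \in iota 0 m.+1 -> (m \notin z) && (k <= size z)%N.
  move=> /perms_path pz; rewrite mem_iota ltnS => /andP[_ km].
  by rewrite (path_of_mem _ pz) ltnn (path_of_size pz).
exact: (@insert_inj m (a, b') (a', b'') (cond _ _ ap bp) (cond _ _ ap' bp') E).
Qed.

Lemma size_perms m : size (perms m) = m`!%N.
Proof.
elim: m => [//|m IHm]; rewrite permsS size_allpairs IHm.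
by rewrite size_iota factS mulnC.
Qed.

Lemma uniq_labels m : uniq (labels m).
Proof.
elim: m => [//|m IHm]; rewrite labelsS; apply: allpairs_uniq => //.
  exact: enum_uniq.
by move=> [l t] [l' t'] _ _ /= /rcons_inj [-> ->].
Qed.

Lemma size_labels m : size (labels m) = (#|C| ^ m)%N.
Proof. by elim: m => [//|m IHm]; rewrite labelsS size_allpairs IHm -cardE expnSr. Qed.

(** [pi x] is the position of [x] on the path; the list goes through the positions, hence the
    inverse. *)
Definition path_seq n (pi : 'S_n) : seq nat := [seq val (pi^-1%g i) | i <- enum 'I_n].

Definition label_seq n (l : {ffun 'I_n -> C}) : seq C := [seq l i | i <- enum 'I_n].

(** Both lists are duplicate-free, have length [n!] and consist of permutations of [iota 0 n], so
    each exhausts these permutations. *)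
Lemma perms_path_seq n : perm_eq [seq path_seq pi | pi <- enum 'S_n] (perms n).
Proof.
have us : uniq [seq path_seq pi | pi <- enum 'S_n].
  rewrite map_inj_uniq ?enum_uniq // => pi pi' E.
  apply: invg_inj; apply/permP => i; apply: val_inj.
  have := congr1 (fun s => nth 0%N s i) E; rewrite /= /path_seq.
  by rewrite !(nth_map i) -?enumT ?size_enum_ord ?nth_ord_enum.
have path_pi pi : path_of n (@path_seq n pi).
  rewrite /path_of -val_enum_ord /path_seq map_comp; apply: perm_map.
  apply: uniq_perm; last 1 first.
  - move=> i; rewrite mem_enum; apply/mapP; exists (pi i); first by rewrite mem_enum.
    by rewrite permK.
  - by rewrite map_inj_uniq ?enum_uniq //; exact: perm_inj.
  - exact: enum_uniq.
have sub : {subset [seq path_seq pi | pi <- enum 'S_n] <= permutations (iota 0 n)}.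
  by move=> s /mapP[pi _ ->]; rewrite mem_permutations; exact: path_pi.
have sub' : {subset perms n <= permutations (iota 0 n)}.
  by move=> s /perms_path; rewrite mem_permutations.
have sp : size (permutations (iota 0 n)) = n`!%N.
  by rewrite size_permutations ?iota_uniq // size_iota.
have [|_ E1] := uniq_min_size us sub.
  by rewrite sp size_map -?enumT -cardE card_Sn.
have [|_ E2] := uniq_min_size (uniq_perms n) sub'; first by rewrite sp size_perms.
by apply: uniq_perm => // [|s]; rewrite ?uniq_perms // E1 E2.
Qed.

Lemma labels_label_seq n :
  perm_eq [seq label_seq l | l <- enum {ffun 'I_n -> C}] (labels n).
Proof.
have us : uniq [seq label_seq l | l <- enum {ffun 'I_n -> C}].
  rewrite map_inj_uniq ?enum_uniq // => l l' E; apply/ffunP => i.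
  have := congr1 (fun s => nth c0 s i) E; rewrite /= /label_seq.
  by rewrite !(nth_map i) -?enumT ?size_enum_ord ?nth_ord_enum.
have sub : {subset labels n <= [seq label_seq l | l <- enum {ffun 'I_n -> C}]}.
  move=> l /labels_size sl; apply/mapP; exists [ffun i : 'I_n => nth c0 l i].
    by rewrite mem_enum.
  apply: (@eq_from_nth _ c0); rewrite sl ?size_map -?enumT ?size_enum_ord // => i ni.
  by rewrite (nth_map (Ordinal ni)) -?enumT ?size_enum_ord // ffunE nth_enum_ord.
have [|_ E] := uniq_min_size (uniq_labels n) sub.
  by rewrite size_labels size_map -?enumT -cardE card_ffun card_ord.
by apply: uniq_perm => //; exact: uniq_labels.
Qed.

Lemma first_gapE m s x : path_of m s ->
  ((None, Some x) \in gaps s) = (x < m)%N && (index x s == 0%N).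
Proof.
move=> ps; rewrite -(path_of_mem _ ps).
case: s ps => [|a s] ps //; rewrite /gaps /= !inE xpair_eqE /=.
rewrite -[Some x == Some a]/(x == a) eq_sym.
case: eqP => [->|ax]; rewrite ?eqxx //=.
rewrite andbF; apply/negP => /cpair_mem /andP[+ _].
by rewrite inE /= => /mapP[].
Qed.

Lemma index_path_seq n (pi : 'S_n) (i : 'I_n) : index (i : nat) (path_seq pi) = pi i.
Proof.
rewrite /path_seq (map_comp val) index_map; last exact: val_inj.
by rewrite -{1}[i](permK pi) index_map ?index_enum_ord //; exact: perm_inj.
Qed.

Lemma path_of_path_seq n (pi : 'S_n) : path_of n (path_seq pi).
Proof.
by apply: perms_path; rewrite -(perm_mem (perms_path_seq n)) map_f ?mem_enum.
Qed.

Definition labelled_weight n (pi : 'S_n) (l : {ffun 'I_n -> C}) : F :=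
  (\prod_(y < n) (u (l y) * \prod_(x < n | (x < y)%N)
      r (l x) (l y) (pi y == (pi x).+1 :> nat) (pi x == (pi y).+1 :> nat)))
  * \prod_(x < n | pi x == 0%N :> nat) b (l x).

Lemma path_weightE n (pi : 'S_n) l :
  path_weight (path_seq pi) (label_seq l) = labelled_weight pi l.
Proof.
have ps := path_of_path_seq pi.
have lE (i : 'I_n) : nth c0 (label_seq l) i = l i.
  by rewrite /label_seq (nth_map i) -?enumT ?size_enum_ord ?nth_ord_enum.
rewrite /path_weight /labelled_weight (path_of_size ps); congr (_ * _); last first.
  apply: eq_big => [x|x _]; last by rewrite lE.
  by rewrite (first_gapE _ ps) ltn_ord index_path_seq.
apply: eq_bigr => y _; rewrite lE; congr (_ * _).
have ly := ltnW (ltn_ord y).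
rewrite (big_ord_widen n (fun x : nat => r (nth c0 (label_seq l) x) (l y)
  (adjacent (path_seq pi) x y) (adjacent (path_seq pi) y x)) ly).
apply: eq_bigr => x xy; rewrite lE !(adjacentE _ _ ps) !ltn_ord !index_path_seq.
by [].
Qed.

Lemma counters_nil : counters [::] [::] = initial.
Proof. by apply: funext => j; rewrite /counters /initial /= addn0 eq_sym. Qed.

Theorem sum_labelled_paths n :
  \sum_(pi : 'S_n) \sum_(l : {ffun 'I_n -> C}) labelled_weight pi l =
  value insertions keeping n initial.
Proof.
rewrite -counters_nil -[RHS]mul1r.
have -> : 1 = apart_weight [::] [::] by rewrite /apart_weight big_ord0.
rewrite -(@total_value n 0) // total_sum.
rewrite -(perm_big _ (perms_path_seq n)) big_map big_enum; apply: eq_bigr => pi _.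
rewrite -(perm_big _ (labels_label_seq n)) big_map big_enum; apply: eq_bigr => l _.
by rewrite path_weightE.
Qed.

(** The 3 stands for the counters that an insertion increments: one label and two gaps. *)
Lemma well_indexed_insertions : well_indexed ncounters 3 insertions keeping.
Proof.
have cK c : (icell c < ncounters)%N by rewrite ltn_addr // ltn_ord.
have gK g : (igap g < ncounters)%N by rewrite ltn_add2l ltn_ord.
split=> [m /allpairsPdep[g [t [_ _ ->]]]|q /mapP[g _ ->]]; last exact: gK.
split=> [|q /mapP[c _ ->]|i|//]; [exact: gK | exact: cK |].
by rewrite !inE => /or3P[] /eqP ->; [exact: cK | exact: gK | exact: gK].
Qed.

Lemma initial_le1 j : (initial j <= 1)%N.
Proof. exact: leq_b1. Qed.

End Paths.

(** * Two-variable sentences as sums over labellings *)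

Lemma prod_triangle (R : comNzRingType) n (f : 'I_n -> 'I_n -> R) :
  (\prod_(x < n) \prod_(y < n) f x y =
  \prod_(y < n) (f y y * \prod_(x < n | (x < y)%N) (f x y * f y x)))%R.
Proof.
transitivity (\prod_(x < n)
  (f x x * \prod_(y < n | (y < x)%N) f x y * \prod_(y < n | (x < y)%N) f x y))%R.
  apply: eq_bigr => x _; rewrite (bigD1 x) //= -mulrA; congr (_ * _)%R.
  rewrite (bigID (fun y : 'I_n => (y < x)%N)) /=; congr (_ * _)%R; apply: eq_bigl => y.
    by rewrite -val_eqE; case: ltngtP.
  by rewrite -val_eqE; case: ltngtP.
under [RHS]eq_bigr do rewrite big_split mulrCA mulrC.
rewrite !big_split /=; congr (_ * _)%R.
exact: (exchange_big_dep xpredT).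
Qed.

Lemma prod_bool (R : comNzRingType) (I : finType) (b : I -> bool) :
  (\prod_i (b i)%:R = [forall i, b i]%:R :> R)%R.
Proof.
have [/forallP ball|/forallPn[i /negbTE bi]] := boolP [forall i, b i].
  by rewrite big1 // => i _; rewrite ball.
by rewrite (bigD1 i) //= bi mul0r.
Qed.

Lemma sum_ffun_pair (R : nmodType) (I X Y : finType)
    (G : {ffun I -> X} -> {ffun I -> Y} -> R) :
  (\sum_A \sum_B G A B =
   \sum_(l : {ffun I -> X * Y}) G [ffun i => (l i).1] [ffun i => (l i).2])%R.
Proof.
rewrite pair_big /=.
pose f (l : {ffun I -> X * Y}) := ([ffun i => (l i).1], [ffun i => (l i).2]).
pose g (AB : {ffun I -> X} * {ffun I -> Y}) := [ffun i => (AB.1 i, AB.2 i)].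
rewrite (reindex f) //; exists g => [l|[A B]] _.
  by apply/ffunP => i; rewrite !ffunE -surjective_pairing.
by congr (_, _); apply/ffunP => i; rewrite !ffunE.
Qed.

(** * Guessing the truth values of quantified subformulas *)

Section Normalize.

Local Open Scope nat_scope.

Variables (sig : finType) (arity : sig -> nat).
Variables p q : nat.
Hypothesis pq : p != q.

Notation formula := (formula arity).

Definition other (x : nat) : nat := if x == p then q else p.

Definition two_vars (f : formula) : Prop := forall x, x \in vars f -> x = p \/ x = q.

(* The quantified subformulas in preorder, with [true] for a universal one. *)
Fixpoint quants (f : formula) : seq (bool * nat * formula) :=
  match f with
  | FAtom _ _ | FEq _ _ => [::]
  | FNot g => quants g
  | FAnd g h | FOr g h | FImp g h => quants g ++ quants h
  | FForall x g => (true, x, g) :: quants g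
  | FExists x g => (false, x, g) :: quants g
  end.

(* Evaluation with the truth value of the quantified subformula number [i] read
   from [A v i], where [v] is the value of the variable that is not bound. *)
Fixpoint qf_eval m (om : world arity m) (A : 'I_m -> nat -> bool)
    (e : nat -> 'I_m) (i : nat) (f : formula) : bool :=
  match f with
  | FAtom P xs => holds om (map_tuple e xs)
  | FEq x y => e x == e y
  | FNot g => ~~ qf_eval om A e i g
  | FAnd g h => qf_eval om A e i g && qf_eval om A e (i + size (quants g)) h
  | FOr g h => qf_eval om A e i g || qf_eval om A e (i + size (quants g)) h
  | FImp g h => qf_eval om A e i g ==> qf_eval om A e (i + size (quants g)) h
  | FForall x _ | FExists x _ => A (e (other x)) i
  end.

Definition pair_env m (x : nat) (d v : 'I_m) : nat -> 'I_m :=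
  fun z => if z == x then d else v.

Variable Psi : formula.

Definition quant (i : nat) : bool * nat * formula :=
  nth (true, 0, FEq arity 0 0) (quants Psi) i.

(** Comparison with the flag treats both quantifiers alike: that all instances hold means truth for
    a universal subformula and falsity for an existential one. *)
Definition instance m (om : world arity m) (A : 'I_m -> nat -> bool)
    (i : nat) (v d : 'I_m) : bool :=
  qf_eval om A (pair_env (quant i).1.2 d v) i.+1 (quant i).2 == (quant i).1.1.

Definition consistent m (om : world arity m) A i : Prop := forall v : 'I_m,
  (A v i == (quant i).1.1) = [forall d, instance om A i v d].

Definition truth m (om : world arity m) (v : 'I_m) (i : nat) : bool :=
  [forall d, eval om (pair_env (quant i).1.2 d v) (quant i).2 == (quant i).1.1]
    == (quant i).1.1.

Definition occurs_at (i : nat) (f : formula) : Prop :=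
  forall j, j < size (quants f) ->
    quant (i + j) = nth (true, 0, FEq arity 0 0) (quants f) j.

Lemma occurs_cat i f g h : quants f = quants g ++ quants h -> occurs_at i f ->
  occurs_at i g /\ occurs_at (i + size (quants g)) h.
Proof.
move=> E; rewrite /occurs_at E size_cat => oc; split=> j js.
  by rewrite oc ?nth_cat ?js //; exact: ltn_addr.
by rewrite -addnA oc ?ltn_add2l // nth_cat ltnNge leq_addr addKn.
Qed.

Lemma occurs_cons i f t g : quants f = t :: quants g -> occurs_at i f ->
  quant i = t /\ occurs_at i.+1 g.
Proof.
move=> E; rewrite /occurs_at E => oc; split; first by have := oc 0 isT; rewrite addn0.
by move=> j js; rewrite addSnnS oc.
Qed.

Lemma eval_ext m (om : world arity m) f e e' :
  (forall x, x \in vars f -> e x = e' x) -> eval om e f = eval om e' f.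
Proof.
elim: f e e' => [P xs|x y|g IHg|g IHg h IHh|g IHg h IHh|g IHg h IHh|x g IHg|x g IHg]
  e e' ee' /=.
- by congr holds; apply: eq_from_tnth => i; rewrite !tnth_map ee' ?mem_tnth.
- by rewrite !ee' ?inE ?eqxx ?orbT.
- by rewrite (IHg e e').
- by rewrite (IHg e e') 1?(IHh e e') // => z zv; apply: ee'; rewrite mem_cat zv ?orbT.
- by rewrite (IHg e e') 1?(IHh e e') // => z zv; apply: ee'; rewrite mem_cat zv ?orbT.
- by rewrite (IHg e e') 1?(IHh e e') // => z zv; apply: ee'; rewrite mem_cat zv ?orbT.
- apply: eq_forallb => d; apply: IHg => z zv; rewrite /update; case: eqP => // _.
  by apply: ee'; rewrite inE zv orbT.
- apply: eq_existsb => d; apply: IHg => z zv; rewrite /update; case: eqP => // _.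
  by apply: ee'; rewrite inE zv orbT.
Qed.

Lemma eval_pair_env m (om : world arity m) f e x d :
  two_vars f -> x = p \/ x = q ->
  eval om (pair_env x d (e (other x))) f = eval om (update e x d) f.
Proof.
move=> vf xpq; apply: eval_ext => z /vf zpq; rewrite /pair_env /update.
case: eqP => // zx; congr e; rewrite /other.
by case: xpq zpq zx => -> [] ->; rewrite ?eqxx // eq_sym (negPf pq).
Qed.

Lemma two_vars_sub f g : {subset vars g <= vars f} -> two_vars f -> two_vars g.
Proof. by move=> gf vf x /gf /vf. Qed.

Definition agree m (A B : 'I_m -> nat -> bool) i k : Prop :=
  forall j v, j < k -> A v (i + j) = B v (i + j).

Lemma agree_cat m (A B : 'I_m -> nat -> bool) i k k' : agree A B i (k + k') ->
  agree A B i k /\ agree A B (i + k) k'.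
Proof.
move=> ag; split=> j v js; first by apply: ag; exact: ltn_addr.
by rewrite -addnA ag // ltn_add2l.
Qed.

Lemma agree_cons m (A B : 'I_m -> nat -> bool) i k : agree A B i k.+1 ->
  (forall v, A v i = B v i) /\ agree A B i.+1 k.
Proof.
move=> ag; split=> [v|j v js]; first by have := ag 0 v isT; rewrite addn0.
by rewrite addSnnS ag.
Qed.

Lemma qf_eval_truth m (om : world arity m) A f i e : two_vars f -> occurs_at i f ->
  agree A (truth om) i (size (quants f)) -> qf_eval om A e i f = eval om e f.
Proof.
elim: f i e => [P xs|x y|g IHg|g IHg h IHh|g IHg h IHh|g IHg h IHh|x g IHg|x g IHg]
  i e vf oc ag //.
- by rewrite /= IHg.
- have [og oh] := @occurs_cat i (FAnd g h) g h erefl oc; rewrite /= size_cat in ag.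
  have [ag1 ag2] := agree_cat ag.
  by rewrite /= IHg ?IHh //; apply: two_vars_sub vf => z zv; rewrite mem_cat zv ?orbT.
- have [og oh] := @occurs_cat i (FOr g h) g h erefl oc; rewrite /= size_cat in ag.
  have [ag1 ag2] := agree_cat ag.
  by rewrite /= IHg ?IHh //; apply: two_vars_sub vf => z zv; rewrite mem_cat zv ?orbT.
- have [og oh] := @occurs_cat i (FImp g h) g h erefl oc; rewrite /= size_cat in ag.
  have [ag1 ag2] := agree_cat ag.
  by rewrite /= IHg ?IHh //; apply: two_vars_sub vf => z zv; rewrite mem_cat zv ?orbT.
- have [qi _] := @occurs_cons i (FForall x g) _ g erefl oc; have [ag0 _] := agree_cons ag.
  rewrite /= ag0 /truth qi /= eqb_id; apply: eq_forallb => d; rewrite eqb_id.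
  apply: eval_pair_env; first by apply: two_vars_sub vf => z zv; rewrite inE zv orbT.
  by apply: vf; rewrite mem_head.
- have [qi _] := @occurs_cons i (FExists x g) _ g erefl oc; have [ag0 _] := agree_cons ag.
  rewrite /= ag0 /truth qi /= eqbF_neg negb_forall; apply: eq_existsb => d.
  rewrite eqbF_neg negbK.
  apply: eval_pair_env; first by apply: two_vars_sub vf => z zv; rewrite inE zv orbT.
  by apply: vf; rewrite mem_head.
Qed.

Lemma instance_truth m (om : world arity m) A f i t x g (d v : 'I_m) :
  vars f = x :: vars g -> quants f = (t, x, g) :: quants g ->
  two_vars f -> occurs_at i f -> agree A (truth om) i.+1 (size (quants g)) ->
  instance om A i v d = (eval om (pair_env (quant i).1.2 d v) (quant i).2 == (quant i).1.1).
Proof.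
move=> vE qE vf oc ag; have [qi oc'] := occurs_cons qE oc.
rewrite /instance qi /= qf_eval_truth //.
by apply: two_vars_sub vf => z zv; rewrite vE inE zv orbT.
Qed.

Lemma agree_join m (A B : 'I_m -> nat -> bool) i k k' :
  agree A B i k -> agree A B (i + k) k' -> agree A B i (k + k').
Proof.
move=> ag ag' j v jk; have [jk'|kj] := ltnP j k; first exact: ag.
by rewrite -(subnKC kj) addnA; apply: ag'; lia.
Qed.

Lemma agree_step m (A B : 'I_m -> nat -> bool) i k :
  (forall v, A v i = B v i) -> agree A B i.+1 k -> agree A B i k.+1.
Proof. by move=> ag ag' [|j] v jk; rewrite ?addn0 // -addSnnS ag'. Qed.

Lemma consistent_quant m (om : world arity m) A f i t x g :
  vars f = x :: vars g -> quants f = (t, x, g) :: quants g ->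
  two_vars f -> occurs_at i f -> agree A (truth om) i.+1 (size (quants g)) ->
  consistent om A i <-> forall v, A v i = truth om v i.
Proof.
move=> vE qE vf oc ag.
have E v : [forall d, instance om A i v d] =
    [forall d, eval om (pair_env (quant i).1.2 d v) (quant i).2 == (quant i).1.1].
  by apply: eq_forallb => d; rewrite (instance_truth _ _ vE qE vf oc ag).
split=> co v.
  rewrite /truth -E -co; case: (A v i); case: ((quant i).1.1) => //.
by rewrite co E /truth; case: [forall _, _]; case: (quant i).1.1.
Qed.

(** Consistency at a quantifier refers only to guesses for the quantifiers nested in it, which have
    larger numbers in preorder. Working outwards from the innermost ones, each guess is forced to be
    the truth value. *)
Lemma consistent_truth m (om : world arity m) A f i : two_vars f -> occurs_at i f ->
  (forall j, j < size (quants f) -> consistent om A (i + j)) <->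
  agree A (truth om) i (size (quants f)).
Proof.
have cat g h k : two_vars g -> two_vars h -> occurs_at k g ->
    occurs_at (k + size (quants g)) h ->
    (forall k, two_vars g -> occurs_at k g ->
      (forall j, j < size (quants g) -> consistent om A (k + j)) <->
      agree A (truth om) k (size (quants g))) ->
    (forall k, two_vars h -> occurs_at k h ->
      (forall j, j < size (quants h) -> consistent om A (k + j)) <->
      agree A (truth om) k (size (quants h))) ->
    (forall j, j < size (quants g ++ quants h) -> consistent om A (k + j)) <->
    agree A (truth om) k (size (quants g ++ quants h)).
  move=> vg vh og oh Hg Hh; rewrite size_cat; split=> [co|/agree_cat[ag ah] j js].
    apply: agree_join; [apply/Hg|apply/Hh] => // j js; first exact/co/ltn_addr.
    by rewrite -addnA; apply: co; rewrite ltn_add2l.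
  have [jg|gj] := ltnP j (size (quants g)); first by move/(Hg _ vg og): ag; exact.
  rewrite -(subnKC gj) addnA; move/(Hh _ vh oh): ah; apply; lia.
have cons f' t x g k : vars f' = x :: vars g -> quants f' = (t, x, g) :: quants g ->
    two_vars f' -> occurs_at k f' ->
    (forall k, two_vars g -> occurs_at k g ->
      (forall j, j < size (quants g) -> consistent om A (k + j)) <->
      agree A (truth om) k (size (quants g))) ->
    (forall j, j < size (quants f') -> consistent om A (k + j)) <->
    agree A (truth om) k (size (quants f')).
  move=> vE qE vf oc Hg.
  have [_ og] := occurs_cons qE oc.
  have vg : two_vars g by apply: two_vars_sub vf => z zv; rewrite vE inE zv orbT.
  rewrite qE /=; split=> [co|/agree_cons[a0 ag]].
    have ag : agree A (truth om) k.+1 (size (quants g)).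
      by apply/Hg => // j js; rewrite addSnnS; exact: co.
    apply: agree_step => //; apply/(consistent_quant vE qE vf oc ag).
    by have := co 0 isT; rewrite addn0.
  case=> [_|j js]; first by rewrite addn0; apply/(consistent_quant vE qE vf oc ag).
  by rewrite -addSnnS; move/(Hg _ vg og): ag; apply.
elim: f i => [P xs|x y|g IHg|g IHg h IHh|g IHg h IHh|g IHg h IHh|x g IHg|x g IHg]
  i vf oc //.
- exact: IHg.
- have [og oh] := @occurs_cat i (FAnd g h) g h erefl oc.
  by apply: cat => //; apply: two_vars_sub vf => z zv; rewrite mem_cat zv ?orbT.
- have [og oh] := @occurs_cat i (FOr g h) g h erefl oc.
  by apply: cat => //; apply: two_vars_sub vf => z zv; rewrite mem_cat zv ?orbT.
- have [og oh] := @occurs_cat i (FImp g h) g h erefl oc.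
  by apply: cat => //; apply: two_vars_sub vf => z zv; rewrite mem_cat zv ?orbT.
- exact: (cons (FForall x g) true x g).
- exact: (cons (FExists x g) false x g).
Qed.

(** * From guesses to products over pairs of elements *)

Section Sum.

Local Open Scope ring_scope.

Variable R : comNzRingType.
Hypothesis vPsi : two_vars Psi.

Definition table (a : {ffun 'I_(size (quants Psi)) -> bool}) (i : nat) : bool :=
  odflt false (omap a (insub i)).

Lemma tableE a (i : 'I_(size (quants Psi))) : table a i = a i.
Proof. by rewrite /table valK. Qed.

(** Exactly one guess is consistent, the true one [A0], and under it the quantifier-free evaluation
    is the real one. *)
Lemma sat_sum n (om : world arity n) :
  [forall d, eval om (fun=> d) Psi]%:R =
  \sum_(A : {ffun 'I_n -> {ffun 'I_(size (quants Psi)) -> bool}})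
    (\prod_v \prod_i ((A v i == (quant i).1.1) ==
       [forall d, instance om (table \o A) i v d])%:R) *
    \prod_v (qf_eval om (table \o A) (fun=> v) 0 Psi)%:R :> R.
Proof.
pose A0 : {ffun 'I_n -> {ffun 'I_(size (quants Psi)) -> bool}} :=
  [ffun v => [ffun i : 'I_(size (quants Psi)) => truth om v i]].
have oc : occurs_at 0 Psi by [].
have ag0 : agree (table \o A0) (truth om) 0 (size (quants Psi)).
  by move=> j v js; rewrite add0n /= (tableE _ (Ordinal js)) !ffunE.
rewrite (bigD1 A0) //= [X in _ + X]big1 ?addr0 => [|A neA]; last first.
  under eq_bigr do rewrite prod_bool; rewrite prod_bool.
  case: forallP => [H|_]; last by rewrite mul0r.
  case/eqP: neA; apply/ffunP => v; apply/ffunP => i; rewrite !ffunE -tableE.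
  have /(consistent_truth om (table \o A) vPsi oc) : forall j, (j < size (quants Psi))%N ->
      consistent om (table \o A) (0 + j).
    move=> j js w; rewrite add0n; have /forallP/(_ (Ordinal js))/eqP <- := H w.
    by rewrite -(tableE _ (Ordinal js)).
  by move=> /(_ i v (ltn_ord i)).
rewrite !prod_bool (_ : [forall v, qf_eval _ _ _ _ _] = [forall d, eval om (fun=> d) Psi]).
  rewrite big1 ?mul1r // => v _; rewrite big1 // => i _.
  have /(consistent_truth om (table \o A0) vPsi oc) /(_ i (ltn_ord i) v) := ag0.
  by rewrite add0n /= tableE => ->; rewrite eqxx.
by apply: eq_forallb => v; apply: qf_eval_truth.
Qed.

(* Moebius inversion: [(P == B)%:R = \sum_s moebius P s * (s ==> B)%:R] turns the
   existential condition [~~ B] into products. *)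
Definition moebius (P s : bool) : R :=
  if P then s%:R else (-1) ^+ s.

Lemma moebius_sum n (om : world arity n) A i v :
  ((A v i == (quant i).1.1) == [forall d, instance om A i v d])%:R =
  \sum_s moebius (A v i == (quant i).1.1) s *
    \prod_d (s ==> instance om A i v d)%:R.
Proof.
rewrite big_bool /= prod_bool big1 // mulr1.
case: (_ == (quant i).1.1) => /=; rewrite ?expr0 ?expr1 ?mul1r ?mul0r ?addr0 //.
by case: [forall d, _]; rewrite ?mulr1 ?mulr0 ?addNr ?add0r.
Qed.

(** The first component holds the guessed truth values, the second the term of the Moebius inversion
    selected for each of them. *)
Definition choices : finType :=
  ({ffun 'I_(size (quants Psi)) -> bool} * {ffun 'I_(size (quants Psi)) -> bool})%type.

(** For injective [h] this is the substructure on the image of [h], renamed; for a permutation it is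
    an isomorphic copy of the whole world. *)
Definition pull m n (om : world arity n) (h : 'I_m -> 'I_n) : world arity m :=
  [set a | holds om (map_tuple h (tagged a))].

Lemma holds_pull m n (om : world arity n) (h : 'I_m -> 'I_n) P ds :
  holds (pull om h) (P := P) ds = holds om (map_tuple h ds).
Proof. by rewrite /holds inE. Qed.

Lemma qf_eval_pull m n (om : world arity n) (h : 'I_m -> 'I_n) A e i f :
  injective h ->
  qf_eval om A (h \o e) i f = qf_eval (pull om h) (A \o h) e i f.
Proof.
move=> hI; elim: f i => //= [P xs|x y|g IHg|g IHg k IHk|g IHg k IHk|g IHg k IHk] i.
- by rewrite holds_pull; congr holds; apply: val_inj; rewrite /= map_comp.
- exact: inj_eq.
- by rewrite IHg.
- by rewrite IHg IHk.
- by rewrite IHg IHk.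
- by rewrite IHg IHk.
Qed.

Definition at1 n (x : 'I_n) : 'I_1 -> 'I_n := fun=> x.
Definition at2 n (x y : 'I_n) : 'I_2 -> 'I_n := fun i => if i == ord0 then x else y.

Lemma at1_inj n (x : 'I_n) : injective (at1 x).
Proof. by move=> i j _; rewrite !ord1. Qed.

Lemma at2_inj n (x y : 'I_n) : x != y -> injective (at2 x y).
Proof.
move=> xy i j; rewrite /at2; have ord2 (k : 'I_2) : k = ord0 \/ k = ord_max.
  by case: k => [[|[]]] // k2; [left|right]; apply: val_inj.
case: (ord2 i) (ord2 j) => -> [] -> //= E.
  by rewrite E eqxx in xy.
by rewrite E eqxx in xy.
Qed.

Definition unary_factor (l : choices) (th : world arity 1) : R :=
  (\prod_i (moebius (l.1 i == (quant i).1.1) (l.2 i) *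
     (l.2 i ==> instance th (fun=> table l.1) i ord0 ord0)%:R)) *
  (qf_eval th (fun=> table l.1) (fun=> ord0) 0 Psi)%:R.

Definition binary_factor (l l' : choices) (tau : world arity 2) : R :=
  let A := fun v : 'I_2 => table (if v == ord0 then l.1 else l'.1) in
  \prod_i ((l.2 i ==> instance tau A i ord0 ord_max)%:R *
           (l'.2 i ==> instance tau A i ord_max ord0)%:R).

(** Once the sums over guesses and over Moebius terms are outside, every condition concerns an
    element [v] and a possible value [d] of the bound variable. The diagonal goes to [unary_factor],
    and both orders of a pair [x < y] go to [binary_factor]. *)
Lemma sat_labels n (om : world arity n) :
  [forall d, eval om (fun=> d) Psi]%:R =
  \sum_(l : {ffun 'I_n -> choices})
    \prod_(y < n) (unary_factor (l y) (pull om (at1 y)) *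
      \prod_(x < n | (x < y)%N) binary_factor (l x) (l y) (pull om (at2 x y))).
Proof.
rewrite sat_sum.
transitivity (\sum_(A : {ffun 'I_n -> {ffun 'I_(size (quants Psi)) -> bool}})
   \sum_(S : {ffun 'I_n -> {ffun 'I_(size (quants Psi)) -> bool}})
   (\prod_v \prod_i (moebius (A v i == (quant i).1.1) (S v i) *
       \prod_d (S v i ==> instance om (table \o A) i v d)%:R)) *
    \prod_v (qf_eval om (table \o A) (fun=> v) 0 Psi)%:R).
  apply: eq_bigr => A _; rewrite -big_distrl /=; congr (_ * _).
  (* The sum over [S] is factored back, by elements and then by subformulas, into the two-term sums
     of [moebius_sum]. *)
  rewrite -(bigA_distr_bigA (fun v (t : {ffun 'I_(size (quants Psi)) -> bool}) =>
    \prod_i (moebius (A v i == (quant i).1.1) (t i) *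
       \prod_d (t i ==> instance om (table \o A) i v d)%:R))).
  apply: eq_bigr => v _.
  rewrite -(bigA_distr_bigA (fun i s => moebius (A v i == (quant i).1.1) s *
       \prod_d (s ==> instance om (table \o A) i v d)%:R)).
  apply: eq_bigr => i _; rewrite -(tableE (A v)).
  exact: (moebius_sum om (table \o A) i v).
rewrite sum_ffun_pair; apply: eq_bigr => l _.
set A := [ffun i => (l i).1]; set S := [ffun i => (l i).2].
have AE v : A v = (l v).1 by rewrite ffunE.
have SE v : S v = (l v).2 by rewrite ffunE.
transitivity (\prod_(y < n) ((\prod_i moebius (A y i == (quant i).1.1) (S y i)) *
     (qf_eval om (table \o A) (fun=> y) 0 Psi)%:R) *
   \prod_(v < n) \prod_(d < n) \prod_i (S v i ==> instance om (table \o A) i v d)%:R).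
  rewrite [in RHS]big_split [RHS]mulrAC -[in RHS]big_split /=; congr (_ * _).
  apply: eq_bigr => v _.
  rewrite big_split /=; congr (_ * _); exact: exchange_big.
rewrite prod_triangle -big_split /=; apply: eq_bigr => y _.
rewrite mulrA; congr (_ * _).
  rewrite /unary_factor -!AE -SE big_split /= mulrAC; congr (_ * _ * _).
    apply: eq_bigr => i _; congr (_ ==> _)%:R.
    rewrite /instance -[RHS]/(_ == _); congr (_ == _).
    rewrite (_ : pair_env _ y y = at1 y \o pair_env (quant i).1.2 ord0 ord0); last first.
      by apply: funext => z; rewrite /pair_env /=; case: ifP.
    by rewrite qf_eval_pull //; exact: at1_inj.
  congr (_%:R); rewrite -[fun=> y]/(at1 y \o (fun=> ord0)) qf_eval_pull //.
  exact: at1_inj.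
apply: eq_bigr => x xy; rewrite /binary_factor -big_split /=; apply: eq_bigr => i _.
have xney : x != y by rewrite -val_eqE /= ltn_eqF.
have AE2 : (table \o A) \o at2 x y =
    fun v : 'I_2 => table (if v == ord0 then (l x).1 else (l y).1).
  by apply: funext => v; rewrite /= /at2; case: ifP => _; rewrite AE.
rewrite -!SE -AE2; congr (_%:R * _%:R); congr (_ ==> _); rewrite /instance.
  rewrite (_ : pair_env _ y x = at2 x y \o pair_env (quant i).1.2 ord_max ord0).
    by rewrite qf_eval_pull //; exact: at2_inj.
  by apply: funext => z; rewrite /pair_env /at2 /=; case: ifP.
rewrite (_ : pair_env _ x y = at2 x y \o pair_env (quant i).1.2 ord0 ord_max).
  by rewrite qf_eval_pull //; exact: at2_inj.
by apply: funext => z; rewrite /pair_env /at2 /=; case: ifP.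
Qed.

End Sum.

End Normalize.

(** * Factorization of sums over possible worlds *)

(** A set amounts to an independent choice of a subset of each fibre of [f]. *)
Lemma sum_fibers (R : comNzRingType) (T D : finType) (f : T -> D)
    (G : D -> {set T} -> R) :
  (\sum_(A : {set T}) \prod_d G d (A :&: [set t | f t == d]) =
   \prod_d \sum_(A : {set T} | A \subset [set t | f t == d]) G d A)%R.
Proof.
rewrite bigA_distr_big_dep /=.
pose split (A : {set T}) : {ffun D -> {set T}} := [ffun d => A :&: [set t | f t == d]].
pose glue (B : {ffun D -> {set T}}) : {set T} := [set t | t \in B (f t)].
have splitK A : glue (split A) = A.
  by apply/setP => t; rewrite !inE ffunE !inE eqxx andbT.
rewrite (reindex_onto split glue) /=.
  apply: eq_big => [A|A _]; last by apply: eq_bigr => d _; rewrite ffunE.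
  rewrite splitK eqxx andbT; apply/esym/familyP => d.
  by rewrite ffunE unfold_in /= subsetIr.
move=> B /familyP HB; apply/ffunP => d; rewrite ffunE; apply/setP => t; rewrite !inE.
apply/andP/idP => [[tB /eqP <-] //|tB].
have /subsetP/(_ t tB) : B d \subset [set t | f t == d] by exact: HB.
by rewrite inE => /eqP ftd; rewrite ftd eqxx.
Qed.

Lemma card_set2_lt n (x y : 'I_n) : x < y -> #|[set x; y]| = 2.
Proof. by move=> xy; rewrite cards2 -val_eqE /= ltn_eqF. Qed.

Lemma set2_lt_inj n (x y x' y' : 'I_n) : x < y -> x' < y' ->
  [set x; y] = [set x'; y'] -> x = x' /\ y = y'.
Proof.
move=> xy xy' E.
have : x \in [set x'; y'] by rewrite -E !inE eqxx.
have : y \in [set x'; y'] by rewrite -E !inE eqxx orbT.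
have : x' \in [set x; y] by rewrite E !inE eqxx.
rewrite !inE => /orP[] /eqP Ex' /orP[] /eqP Ey /orP[] /eqP Ex; subst=> //;
  by rewrite ?ltnn // in xy xy' *; have := ltn_trans xy xy'; rewrite ltnn.
Qed.

Lemma big_sets (M : Type) (idx : M) (op : Monoid.com_law idx) n (H : {set 'I_n} -> M) :
  \big[op/idx]_D H D = op (op (op (H set0) (\big[op/idx]_x H [set x]))
    (\big[op/idx]_(y < n) \big[op/idx]_(x < n | x < y) H [set x; y]))
    (\big[op/idx]_(D : {set 'I_n} | 2 < #|D|) H D).
Proof.
rewrite (bigID (fun D : {set 'I_n} => 2 < #|D|)) /= Monoid.mulmC; congr (op _ _).
rewrite (bigID (fun D : {set 'I_n} => #|D| <= 1)) /=; congr (op _ _).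
  rewrite (bigD1 set0) ?cards0 //=; congr (op _ _).
  transitivity (\big[op/idx]_(D in [set [set x] | x : 'I_n]) H D).
    apply: eq_bigl => D; apply/andP/imsetP => [[/andP[_ D1] D0]|[x _ ->]].
      have /cards1P[x ->] : #|D| == 1%N by rewrite eqn_leq D1 card_gt0.
      by exists x.
    by rewrite cards1; split=> //; apply/eqP => /setP/(_ x); rewrite !inE eqxx.
  rewrite big_imset /=; last by move=> x y _ _ /set1_inj.
  by apply: eq_bigl => x; rewrite inE.
transitivity (\big[op/idx]_(D in
    [set [set p.2; p.1] | p in [set p : 'I_n * 'I_n | p.2 < p.1]]) H D).
  apply: eq_bigl => D; apply/andP/imsetP => [[]|[[y x]]].
    rewrite -leqNgt -ltnNge => D2 D1.
    have /cards2P[x [y [xy ->]]] : #|D| == 2 by rewrite eqn_leq D2 D1.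
    have [lt|lt|E] := ltngtP x y; last by rewrite (val_inj E) eqxx in xy.
      by exists (y, x); rewrite ?inE.
    by exists (x, y); rewrite ?inE // setUC.
  by rewrite inE /= => xy ->; rewrite card_set2_lt.
rewrite big_imset /=; last first.
  move=> [y x] [y' x']; rewrite !inE /= => xy xy' E.
  by have [-> ->] := set2_lt_inj xy xy' E.
by rewrite pair_big_dep /=; apply: eq_bigl => -[y x]; rewrite inE.
Qed.

(** * Atoms grouped by the set of their elements *)

Section Atoms.

Variables (sig : finType) (arity : sig -> nat).

Notation ground_atom := (ground_atom arity).
Notation world := (world arity).

Definition support n (a : ground_atom n) : {set 'I_n} := [set x in val (tagged a)].

Definition amap m n (h : 'I_m -> 'I_n) (a : ground_atom m) : ground_atom n :=
  existT (fun P : sig => (arity P).-tuple 'I_n) (tag a) (map_tuple h (tagged a)).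

Lemma amap_eq m n (h h' : 'I_m -> 'I_n) a :
  {in support a, h =1 h'} -> amap h a = amap h' a.
Proof.
move=> hh; rewrite /amap; congr existT; apply: val_inj => /=.
by apply/eq_in_map => x xa; apply: hh; rewrite inE.
Qed.

Lemma amap_id n (a : ground_atom n) : amap id a = a.
Proof. by case: a => P t; rewrite /amap; congr existT; apply: val_inj; rewrite /= map_id. Qed.

Lemma amap_comp m n k (h : 'I_n -> 'I_k) (g : 'I_m -> 'I_n) a :
  amap h (amap g a) = amap (h \o g) a.
Proof. by rewrite /amap /=; congr existT; apply: val_inj; rewrite /= map_comp. Qed.

Lemma support_amap m n (h : 'I_m -> 'I_n) a : support (amap h a) = h @: support a.
Proof.
apply/setP => y; rewrite inE; apply/mapP/imsetP => -[x xa ->]; exists x => //.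
  by rewrite inE.
by rewrite inE in xa.
Qed.

Lemma pullE m n (om : world n) (h : 'I_m -> 'I_n) a :
  (a \in pull om h) = (amap h a \in om).
Proof. by rewrite inE. Qed.

Lemma injective_retract m n (h : 'I_m.+1 -> 'I_n) : injective h ->
  exists g, cancel h g.
Proof.
move=> hI; exists (fun y => odflt ord0 [pick i | h i == y]) => i.
by case: pickP => [j /eqP/hI ->|/(_ i)]; rewrite //= eqxx.
Qed.

Lemma amap_cancel m n (h : 'I_m -> 'I_n) g : cancel h g -> cancel (amap h) (amap g).
Proof. by move=> hK a; rewrite amap_comp (amap_eq (h' := id)) ?amap_id // => x _; exact: hK. Qed.

Lemma amap_retract m n (h : 'I_m -> 'I_n) g b (D : {set 'I_m}) : cancel h g ->
  support b = h @: D -> amap h (amap g b) = b.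
Proof.
move=> hK bD; rewrite amap_comp (amap_eq (h' := id)) ?amap_id // => y.
by rewrite bD => /imsetP[x _ ->] /=; rewrite hK.
Qed.

Section Sums.

Variable R : comNzRingType.
Local Open Scope ring_scope.

Lemma prod_amap m n (h : 'I_m.+1 -> 'I_n) (D : {set 'I_m.+1}) (f : ground_atom n -> R) : injective h ->
  \prod_(b | support b == h @: D) f b = \prod_(a | support a == D) f (amap h a).
Proof.
move=> hI; have [g hK] := injective_retract hI.
rewrite (reindex_onto (amap h) (amap g)) /=.
  by apply: eq_bigl => a; rewrite amap_cancel // eqxx andbT support_amap (inj_eq (imset_inj hI)).
by move=> b /eqP bD; exact: amap_retract hK bD.
Qed.

Lemma sum_amap m n (h : 'I_m.+1 -> 'I_n) (D : {set 'I_m.+1}) (G : world n -> R) : injective h ->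
  \sum_(A : world n | A \subset [set b | support b == h @: D]) G A =
  \sum_(B : world m.+1 | B \subset [set a | support a == D]) G (amap h @: B).
Proof.
move=> hI; have [g hK] := injective_retract hI.
have aI : injective (amap h) := can_inj (amap_cancel hK).
rewrite (reindex_onto (fun B : world m.+1 => amap h @: B : world n)
    (fun A : world n => amap h @^-1: A : world m.+1)) /=.
  apply: eq_bigl => B; rewrite (_ : (_ == B) = true) ?andbT.
    apply/subsetP/subsetP => [H a aB|H b /imsetP[a aB ->]].
      have := H _ (imset_f (amap h) aB).
      by rewrite !inE support_amap (inj_eq (imset_inj hI)).
    have := H _ aB; by rewrite !inE support_amap (inj_eq (imset_inj hI)).
  by apply/eqP/setP => a; rewrite inE mem_imset.
move=> A /subsetP AD; apply/setP => b; apply/imsetP/idP => [[a]|bA].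
  by rewrite inE => aA ->.
have := AD b bA; rewrite inE => /eqP bD.
by exists (amap g b); rewrite ?inE (amap_retract hK bD).
Qed.

Variables w wbar : sig -> R.

Definition atom_weight n (a : ground_atom n) (v : bool) : R :=
  if v then w (tag a) else wbar (tag a).

Lemma weight_prod n (om : world n) : weight w wbar om = \prod_a atom_weight a (a \in om).
Proof.
rewrite /weight [RHS](bigID (mem om)) /=; congr (_ * _).
  by apply: eq_bigr => a ->.
by apply: eq_big => [a|a]; rewrite ?inE // => /negPf ->.
Qed.

Definition part_weight n (D : {set 'I_n}) (om : world n) : R :=
  \prod_(a | support a == D) atom_weight a (a \in om).

Lemma weight_parts n (om : world n) : weight w wbar om = \prod_D part_weight D om.
Proof. by rewrite weight_prod (partition_big (@support n) xpredT). Qed.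

Lemma part_weight_local n (D : {set 'I_n}) (om om' : world n) :
  om :&: [set a | support a == D] = om' :&: [set a | support a == D] ->
  part_weight D om = part_weight D om'.
Proof.
move=> E; apply: eq_bigr => a aD; congr atom_weight.
by have := congr1 (fun A : world n => a \in A) E; rewrite !inE aD !andbT.
Qed.

Lemma part_weight_pull m n (h : 'I_m.+1 -> 'I_n) (D : {set 'I_m.+1}) om : injective h ->
  part_weight (h @: D) om = part_weight D (pull om h).
Proof.
move=> hI; rewrite /part_weight prod_amap //; apply: eq_bigr => a _.
by rewrite pullE.
Qed.

Lemma sum_subset_weight n (D : {set 'I_n}) :
  \sum_(A : world n | A \subset [set a | support a == D]) part_weight D A =
  \prod_(a : ground_atom n | support a == D) (w (tag a) + wbar (tag a)).
Proof.
pose f (a : ground_atom n) : R := if support a == D then w (tag a) else 0.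
pose g (a : ground_atom n) : R := if support a == D then wbar (tag a) else 1.
transitivity (\prod_a (f a + g a)); last first.
  by rewrite [RHS]big_mkcond; apply: eq_bigr => a _; rewrite /f /g; case: ifP; rewrite ?add0r.
rewrite bigA_distr.
rewrite [RHS](bigID (fun A : {set ground_atom n} => A \subset [set a | support a == D])) /=.
rewrite [X in _ + X]big1 ?addr0.
  apply: eq_bigr => A /subsetP AD; rewrite /part_weight big_mkcond; apply: eq_bigr => a _.
  rewrite /f /g /atom_weight; case: ifP => // aD; case: ifP => // aA.
  by have := AD a aA; rewrite inE aD.
move=> A /subsetPn[a aA aD]; rewrite (bigD1 a) //= aA /f.
by rewrite inE in aD; rewrite (negPf aD) mul0r.
Qed.

(** * Worlds with prescribed one-element substructures *)

Section Factor.

Variables (n : nat) (x0 : 'I_n) (th : 'I_n -> world 1).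
Variable g : 'I_n -> 'I_n -> world 2 -> R.

Definition fiber m (D : {set 'I_m}) : world m := [set a | support a == D].

Definition to1 : 'I_n -> 'I_1 := fun=> ord0.

(** The atoms with at most one element that [th] dictates. Every [th x] speaks about the nullary
    atoms, so one element [x0] is singled out to decide them; [compatible] says that the others
    agree. *)
Definition prescribed : world n :=
  [set a | (support a == set0) && (amap to1 a \in th x0)
        || [exists x, (support a == [set x]) && (amap to1 a \in th x)]].

Definition compatible : Prop :=
  forall x (a : ground_atom 1), support a = set0 -> (a \in th x) = (a \in th x0).

Lemma at1_to1 m (x : 'I_m) (k : 'I_m -> 'I_1) : k \o at1 x =1 id.
Proof. by move=> i; rewrite !ord1. Qed.

Lemma amap_to1 x (a : ground_atom 1) : amap to1 (amap (at1 x) a) = a.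
Proof. by rewrite amap_comp (amap_eq (h' := id)) ?amap_id // => i _; exact: at1_to1. Qed.

Lemma support1 (a : ground_atom 1) : support a = set0 \/ support a = [set ord0].
Proof.
have [i ai|a0] := pickP (mem (support a)); [right|left]; apply/setP => j; rewrite !inE.
  by move: ai; rewrite !ord1 eqxx /= inE.
by have := a0 j; rewrite /= inE.
Qed.

Lemma at1_set0 m (x : 'I_m) : at1 x @: set0 = set0.
Proof. exact: imset0. Qed.

Lemma at1_setT m (x : 'I_m) : at1 x @: [set ord0] = [set x].
Proof. exact: imset_set1. Qed.

Lemma at2_setT m (x y : 'I_m) : at2 x y @: [set ord0; ord_max] = [set x; y].
Proof. by rewrite imsetU1 imset_set1. Qed.

Lemma set2T : [set ord0; ord_max] = [set: 'I_2].
Proof. by apply/setP => i; rewrite !inE -!val_eqE; case: i => [[|[|]]]. Qed.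

Lemma small_support m (z : 'I_m) (a : ground_atom m) : (#|support a| <= 1)%N ->
  exists x b, a = amap (at1 x) b.
Proof.
move=> a1; exists (odflt z [pick x in support a]), (amap (fun=> ord0) a).
rewrite amap_comp -[LHS]amap_id; apply: amap_eq => x xa /=; rewrite /at1.
case: pickP => [y ya|/(_ x)]; last by rewrite /= xa.
by move/card_le1_eqP: a1; apply.
Qed.

Lemma pull_prescribed x : compatible -> pull prescribed (at1 x) = th x.
Proof.
move=> co; apply/setP => a; rewrite pullE inE amap_to1 support_amap.
case: (support1 a) => aE; rewrite aE.
  rewrite at1_set0 eqxx /= -(co x a aE); apply/orP/idP => [[//|/existsP[y /andP[]]]|]; last by left.
  by move/eqP => /setP/(_ y); rewrite !inE eqxx.
rewrite at1_setT; apply/orP/idP => [[/andP[/eqP/setP/(_ x)]|/existsP[y /andP[]]]|ax].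
- by rewrite !inE eqxx.
- by move/eqP/set1_inj ->.
- by right; apply/existsP; exists x; rewrite eqxx.
Qed.

Lemma prescribed_small a : a \in prescribed -> (#|support a| <= 1)%N.
Proof.
by rewrite inE => /orP[/andP[/eqP ->]|/existsP[x /andP[/eqP ->]]]; rewrite ?cards0 ?cards1.
Qed.

Lemma matchP (om : world n) : compatible ->
  [forall x, pull om (at1 x) == th x] =
  [forall D : {set 'I_n}, (#|D| <= 1)%N ==> (om :&: fiber D == prescribed :&: fiber D)].
Proof.
move=> co; apply/forallP/forallP => H.
  move=> D; apply/implyP => D1; apply/eqP/setP => a; rewrite !inE.
  case: eqP => [aD|]; rewrite ?andbT ?andbF // -aD in D1 *.
  have [x [b ab]] := small_support x0 D1.
  have /eqP := H x; rewrite -(pull_prescribed x co) => /setP/(_ b).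
  by rewrite !pullE -ab inE.
move=> x; rewrite -(pull_prescribed x co); apply/eqP/setP => a; rewrite !pullE.
have := H (support (amap (at1 x) a)); rewrite support_amap.
have -> : (#|at1 x @: support a| <= 1)%N.
  by apply: leq_trans (leq_imset_card _ _) _; case: (support1 a) => ->; rewrite ?cards0 ?cards1.
move=> /eqP/setP/(_ (amap (at1 x) a)).
by rewrite !in_setI /fiber !(inE, support_amap) eqxx !andbT.
Qed.

(** Taking the union with [prescribed] restores the smaller atoms, so that the two-element structure
    seen by [g] can be recovered from the atoms with support [D] alone. *)
Definition part_factor (D : {set 'I_n}) (A : world n) : R :=
  part_weight D A * (((#|D| <= 1)%N ==> (A == prescribed :&: fiber D))%:R *
    \prod_(y < n) \prod_(x < n | (x < y)%N)
      (if D == [set x; y] then g x y (pull (A :|: prescribed) (at2 x y)) else 1)).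

Lemma at2_lt_inj (x y : 'I_n) : (x < y)%N -> injective (at2 x y).
Proof. by move=> xy; apply: at2_inj; rewrite -val_eqE /= ltn_eqF. Qed.

Lemma support2_small (a : ground_atom 2) :
  support a != [set ord0; ord_max] -> (#|support a| <= 1)%N.
Proof.
rewrite set2T -properT => /proper_card.
by rewrite cardsT card_ord.
Qed.

Lemma prod_at_set2 (f : {set 'I_n} -> 'I_n -> 'I_n -> R) :
  \prod_D \prod_(y < n) \prod_(x < n | (x < y)%N)
    (if D == [set x; y] then f D x y else 1) =
  \prod_(y < n) \prod_(x < n | (x < y)%N) f [set x; y] x y.
Proof.
rewrite exchange_big /=; apply: eq_bigr => y _.
rewrite exchange_big /=; apply: eq_bigr => x _.
rewrite (bigD1 [set x; y]) //= eqxx big1 ?mulr1 // => D /negPf ->.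
by [].
Qed.

(** If some one-element substructure differs from [th], both sides are 0. Otherwise [om] and
    [prescribed] agree on small supports, and the world seen by [g] is unchanged by the
    replacement. *)
Lemma weighted_term (om : world n) : compatible ->
  weight w wbar om * [forall x, pull om (at1 x) == th x]%:R *
    \prod_(y < n) \prod_(x < n | (x < y)%N) g x y (pull om (at2 x y)) =
  \prod_D part_factor D (om :&: fiber D).
Proof.
move=> co; rewrite /part_factor big_split big_split /=.
rewrite (prod_at_set2 (fun D x y => g x y (pull (om :&: fiber D :|: prescribed) (at2 x y)))).
rewrite weight_parts -mulrA; congr (_ * _).
  apply: eq_bigr => D _; apply: part_weight_local.
  by rewrite -setIA setIid.
rewrite prod_bool matchP //; case: forallP => [H|_]; last by rewrite !mul0r.
congr (_ * _); apply: eq_bigr => y _; apply: eq_bigr => x xy; congr g.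
apply/setP => a; rewrite !pullE in_setU in_setI [_ \in fiber _]inE support_amap.
rewrite -at2_setT (inj_eq (imset_inj (at2_lt_inj xy))).
case: eqP => [aT|/eqP aT].
  rewrite andbT; case: (_ \in om) => //=; apply/esym/negbTE/negP => /prescribed_small.
  by rewrite support_amap aT at2_setT card_set2_lt.
rewrite andbF /=.
have a1 : (#|support (amap (at2 x y) a)| <= 1)%N.
  rewrite support_amap; apply: leq_trans (leq_imset_card _ _) _.
  exact: support2_small.
have := H (support (amap (at2 x y) a)); rewrite a1 => /eqP/setP/(_ (amap (at2 x y) a)).
by rewrite !in_setI [_ \in fiber _]inE eqxx !andbT.
Qed.

Lemma part_factor_small (D : {set 'I_n}) : (#|D| <= 1)%N ->
  \sum_(A : world n | A \subset fiber D) part_factor D A = part_weight D prescribed.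
Proof.
move=> D1; rewrite (bigD1 (prescribed :&: fiber D)) ?subsetIr //= big1 ?addr0.
  rewrite /part_factor D1 eqxx mul1r big1 ?mulr1.
    by apply: part_weight_local; rewrite -setIA setIid.
  move=> y _; rewrite big1 // => x xy; case: eqP => // DE.
  by rewrite DE card_set2_lt in D1.
by move=> A /andP[_ /negPf AP]; rewrite /part_factor D1 AP mul0r mulr0.
Qed.

Lemma part_factor_large (D : {set 'I_n}) : (2 < #|D|)%N ->
  \sum_(A : world n | A \subset fiber D) part_factor D A =
  \prod_(a : ground_atom n | support a == D) (w (tag a) + wbar (tag a)).
Proof.
move=> D2; rewrite -sum_subset_weight; apply: eq_bigr => A _.
rewrite /part_factor leqNgt (ltnW D2) /= mul1r big1 ?mulr1 // => y _.
rewrite big1 // => x xy; case: eqP => // DE.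
by rewrite DE card_set2_lt in D2.
Qed.

Definition matches (x y : 'I_n) (tau : world 2) : bool :=
  (pull tau (at1 ord0) == th x) && (pull tau (at1 ord_max) == th y).

Lemma pull_pull m k l (om : world l) (h : 'I_k -> 'I_l) (f : 'I_m -> 'I_k) :
  pull (pull om h) f = pull om (h \o f).
Proof. by apply/setP => a; rewrite !pullE amap_comp. Qed.

(** Atoms with support [[set x; y]] correspond to the atoms of full support over two elements.
    Adding the small atoms fixed by [th] is a bijection from sets of the latter onto the two-element
    worlds that match. *)
Lemma part_factor_pair (x y : 'I_n) : compatible -> (x < y)%N ->
  \sum_(A : world n | A \subset fiber [set x; y]) part_factor [set x; y] A =
  \sum_(tau | matches x y tau) part_weight setT tau * g x y tau.
Proof.
move=> co xy; have hI := at2_lt_inj xy.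
pose h := at2 x y; pose P2 := pull prescribed h.
have P2m : matches x y P2.
  rewrite /matches !pull_pull -(pull_prescribed x co) -(pull_prescribed y co).
  by apply/andP; split; apply/eqP; congr pull; apply: funext.
have P2T a : support a = setT -> a \in P2 = false.
  move=> aT; rewrite pullE; apply/negP => /prescribed_small.
  by rewrite support_amap aT -set2T at2_setT card_set2_lt.
have matchE tau : matches x y tau = [forall a, (support a != setT) ==> ((a \in tau) == (a \in P2))].
  apply/idP/forallP => [/andP[/eqP t0 /eqP t1] a|H].
    apply/implyP => aT; have a1 : (#|support a| <= 1)%N by apply: support2_small; rewrite set2T.
    have [z [b ->]] := small_support ord0 a1.
    have /andP[/eqP p0 /eqP p1] := P2m.
    have [->|->] : z = ord0 \/ z = ord_max.
      by case: z => [[|[]]] // ?; [left|right]; apply: val_inj.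
    by rewrite -!pullE t0 p0.
    by rewrite -!pullE t1 p1.
  have E z : pull tau (at1 z) = pull P2 (at1 z).
    apply/setP => b; rewrite (pullE tau) (pullE P2).
    apply/eqP; have /implyP := H (amap (at1 z) b); apply.
    rewrite support_amap; apply: contraTneq (leq_imset_card (at1 z) (support b)) => ->.
    rewrite cardsT card_ord -ltnNge ltnS.
    by case: (support1 b) => ->; rewrite ?cards0 ?cards1.
  by rewrite /matches !E.
have hT : h @: setT = [set x; y] by rewrite -at2_setT set2T.
rewrite -hT /fiber (sum_amap setT _ hI).
have BE (B : world 2) : B \subset [set a | support a == setT] ->
    part_factor (h @: setT) (amap h @: B) =
    part_weight setT (B :|: P2) * g x y (B :|: P2).
  move=> /subsetP BT; rewrite /part_factor part_weight_pull // hT.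
  rewrite card_set2_lt // mul1r.
  have -> : pull (amap h @: B) h = B.
    apply/setP => a; rewrite pullE mem_imset //.
    by have [k hK] := injective_retract hI; exact: can_inj (amap_cancel hK).
  congr (_ * _).
    apply: eq_bigr => a /eqP aT; congr atom_weight.
    by rewrite in_setU P2T // orbF.
  rewrite (bigD1 y) //= [X in _ * X]big1 ?mulr1; last first.
    move=> y' /eqP yy'; rewrite big1 // => x' xy'; case: eqP => // E.
    by case: (set2_lt_inj xy xy' E) => _ /esym.
  rewrite (bigD1 x) //= [X in _ * X]big1 ?mulr1; last first.
    move=> x' /andP[xy' /eqP xx']; case: eqP => // E.
    by case: (set2_lt_inj xy xy' E) => /esym.
  rewrite eqxx; congr g; apply/setP => a; rewrite !(pullE, in_setU); congr (_ || _).
  rewrite mem_imset //.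
  by have [k hK] := injective_retract hI; exact: can_inj (amap_cancel hK).
rewrite (eq_bigr _ BE).
rewrite [RHS](reindex_onto (fun B : world 2 => B :|: P2)
  (fun tau : world 2 => tau :&: [set a | support a == setT])) /=; last first.
  move=> tau; rewrite matchE => /forallP H; apply/setP => a.
  rewrite in_setU in_setI [X in _ && X]inE; case: eqP => [aT|/eqP aT].
    by rewrite andbT P2T // orbF.
  by rewrite andbF; have /implyP/(_ aT)/eqP -> := H a.
apply: eq_bigl => B; apply/subsetP/andP => [BT|[_ /eqP <-] a]; last by rewrite in_setI => /andP[].
split.
  rewrite matchE; apply/forallP => a; apply/implyP => aT; rewrite in_setU.
  case aB: (a \in B) => //=; by have := BT a aB; rewrite inE (negPf aT).
apply/eqP/setP => a; rewrite in_setI in_setU [X in _ && X]inE.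
case: eqP => [aT|/eqP aT]; first by rewrite P2T // orbF andbT.
by rewrite andbF; apply/esym/negbTE; apply: contra aT => /BT; rewrite inE.
Qed.

Definition rest_weight : R :=
  \prod_(a : ground_atom n | (2 < #|support a|)%N) (w (tag a) + wbar (tag a)).

(** For compatible [th] the summand is a product over supports, and the supports can be treated
    independently. Otherwise both sides vanish: no world has these substructures, and on the right
    the pair of [x0] with an element that disagrees on a nullary atom has no matching two-element
    world. *)
Lemma sum_worlds :
  \sum_(om : world n) weight w wbar om * [forall x, pull om (at1 x) == th x]%:R *
    \prod_(y < n) \prod_(x < n | (x < y)%N) g x y (pull om (at2 x y)) =
  part_weight set0 (th x0) * rest_weight *
  \prod_(y < n) (part_weight setT (th y) * \prod_(x < n | (x < y)%N)
     \sum_(tau | matches x y tau) part_weight setT tau * g x y tau).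
Proof.
have [co|nco] := EM compatible.
  rewrite (eq_bigr _ (fun om _ => weighted_term om co)).
  rewrite (sum_fibers (@support n) part_factor) big_sets /=.
  rewrite part_factor_small ?cards0 //.
  have -> : part_weight set0 prescribed = part_weight set0 (th x0).
    rewrite -(at1_set0 x0) part_weight_pull; last exact: at1_inj.
    by rewrite pull_prescribed.
  have -> : \prod_x (\sum_(A : world n | A \subset fiber [set x]) part_factor [set x] A) =
      \prod_x part_weight setT (th x).
    apply: eq_bigr => x _; rewrite part_factor_small ?cards1 //.
    rewrite -at1_setT part_weight_pull; last exact: at1_inj.
    by rewrite pull_prescribed //; congr part_weight; apply/setP => i; rewrite !inE ord1.
  have -> : \prod_(D : {set 'I_n} | (2 < #|D|)%N)
      (\sum_(A : world n | A \subset fiber D) part_factor D A) = rest_weight.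
    rewrite /rest_weight (partition_big (@support n) (fun D => (2 < #|D|)%N)) //=.
    apply: eq_bigr => D D2; rewrite part_factor_large //; apply: eq_bigl => a.
    by case: eqP => [->|]; rewrite ?andbF // D2.
  rewrite [in RHS]big_split /=.
  have -> : \prod_(y < n) \prod_(x < n | (x < y)%N)
        (\sum_(A : world n | A \subset fiber [set x; y]) part_factor [set x; y] A) =
      \prod_(y < n) \prod_(x < n | (x < y)%N)
        \sum_(tau | matches x y tau) part_weight setT tau * g x y tau.
    by apply: eq_bigr => y _; apply: eq_bigr => x xy; exact: part_factor_pair.
  by ring.
have [x [a [a0 ax]]] : exists x a, support a = set0 /\ (a \in th x) != (a \in th x0).
  have [x H] := (existsNP _).2 nco; have [a H'] := (existsNP _).2 H.
  by exists x, a; move/not_implyP: H' => [? /eqP].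
have amap0 m (z z' : 'I_m) : amap (at1 z) a = amap (at1 z') a.
  by apply: amap_eq => i; rewrite a0 inE.
rewrite big1 => [|om _]; last first.
  rewrite (_ : [forall x, _] = false) ?mulr0 ?mul0r //; apply/negbTE/forallPn.
  have [E|E] := eqVneq (pull om (at1 x)) (th x); last by exists x.
  exists x0; apply: contraNneq ax => E0.
  by rewrite -E -E0 !pullE (amap0 _ x x0).
have nomatch y z tau : (a \in th y) != (a \in th z) -> matches y z tau = false.
  move=> yz; apply/negbTE; apply: contra yz => /andP[/eqP <- /eqP <-].
  by rewrite !pullE (amap0 _ ord0 ord_max).
have [lt|lt|E] := ltngtP x x0; last by rewrite (val_inj E) eqxx in ax.
- rewrite (bigD1 x0) //= (bigD1 x) //= big1 ?mul0r ?mulr0 ?mul0r ?mulr0 // => tau.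
  by rewrite nomatch.
- rewrite (bigD1 x) //= (bigD1 x0) //= [\sum_(tau | _) _]big1 ?mul0r ?mulr0 ?mul0r ?mulr0 // => tau.
  by rewrite nomatch // eq_sym.
Qed.

End Factor.

End Sums.

End Atoms.

Lemma card_ord_lt n k : k <= n -> #|[pred x : 'I_n | x < k]| = k.
Proof.
move=> kn; rewrite -sum1_card -[RHS]card_ord -[RHS]sum1_card.
transitivity (\sum_(i < n | i < k) 1); first by apply: eq_bigl => x; rewrite inE.
rewrite -(big_ord_widen n (fun=> 1) kn); exact: eq_bigl.
Qed.

(** * Counting the atoms with at least three elements *)

Section RestWeight.

Variables (sig : finType) (arity : sig -> nat).

(** The number of tuples in which both elements of a given pair occur and no others. It depends on
    the arity alone and enters the program as a numeral. *)
Definition full_tuples (a : nat) : nat :=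
  #|[pred t : a.-tuple 'I_2 | [set x in val t] == setT]|.

Lemma set_map_tuple a m n (h : 'I_m -> 'I_n) (t : a.-tuple 'I_m) :
  [set x in val (map_tuple h t)] = h @: [set x in val t].
Proof.
apply/setP => y; rewrite inE; apply/mapP/imsetP => -[x xt ->]; exists x => //.
  by rewrite inE.
by rewrite inE in xt.
Qed.

Lemma card_tuples_set0 a n : #|[pred t : a.-tuple 'I_n | [set x in val t] == set0]| = (a == 0).
Proof.
case: a => [|a].
  rewrite (@eq_card1 _ [tuple]) // => t; rewrite !inE tuple0 eqxx.
  by apply/eqP/setP => x; rewrite !inE.
apply: eq_card0 => t; rewrite !inE; apply/negP => /eqP/setP/(_ (thead t)).
by rewrite !inE mem_tnth.
Qed.

Lemma card_tuples_set1 a n (x : 'I_n) :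
  #|[pred t : a.-tuple 'I_n | [set y in val t] == [set x]]| = (0 < a).
Proof.
case: a => [|a].
  apply: eq_card0 => t; rewrite !inE tuple0; apply/negP => /eqP/setP/(_ x).
  by rewrite !inE eqxx.
rewrite (@eq_card1 _ (nseq_tuple a.+1 x)) // => t; rewrite !inE.
apply/eqP/eqP => [E|->]; last by apply/setP => y; rewrite inE mem_nseq inE.
apply: eq_from_tnth => i; have := mem_tnth i t.
have /setP/(_ (tnth t i)) := E; rewrite !inE => -> /eqP ->.
by rewrite (tnth_nth x) nth_nseq ltn_ord.
Qed.

Lemma card_tuples_set2 a n (x y : 'I_n) : x < y ->
  #|[pred t : a.-tuple 'I_n | [set z in val t] == [set x; y]]| = full_tuples a.
Proof.
move=> xy; have hI := at2_lt_inj xy; have [k hK] := injective_retract hI.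
have hT : at2 x y @: setT = [set x; y] by rewrite -at2_setT set2T.
rewrite /full_tuples -(card_image (f := map_tuple (at2 x y))); last first.
  by move=> t t' /(congr1 val) /= /(inj_map hI) /val_inj.
apply: eq_card => t; rewrite !inE; apply/eqP/imageP => [tE|[t' + ->]].
  exists (map_tuple k t).
    rewrite inE set_map_tuple tE -hT -imset_comp (eq_imset (g := id)) ?imset_id //.
  apply: val_inj; rewrite /= -map_comp -[LHS]map_id; apply/eq_in_map => z zt /=.
  have : z \in [set z in val t] by rewrite inE.
  by rewrite tE -hT => /imsetP[i _ ->]; rewrite hK.
by rewrite inE set_map_tuple => /eqP ->.
Qed.

(** All [n ^ a] tuples are sorted by the set of their components; being summands of this total, the
    terms subtracted cannot exceed it. *)
Lemma card_large_tuples a n :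
  #|[pred t : a.-tuple 'I_n | 2 < #|[set x in val t]|]| =
  tuple_count a (full_tuples a) (0 < a) (a == 0) n.
Proof.
pose N (D : {set 'I_n}) := #|[pred t : a.-tuple 'I_n | [set x in val t] == D]|.
have E : n ^ a = \sum_D N D.
  transitivity #|{: a.-tuple 'I_n}|; first by rewrite card_tuple card_ord.
  rewrite -sum1_card.
  rewrite (partition_big (fun t : a.-tuple 'I_n => [set x in val t]) xpredT) //=.
  by apply: eq_bigr => D _; rewrite /N -sum1_card.
have E3 : \sum_(D : {set 'I_n} | 2 < #|D|) N D =
    #|[pred t : a.-tuple 'I_n | 2 < #|[set x in val t]|]|.
  rewrite -sum1_card (partition_big (fun t : a.-tuple 'I_n => [set x in val t])
    (fun D : {set 'I_n} => 2 < #|D|)) //=.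
  apply: eq_bigr => D D2; rewrite /N -sum1_card; apply: eq_bigl => t.
  by rewrite !inE; case: eqP => [->|]; rewrite ?andbF // D2.
have E1 : \sum_x N [set x] = (0 < a) * n.
  rewrite (eq_bigr (fun=> (0 < a : nat))) => [|x _]; last exact: card_tuples_set1.
  by rewrite sum_nat_const card_ord mulnC.
have E2 : \sum_(y < n) \sum_(x < n | x < y) N [set x; y] = full_tuples a * 'C(n, 2).
  rewrite -triangular_sum big_mkord big_distrr; apply: eq_bigr => y _ /=.
  rewrite (eq_bigr (fun=> full_tuples a)) => [|x xy]; last exact: card_tuples_set2.
  rewrite sum_nat_const mulnC; congr (_ * _).
  by rewrite -[RHS](card_ord_lt (ltnW (ltn_ord y))).
move: E; rewrite big_sets /= E1 E2 E3 {1}/N card_tuples_set0 /tuple_count => ->.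
move: (nat_of_bool (a == 0)) ((0 < a) * n) (full_tuples a * 'C(n, 2)) => i j k.
by move: #|_| => l; lia.
Qed.

Lemma rest_weightE (R : comNzRingType) (w wbar : sig -> R) n :
  rest_weight arity w wbar n =
  (\prod_P (w P + wbar P) ^+ tuple_count (arity P) (full_tuples (arity P))
     (0 < arity P) (arity P == 0) n)%R.
Proof.
rewrite /rest_weight.
rewrite -(sig_big_dep xpredT (fun P (t : (arity P).-tuple 'I_n) => 2 < #|[set x in val t]|)
  (fun P _ => (w P + wbar P)%R)) /=.
by apply: eq_bigr => P _; rewrite prodr_const -card_large_tuples.
Qed.

End RestWeight.

(** * Linear orders as permutations *)

Section Orders.

Variable n : nat.

Definition rank (r : rel 'I_n) (x : 'I_n) : nat := #|[pred y | r y x && (y != x)]|.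

Definition ordered_by (s : 'S_n) (r : rel 'I_n) : bool :=
  [forall x, forall y, r x y == (s x <= s y)].

Definition chained_by (s : 'S_n) (r : rel 'I_n) : bool :=
  [forall x, forall y, r x y == (s y == (s x).+1 :> nat)].

Lemma ordered_byP (s : 'S_n) (r : rel 'I_n) : reflect (forall x y, r x y = (s x <= s y)) (ordered_by s r).
Proof.
apply: (iffP forallP) => [H x y|H x]; first by have /forallP/(_ y)/eqP := H x.
by apply/forallP => y; rewrite H.
Qed.

Lemma chained_byP (s : 'S_n) (r : rel 'I_n) :
  reflect (forall x y, r x y = (s y == (s x).+1 :> nat)) (chained_by s r).
Proof.
apply: (iffP forallP) => [H x y|H x]; first by have /forallP/(_ y)/eqP := H x.
by apply/forallP => y; rewrite H.
Qed.

Lemma perm_card_lt (s : 'S_n) x : #|[pred y | s y < s x]| = s x.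
Proof.
rewrite -(card_image (f := s)) /=; last exact: perm_inj.
rewrite -[RHS](card_ord_lt (ltnW (ltn_ord (s x)))); apply: eq_card => y.
rewrite inE; apply/imageP/idP => [[z zx ->] //|yx].
by exists (s^-1%g y); rewrite ?inE permKV.
Qed.

Lemma ordered_by_inj (s s' : 'S_n) (r : rel 'I_n) : ordered_by s r -> ordered_by s' r -> s = s'.
Proof.
move=> /ordered_byP H /ordered_byP H'; apply/permP => x; apply: val_inj.
rewrite /= -perm_card_lt -[RHS]perm_card_lt; apply: eq_card => y.
by rewrite !inE !ltnNge -H -H'.
Qed.

(** The rank, the number of strict predecessors, is strictly increasing along [r]; it is therefore
    injective and yields the permutation. *)
Lemma linear_orderP (r : rel 'I_n) : linear_order r <-> exists s, ordered_by s r.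
Proof.
split=> [[rr ra rt rtot]|[s /ordered_byP H]]; last first.
  split=> [x|x y|y x z|x y]; rewrite !H ?leqnn //.
  - by move=> xy; apply: (@perm_inj _ s); apply: val_inj; apply/eqP; rewrite eqn_leq.
  - exact: leq_trans.
  - exact: leq_total.
have rank_lt x y : r x y -> x != y -> rank r x < rank r y.
  move=> xy nxy; apply: proper_card; apply/properP; split.
    apply/subsetP => z; rewrite !inE => /andP[zx nzx].
    rewrite (rt _ _ _ zx xy); apply: contraNneq nzx => zy.
    by rewrite zy in zx *; apply/eqP/ra; rewrite xy zx.
  by exists x; rewrite !inE ?xy // eqxx andbF.
have rank_n x : rank r x < n.
  rewrite -[X in _ < X]card_ord; apply: proper_card; apply/properP; split.
    exact/subsetP.
  by exists x; rewrite !inE // eqxx andbF.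
have rI : injective (fun x => Ordinal (rank_n x)).
  move=> x y /(congr1 val) /= E; apply/eqP; apply: contraT => xy.
  have /orP[/rank_lt|/rank_lt] := rtot x y.
    by move/(_ xy); rewrite E ltnn.
  by rewrite eq_sym => /(_ xy); rewrite E ltnn.
exists (perm rI); apply/ordered_byP => x y; rewrite !permE /=.
have [->|xy] := eqVneq x y; first by rewrite rr leqnn.
apply/idP/idP => [rxy|]; first exact/ltnW/rank_lt.
have /orP[//|ryx] := rtot x y.
by rewrite leqNgt rank_lt // eq_sym.
Qed.

Lemma successor_ofP (s : 'S_n) (le r : rel 'I_n) : ordered_by s le -> successor_of le r <-> chained_by s r.
Proof.
move=> /ordered_byP H.
have ltE x y : (le x y && (x != y)) = (s x < s y).
  by rewrite H ltn_neqAle andbC (inj_eq val_inj) (inj_eq perm_inj).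
have succE x y : (le x y && (x != y) /\
    ~ (exists z, le x z && (x != z) /\ le z y && (z != y))) <-> (s y == (s x).+1 :> nat).
  rewrite ltE; split=> [[xy nz]|/eqP yx].
    rewrite eqn_leq xy andbT leqNgt; apply/negP => lt; apply: nz.
    pose m := Ordinal (ltn_trans lt (ltn_ord (s y))).
    by exists (s^-1%g m); rewrite !ltE permKV /= lt ltnSn.
  by rewrite yx; split=> // -[z]; rewrite !ltE yx ltnS => -[xz]; rewrite leqNgt xz.
split=> [sr|/chained_byP sr lt x y].
  apply/chained_byP => x y; apply/idP/idP => [/sr/succE //|yx].
  exact/sr/succE.
by rewrite sr; exact: iff_sym (succE x y).
Qed.

(** Along the chain both position functions advance by one, so their difference is constant
    ([shift]). Since [s] runs from 0 to [n.-1], the last element leaves no room for a nonzero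
    difference. *)
Lemma chained_by_inj (s s' : 'S_n) (r : rel 'I_n) : chained_by s r -> chained_by s' r -> s = s'.
Proof.
move=> /chained_byP H /chained_byP H'.
have E x y : (s y == (s x).+1 :> nat) = (s' y == (s' x).+1 :> nat) by rewrite -H -H'.
have shift k x y : s y = s x + k :> nat -> s' y = s' x + k :> nat.
  elim: k y => [|k IHk] y; first by rewrite !addn0 => /val_inj/perm_inj ->.
  rewrite !addnS => yk; have kn : s x + k < n by rewrite -ltnS -yk ltnW // ltnS.
  pose z := s^-1%g (Ordinal kn).
  have zk : s z = s x + k :> nat by rewrite permKV.
  by rewrite -(IHk z zk); apply/eqP; rewrite -E zk yk.
apply/permP => x; apply: val_inj => /=.
have n0 : 0 < n by apply: leq_ltn_trans (ltn_ord (s x)).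
have last_lt : n.-1 < n by rewrite prednK.
pose a := s^-1%g (Ordinal n0); pose z := s^-1%g (Ordinal last_lt).
have sa : s a = 0 :> nat by rewrite permKV.
have sz : s z = n.-1 :> nat by rewrite permKV.
have := shift n.-1 a z; rewrite sa sz add0n => /(_ erefl) Ez.
have := shift (s x) a x; rewrite sa add0n => /(_ erefl) ->.
by have := ltn_ord (s' z); lia.
Qed.

Lemma successor_axiomP (r : rel 'I_n) :
  (exists le : rel 'I_n, linear_order le /\ successor_of le r) <->
  exists s, chained_by s r.
Proof.
split=> [[le [/linear_orderP[s sle] sr]]|[s sr]].
  by exists s; apply/(successor_ofP _ sle).
pose le : rel 'I_n := fun x y => s x <= s y.
have sle : ordered_by s le by apply/ordered_byP.
by exists le; split; [apply/linear_orderP; exists s | apply/(successor_ofP _ sle)].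
Qed.

End Orders.

(** With unique witnesses, an axiom becomes a sum over permutations, which can be exchanged with the
    sum over worlds. *)
Lemma indicator_sum (R : comNzRingType) (I : finType) (P : Prop) (Q : I -> bool) :
  (P <-> exists i, Q i) -> (forall i j, Q i -> Q j -> i = j) ->
  (`[< P >]%:R = \sum_i (Q i)%:R :> R)%R.
Proof.
move=> PQ Q1; case: asboolP => [/PQ[i Qi]|nP].
  rewrite (bigD1 i) //= Qi big1 ?addr0 // => j ji; case Qj: (Q j) => //.
  by rewrite (Q1 _ _ Qj Qi) eqxx in ji.
rewrite big1 // => i _; case Qi: (Q i) => //.
by case: nP; apply/PQ; exists i.
Qed.

(** * The counting formula *)

Section Relabel.

Variables (sig : finType) (arity : sig -> nat).

Lemma binary_pull m n (om : world arity n) (h : 'I_m -> 'I_n) P (arP : arity P = 2) x y :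
  binary (pull om h) arP x y = binary om arP (h x) (h y).
Proof.
rewrite /binary holds_pull; congr holds; apply: val_inj.
by rewrite /= !val_tcast.
Qed.

Lemma eval_pull n (om : world arity n) (s : 'S_n) e f :
  eval (pull om s) e f = eval om (s \o e) f.
Proof.
have upd_s e' x d : s \o update e' x d = update (s \o e') x (s d).
  by apply: funext => y; rewrite /update /=; case: eqP.
elim: f e => [P xs|x y|g IHg|g IHg h IHh|g IHg h IHh|g IHg h IHh|x g IHg|x g IHg] e /=.
- by rewrite holds_pull; congr holds; apply: val_inj; rewrite /= map_comp.
- by rewrite (inj_eq perm_inj).
- by rewrite IHg.
- by rewrite IHg IHh.
- by rewrite IHg IHh.
- by rewrite IHg IHh.
- apply/forallP/forallP => H d; last by rewrite IHg upd_s.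
  by have := H (s^-1%g d); rewrite IHg upd_s permKV.
- apply/existsP/existsP => -[d H]; last first.
    by exists (s^-1%g d); rewrite IHg upd_s permKV.
  by exists (s d); rewrite -upd_s -IHg.
Qed.

Lemma amap_bij n (s : 'S_n) : bijective (@amap sig arity n n s).
Proof. by exists (amap s^-1%g); apply: amap_cancel; [exact: permK | exact: permKV]. Qed.

Lemma pull_bij n (s : 'S_n) : bijective (fun om : world arity n => pull om s).
Proof.
exists (fun om => pull om s^-1%g) => om; apply/setP => a; rewrite !pullE amap_comp;
  by rewrite (amap_eq (h' := id)) ?amap_id // => x _ /=; rewrite ?permK ?permKV.
Qed.

Lemma weight_pull (R : comNzRingType) (w wbar : sig -> R) n (om : world arity n) (s : 'S_n) :
  weight w wbar (pull om s) = weight w wbar om.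
Proof.
rewrite !weight_prod [RHS](reindex (amap s)) /=; last exact/onW_bij/amap_bij.
by apply: eq_bigr => a _; rewrite pullE.
Qed.

End Relabel.

Section Formula.

Local Open Scope ring_scope.

Variables (sig : finType) (arity : sig -> nat).
Variables (L S : sig) (arL : arity L = 2) (arS : arity S = 2).
Variables (p q : nat) (pq : p != q) (Psi : formula arity).
Hypothesis vPsi : two_vars p q Psi.
Variables (R : realFieldType) (w wbar : sig -> R).

Definition linear_successor_models : model_class arity :=
  fun n om => [/\ sat om Psi, linear_order_axiom om arL & successor_axiom om arS].

Definition models (n : nat) (om : world arity n) : bool :=
  [forall d, eval om (fun=> d) Psi].

Lemma WFOMC_orders n : WFOMC linear_successor_models n w wbar =
  \sum_(om : world arity n) weight w wbar om * (models om)%:R *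
    (\sum_(s : 'S_n) (ordered_by s (binary om arL))%:R) *
    (\sum_(s : 'S_n) (chained_by s (binary om arS))%:R).
Proof.
rewrite /WFOMC big_mkcond; apply: eq_bigr => om _.
rewrite -(indicator_sum _ (linear_orderP _)); last by move=> s s'; exact: ordered_by_inj.
rewrite -(indicator_sum _ (successor_axiomP _)); last by move=> s s'; exact: chained_by_inj.
have satE : models om <-> sat om Psi by split=> [/forallP|H] //; apply/forallP.
rewrite /linear_successor_models -!mulrA -!natrM !mulnb.
case: asboolP => [[s l c]|H].
  by rewrite (satE.2 s) !asboolT // mulr1.
rewrite (_ : [&& _, _ & _] = false) ?mulr0 //; apply/and3P => -[/satE s /asboolP l /asboolP c].
exact: H.
Qed.

Lemma ordered_pull n (om : world arity n) (s : 'S_n) :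
  ordered_by s (binary (pull om s) arL) = ordered_by 1%g (binary om arL).
Proof.
apply/ordered_byP/ordered_byP => H x y; last by rewrite binary_pull H !perm1.
have := H (s^-1%g x) (s^-1%g y).
by rewrite binary_pull !permKV !perm1.
Qed.

(** A path [t] of [om] becomes the path [s * t] of the relabelled world, so the terms are merely
    permuted. *)
Lemma sum_chained_pull n (om : world arity n) (s : 'S_n) :
  \sum_(t : 'S_n) (chained_by t (binary (pull om s) arS))%:R =
  \sum_(t : 'S_n) (chained_by t (binary om arS))%:R :> R.
Proof.
rewrite (reindex_inj (mulgI s)) /=; apply: eq_bigr => t _; congr (_%:R); congr nat_of_bool.
apply/chained_byP/chained_byP => H x y; last by rewrite binary_pull H !permM.
by have := H (s^-1%g x) (s^-1%g y); rewrite binary_pull !permM !permKV.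
Qed.

Lemma models_pull n (om : world arity n) (s : 'S_n) : models (pull om s) = models om.
Proof.
apply/forallP/forallP => H d; last by rewrite eval_pull; exact: H.
have := H (s^-1%g d); rewrite eval_pull (_ : _ \o _ = fun=> d) //.
by apply: funext => x /=; rewrite permKV.
Qed.

(** Relabelling by [s] is a weight-preserving bijection of worlds that carries the term of [s] to
    the term of the identity; the [n!] terms are equal. *)
Lemma WFOMC_fact n : WFOMC linear_successor_models n w wbar =
  n`!%:R * \sum_(t : 'S_n) \sum_(om : world arity n) weight w wbar om * (models om)%:R *
     (ordered_by 1%g (binary om arL) && chained_by t (binary om arS))%:R.
Proof.
rewrite WFOMC_orders; under eq_bigr do rewrite mulrAC big_distrr /=.
rewrite exchange_big /=.
rewrite (eq_bigr (fun=> \sum_(om : world arity n) weight w wbar om * (models om)%:R *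
   (\sum_(t : 'S_n) (chained_by t (binary om arS))%:R) *
   (ordered_by 1%g (binary om arL))%:R)); last first.
  move=> s _; rewrite (reindex (fun om : world arity n => pull om s)) /=; last first.
    exact/onW_bij/pull_bij.
  by apply: eq_bigr => om _;
    rewrite weight_pull models_pull ordered_pull sum_chained_pull.
have Sn : #|(xpredT : pred 'S_n)| = n`!%N by rewrite -card_Sn; apply: eq_card.
rewrite sumr_const Sn [RHS]mulr_natl; congr (_ *+ _).
under eq_bigr do rewrite mulrAC big_distrr /=.
rewrite exchange_big /=; apply: eq_bigr => t _; apply: eq_bigr => om _.
by rewrite -mulrA -natrM mulnb.
Qed.

Definition ok1 (th : world arity 1) : bool :=
  binary th arL ord0 ord0 && ~~ binary th arS ord0 ord0.

Definition ok2 (a b : bool) (tau : world arity 2) : bool :=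
  [&& binary tau arL ord0 ord_max, ~~ binary tau arL ord_max ord0,
      binary tau arS ord0 ord_max == a & binary tau arS ord_max ord0 == b].

(** Once the order and the path are fixed, both axioms prescribe the truth value of every single
    atom of [L] and [S], which is a condition on one or two elements. *)
Lemma ok_prod n (om : world arity n) (t : 'S_n) :
  (ordered_by 1%g (binary om arL) && chained_by t (binary om arS))%:R =
  \prod_(y < n) ((ok1 (pull om (at1 y)))%:R * \prod_(x < n | (x < y)%N)
    (ok2 (t y == (t x).+1 :> nat) (t x == (t y).+1 :> nat) (pull om (at2 x y)))%:R) :> R.
Proof.
pose f x y := (binary om arL x y == (x <= y)%N) &&
  (binary om arS x y == (t y == (t x).+1 :> nat)).
transitivity (\prod_x \prod_y (f x y)%:R : R).
  under eq_bigr do rewrite prod_bool; rewrite prod_bool; congr (_%:R); congr nat_of_bool.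
  apply/andP/forallP => [[/ordered_byP H /chained_byP H'] x|H].
    by apply/forallP => y; rewrite /f H H' !perm1 !eqxx.
  split; [apply/ordered_byP | apply/chained_byP] => x y;
    have /forallP/(_ y)/andP[/eqP H1 /eqP H2] := H x; by rewrite ?perm1.
rewrite prod_triangle; apply: eq_bigr => y _; congr (_ * _).
  rewrite /f /ok1 !binary_pull leqnn eqb_id (_ : (t y == _ :> nat) = false) ?eqbF_neg //.
  by apply/eqP; lia.
apply: eq_bigr => x xy; rewrite -natrM mulnb /f /ok2 !binary_pull /at2 /=.
rewrite (ltnW xy) leqNgt xy eqb_id eqbF_neg -!andbA.
by case: (binary om arL x y); case: (binary om arL y x); rewrite ?andbF.
Qed.

Definition cell : finType := (choices Psi * world arity 1)%type.

Definition cell_weight (c : cell) : R :=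
  part_weight w wbar setT c.2 * (ok1 c.2)%:R * unary_factor p q R c.1 c.2.

Definition pair_weight (c d : cell) (a b : bool) : R :=
  \sum_(tau : world arity 2 | (pull tau (at1 ord0) == c.2) && (pull tau (at1 ord_max) == d.2))
    part_weight w wbar setT tau * ((ok2 a b tau)%:R * binary_factor p q R c.1 d.1 tau).

(** The weight of the nullary atoms, which must enter once and not once per element. All labels
    agree on them in the terms that do not vanish, so the first element of the path can carry it. *)
Definition first_weight (c : cell) : R := part_weight w wbar set0 c.2.

Lemma sum_path n (t : 'S_n) : (0 < n)%N ->
  \sum_(om : world arity n) weight w wbar om * (models om)%:R *
     (ordered_by 1%g (binary om arL) && chained_by t (binary om arS))%:R =
  rest_weight arity w wbar n * \sum_(l : {ffun 'I_n -> cell})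
    labelled_weight cell_weight first_weight pair_weight t l.
Proof.
(* The element chosen to decide the nullary atoms is the first one on the path [t]; a nonempty
   domain provides it. *)
move=> n0; pose x0 := (t^-1%g (Ordinal n0)).
pose g (l : {ffun 'I_n -> choices Psi}) x y (tau : world arity 2) : R :=
  (ok2 (t y == (t x).+1 :> nat) (t x == (t y).+1 :> nat) tau)%:R *
  binary_factor p q R (l x) (l y) tau.
pose U (l : {ffun 'I_n -> choices Psi}) (th : {ffun 'I_n -> world arity 1}) : R :=
  \prod_y ((ok1 (th y))%:R * unary_factor p q R (l y) (th y)).
transitivity (\sum_l \sum_(th : {ffun 'I_n -> world arity 1}) U l th *
    \sum_(om : world arity n) weight w wbar om * [forall x, pull om (at1 x) == th x]%:R *
    \prod_(y < n) \prod_(x < n | (x < y)%N) g l x y (pull om (at2 x y))).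
  under [RHS]eq_bigr do under eq_bigr do rewrite big_distrr /=.
  under [RHS]eq_bigr do rewrite exchange_big /=.
  rewrite [RHS]exchange_big /=; apply: eq_bigr => om _.
  rewrite /models (sat_labels pq R vPsi om) ok_prod -mulrA big_distrl big_distrr /=.
  apply: eq_bigr => l _.
  (* In the sum over [th] only the family of actual one-element substructures of [om]
     contributes. *)
  pose th : {ffun 'I_n -> world arity 1} := [ffun x => pull om (at1 x)].
  rewrite (bigD1 th) //= [X in _ + X]big1 ?addr0 => [|th' neth]; last first.
    rewrite (_ : [forall x, _] = false) ?mulr0 ?mul0r ?mulr0 //.
    apply/negbTE; apply: contra neth => /forallP H; apply/eqP/ffunP => x.
    by rewrite ffunE; apply/eqP; rewrite eq_sym.
  rewrite (_ : [forall x, _] = true); last by apply/forallP => x; rewrite ffunE.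
  rewrite mulr1 [RHS]mulrCA; congr (_ * _); rewrite /U -!big_split /=.
  apply: eq_bigr => y _; rewrite ffunE /g big_split /=; ring.
rewrite sum_ffun_pair big_distrr; apply: eq_bigr => l _ /=.
rewrite (sum_worlds w wbar x0) /labelled_weight.
rewrite [\prod_(x < n | _) first_weight _](big_pred1 x0); last first.
  move=> x; apply/eqP/eqP => [tx|->]; last by rewrite permKV.
  by apply: (@perm_inj _ t); apply: val_inj; rewrite permKV.
rewrite /first_weight ffunE.
set A := \prod_(y < n) _; set B := \prod_(y < n) _.
have <- : U [ffun i => (l i).1] [ffun i => (l i).2] * A = B; last by ring.
rewrite /U /A /B -big_split; apply: eq_bigr => y _ /=.
rewrite !ffunE mulrA /cell_weight; congr (_ * _); first by ring.
apply: eq_bigr => x xy; rewrite /pair_weight; apply: eq_big => tau.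
  by rewrite /matches !ffunE.
by rewrite /g !ffunE.
Qed.

End Formula.

(** * Coefficients in the ring generated by the weights *)

Section Generated.

Local Open Scope ring_scope.

Variables (F : realFieldType) (W : F -> Prop).

Lemma generated_sum (I : finType) (P : pred I) (f : I -> F) :
  (forall i, P i -> generated W (f i)) -> generated W (\sum_(i | P i) f i).
Proof.
move=> gf; apply: (big_ind (generated W)) => //; first exact: (gen_bit _ false).
exact: gen_add.
Qed.

Lemma generated_prod (I : finType) (P : pred I) (f : I -> F) :
  (forall i, P i -> generated W (f i)) -> generated W (\prod_(i | P i) f i).
Proof.
move=> gf; apply: (big_ind (generated W)) => //; first exact: (gen_bit _ true).
exact: gen_mul.
Qed.

Lemma generated_moebius P s : generated W (moebius F P s).
Proof.
rewrite /moebius; case: P; first exact: gen_bit.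
case: s; last exact: (gen_bit _ true).
by rewrite expr1 -sub0r; apply: gen_sub; [exact: (gen_bit _ false) | exact: (gen_bit _ true)].
Qed.

End Generated.

(** If fewer than two names occur, the pair is completed by an arbitrary other name. *)
Lemma FO2_two_vars (sig : finType) (arity : sig -> nat) (f : formula arity) :
  FO2 f -> exists p q, p != q /\ two_vars p q f.
Proof.
rewrite /FO2 => f2.
have E p q : (forall x, x \in undup (vars f) -> x = p \/ x = q) -> two_vars p q f.
  by move=> H x xf; apply: H; rewrite mem_undup.
case: (undup _) (undup_uniq (vars f)) f2 E => [|p [|q [|? ?]]] //= u _ E.
- by exists 0, 1; split=> //; apply: E.
- exists p, p.+1; split; first by rewrite neq_ltn ltnSn.
  by apply: E => x; rewrite inE => /eqP; left.
- exists p, q; split; first by move: u; rewrite inE andbT.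
  by apply: E => x; rewrite !inE => /orP[] /eqP; [left|right].
Qed.

(** * Assembling the polynomial-time computation *)

Section Liftable.

Variables (sig : finType) (arity : sig -> nat).
Variables (L S : sig) (arL : arity L = 2) (arS : arity S = 2).
Variables (p q : nat) (pq : p != q) (Psi : formula arity).
Hypothesis vPsi : two_vars p q Psi.
Variables (F : realFieldType) (size : F -> nat) (w wbar : sig -> F).
Variable hs : height_system size (weights w wbar).

Notation gen := (generated (weights w wbar)).

Lemma generated_weights P : gen (w P) /\ gen (wbar P).
Proof. by split; apply: gen_in; exists P; [left|right]. Qed.

Lemma generated_part_weight m (D : {set 'I_m}) (om : world arity m) :
  gen (part_weight w wbar D om).
Proof.
apply: generated_prod => a _; have [gw gwbar] := generated_weights (tag a).
by rewrite /atom_weight; case: ifP.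
Qed.

Lemma generated_cell_weight c : gen (cell_weight arL arS p q w wbar c (Psi := Psi)).
Proof.
apply: gen_mul; first by apply: gen_mul; [exact: generated_part_weight | exact: gen_bit].
apply: gen_mul; last exact: gen_bit.
by apply: generated_prod => i _; apply: gen_mul; [exact: generated_moebius | exact: gen_bit].
Qed.

Lemma generated_pair_weight c d a b :
  gen (pair_weight arL arS p q w wbar c d a b (Psi := Psi)).
Proof.
apply: generated_sum => tau _; apply: gen_mul; first exact: generated_part_weight.
apply: gen_mul; first exact: gen_bit.
by apply: generated_prod => i _; apply: gen_mul; exact: gen_bit.
Qed.

Lemma WFOMC_polytime : polytime_computable size w wbar
  (fun n => WFOMC (linear_successor_models arL arS Psi) n w wbar).
Proof.
pose u := cell_weight arL arS p q w wbar (Psi := Psi).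
pose r := pair_weight arL arS p q w wbar (Psi := Psi).
pose b := first_weight w wbar (Psi := Psi).
pose c0 : cell Psi := ([ffun=> false], [ffun=> false], set0).
pose pw : seq (nat * nat * nat * nat * F) :=
  [seq (arity P, full_tuples (arity P), (0 < arity P : nat), (arity P == 0 : nat), w P + wbar P)%R
     | P <- enum sig].
have gu c : gen (u c) by exact: generated_cell_weight.
have gr c d i j : gen (r c d i j) by exact: generated_pair_weight.
have gb c : gen (b c) by exact: generated_part_weight.
have g1 : gen 1%R by exact: (gen_bit _ true).
have gbroken g : gen (broken r g).
  by case: g => [[[c|] [d|]] [|]] /=; rewrite ?/r0.
have gkept g : gen (kept b r g) by case: g => [[[c|] [d|]] [|]] /=.
apply: (polytime_computable_eq (f := fun n => value (insertions u r) (keeping b r) n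
    (initial (cell Psi)) * (n`!%:R * \prod_(x <- pw)
      x.2 ^+ tuple_count x.1.1.1.1 x.1.1.1.2 x.1.1.2 x.1.2 n))%R).
  move=> n n0; rewrite (WFOMC_fact arL arS Psi w wbar n).
  rewrite (eq_bigr _ (fun t _ => sum_path arL arS pq vPsi w wbar t n0)) -big_distrr /=.
  rewrite (sum_labelled_paths c0) rest_weightE big_map big_enum /=.
  by rewrite mulrCA; congr (_ * _)%R; rewrite mulrC.
apply: (recurrence_polytime hs (well_indexed_insertions u b r)) => //.
- by move=> j _; exact: initial_le1.
- move=> m /allpairsPdep[g [t [_ _ ->]]]; split; first exact: gen_mul.
  by move=> x /mapP[c _ ->]; exact: gr.
- by move=> x /mapP[g _ ->]; exact: gkept.
- move=> x /mapP[P _ ->]; have [gw gwbar] := generated_weights P.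
  exact: gen_add.
Qed.

End Liftable.

Theorem theorem2 (R : realType) (sig : finType) (arity : sig -> nat)
  (L S : sig) (arL : arity L = 2) (arS : arity S = 2) (LS : L <> S)
  (Psi : formula arity) (Psi_sentence : sentence Psi) (Psi_FO2 : FO2 Psi) :
  domain_liftable R
    (fun (n : nat) (om : world arity n) =>
       [/\ sat om Psi, linear_order_axiom om arL & successor_axiom om arS]).
Proof.
have [p [q [pq vPsi]]] := FO2_two_vars Psi_FO2.
split=> w wbar; first exact: (WFOMC_polytime arL arS pq vPsi (unit_height_system (weights w wbar))).
have [hs _] := bit_height_system w wbar.
exact: (WFOMC_polytime arL arS pq vPsi hs).
Qed.
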